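(* Let $\mathcal{A}$ be a nondeterministic parity automaton with $n_1$ states and priorities in $\{0,1,\dots,d_1\}$, and let $\mathcal{B}$ be a history-deterministic parity automaton with $n_2$ states and priorities in $\{0,1,\dots,d_2\}$, both over a finite alphabet $\Sigma$. Then whether $L(\mathcal{A})\subseteq L(\mathcal{B})$ can be decided in time $(n_1\cdot d_1\cdot n_2\cdot d_2\cdot|\Sigma|)^{\mathcal{O}(\log d_2)}$.
   Context: A nondeterministic parity automaton $(Q,\Sigma,q_0,\Delta,\Omega)$ has finite state set $Q$, initial state $q_0$, transitions $\Delta\subseteq Q\times\Sigma\times Q$ and priority function $\Omega:\Delta\to\mathbb{N}$; a run on an infinite word is accepting if the highest priority occurring infinitely often is even, and $L(\cdot)$ denotes the set of infinite words having an accepting run. An automaton is history-deterministic if Eve wins its letter game: in each of infinitely many rounds Adam picks a letter and Eve picks a transition on that letter from her current state (starting at $q_0$); Eve wins if, whenever Adam's infinite word is in the language, her run is accepting. *)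

(* Defs.v *)
From mathcomp Require Import all_boot.
Set Implicit Arguments. Unset Strict Implicit. Unset Printing Implicit Defensive.

(* Nondeterministic parity automata over the alphabet 'I_k with state  *)
(* set 'I_n (any finite state set can be relabelled this way).         *)
(* Transitions Delta are given by a boolean relation; the priority     *)
(* function Omega : Delta -> nat is given as a function on triples,    *)
(* only its values on Delta are meaningful.                            *)
Record npa (k n : nat) := NPA {
  npa_init  : 'I_n ;
  npa_trans : 'I_n -> 'I_k -> 'I_n -> bool ;
  npa_prio  : 'I_n -> 'I_k -> 'I_n -> nat }.

Definition word (k : nat) := nat -> 'I_k.

Definition prio_bounded k n (A : npa k n) (d : nat) : Prop :=
  forall p a q, npa_trans A p a q -> npa_prio A p a q <= d.

Definition is_run k n (A : npa k n) (w : word k) (r : nat -> 'I_n) : Prop :=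
  r 0 = npa_init A /\ forall i, npa_trans A (r i) (w i) (r i.+1).

Definition run_prio k n (A : npa k n) (w : word k) (r : nat -> 'I_n) (i : nat) :=
  npa_prio A (r i) (w i) (r i.+1).

Definition inf_often (P : nat -> Prop) : Prop := forall m, exists i, m <= i /\ P i.

Definition parity_accepting (pr : nat -> nat) : Prop :=
  exists p, inf_often (fun i => pr i = p) /\
            (forall q, inf_often (fun i => pr i = q) -> q <= p) /\
            ~~ odd p.

Definition accepting_run k n (A : npa k n) (w : word k) (r : nat -> 'I_n) : Prop :=
  is_run A w r /\ parity_accepting (run_prio A w r).

Definition lang k n (A : npa k n) (w : word k) : Prop :=
  exists r, accepting_run A w r.

Definition prefix k (w : word k) (i : nat) : seq 'I_k := mkseq w i.

(* Eve's strategies in the letter game: after Adam has played letters  *)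
(* w 0, ..., w i, Eve chooses the next state (i.e. the transition from *)
(* her current state on letter w i to that state).                     *)
Definition strategy k n := seq 'I_k -> 'I_n.

Definition strat_run k n (A : npa k n) (s : strategy k n) (w : word k) : nat -> 'I_n :=
  fun i => if i is i'.+1 then s (prefix w i'.+1) else npa_init A.

Definition history_deterministic k n (A : npa k n) : Prop :=
  exists s : strategy k n, forall w, lang A w -> accepting_run A w (strat_run A s w).

Definition sym := option bool.   (* None = blank *)
Inductive dir := DLeft | DRight.

Record TM := {
  tm_state : finType ;
  tm_start : tm_state ;
  tm_halt  : tm_state -> option bool ;  (* Some b : halting state with answer b *)
  tm_step  : tm_state -> sym -> tm_state * sym * dir }.

Definition config (M : TM) : Type := (tm_state M * seq sym * sym * seq sym)%type.

Definition tm_next (M : TM) (c : config M) : config M :=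
  let: (q, L, h, R) := c in
  if tm_halt q is Some _ then c else
  let: (q', s', d) := tm_step q h in
  match d with
  | DLeft => match L with
             | x :: L' => (q', L', x, s' :: R)
             | [::] => (q', [::], None, s' :: R) end
  | DRight => match R with
             | x :: R' => (q', s' :: L, x, R')
             | [::] => (q', s' :: L, None, [::]) end
  end.

Definition tm_init (M : TM) (x : seq bool) : config M :=
  match x with
  | [::] => (tm_start M, [::], None, [::])
  | b :: x' => (tm_start M, [::], Some b, map Some x')
  end.

Definition tm_iter (M : TM) (t : nat) (c : config M) : config M := iter t (@tm_next M) c.

Definition halts_within (M : TM) (x : seq bool) (t : nat) (b : bool) : Prop :=
  exists s, s <= t /\ tm_halt (@tm_iter M s (@tm_init M x)).1.1.1 = Some b.

(* Input encoding (unary numbers, self-delimiting).                    *)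
Definition enc_nat (m : nat) : seq bool := rcons (nseq m true) false.

Definition enc_npa k n (A : npa k n) : seq bool :=
  enc_nat n ++ enc_nat (npa_init A) ++
  flatten [seq enc_nat (npa_trans A pa.1 pa.2 q) ++
               enc_nat (if npa_trans A pa.1 pa.2 q then npa_prio A pa.1 pa.2 q else 0)
          | pa <- [seq (p, a) | p <- enum 'I_n, a <- enum 'I_k], q <- enum 'I_n].

Definition enc_pair k n1 n2 (A : npa k n1) (B : npa k n2) : seq bool :=
  enc_nat k ++ enc_npa A ++ enc_npa B.

(* Main.v *)
From Stdlib Require Import ZArith Lia Classical FunctionalExtensionality IndefiniteDescription.
Require Import Defs.
From mathcomp Require Import all_boot.
From mathcomp Require Import zify.
Set Implicit Arguments. Unset Strict Implicit. Unset Printing Implicit Defensive.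

(** For an even priority e, let Adam build a run of A and Eve a run of B letter
    by letter, Eve losing if e is the largest priority that Adam sees infinitely
    often while her own run is rejecting.  Since B is history-deterministic, the
    inclusion holds iff Eve wins all these games: its resolver is a winning
    strategy if the inclusion holds, and conversely a winning strategy turns
    accepting runs of A into accepting runs of B.  Remembering the largest
    priority of B since the last occurrence of e makes each of them a parity
    game with polynomially many positions N and O(d2) priorities.

    Such a game is won by Eve iff its positions can be labelled by leaves of a
    universal tree so that she can always move along the order of the tree
    prescribed by the current priority.  Here the leaves are the lists of about
    log N digits between -h and h, with h in O(d2), ordered lexicographically,
    the ancestor at height j being obtained by cutting at the first digit of
    absolute value below j; there are N^O(log d2) of them.  Labels exclude odd
    plays because an odd maximal priority would yield an infinite descent.
    Conversely, the stages of the nested fixed point defining the winning region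
    label its positions by lists of numbers, which embed into the tree by
    splitting at a median of the first component.  The dual fixed point provides
    Adam with a positional strategy on the other positions, which beats the
    resolver.

    The machine stores the set of pairs (position, leaf) found to be losing and
    sweeps over all pairs until it is stable. *)

(** * Structured tape programs *)

(** In the undivided game Eve wins if the run of A is rejecting or her own is accepting: a
    disjunction of two parity conditions, not one parity condition. With e fixed, only the
    priorities of B remain to be compared, so d1 counts games and stays out of the exponent. The
    inclusion allows this division: it speaks of one run of A, whose limit e is known in advance, so
    Eve may use a separate strategy for each e. The time bound comes from the shape of the labels:
    about log N digits in base 2h+1 give (2h+1)^(log N) = N^(log (2h+1)) leaves, so log N leaves the
    exponent. The machine knows neither d1 nor d2: the largest priority written for B and the length
    of the unary input replace them. Its numbers are unary as well, so that recursion with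
    polynomially bounded values runs in polynomial time; the number of leaves, which is not so
    bounded, is computed once by a separate loop and is an argument from then on. *)

Inductive prog :=
| Mv of dir
| Wr of sym & dir
| Seq of prog & prog
| Ite of (sym -> bool) & prog & prog
| Whl of (sym -> bool) & prog.

Definition tape := Z -> sym.
Definition upd (T : tape) (p : Z) (s : sym) : tape :=
  fun q => if Z.eqb q p then s else T q.

(* Coordinates grow to the left: the workspace lies left of the input. *)
Definition mv (d : dir) (p : Z) : Z :=
  match d with DLeft => p + 1 | DRight => p - 1 end%Z.

Inductive exec : prog -> Z * tape -> nat -> Z * tape -> Prop :=
| ExMv d p T : exec (Mv d) (p, T) 1 (mv d p, T)
| ExWr s d p T : exec (Wr s d) (p, T) 1 (mv d p, upd T p s)
| ExSeq P Q c1 c2 c3 m n : exec P c1 m c2 -> exec Q c2 n c3 -> exec (Seq P Q) c1 (m + n) c3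
| ExIteT (t : sym -> bool) P Q p T n c : t (T p) -> exec P (p, T) n c -> exec (Ite t P Q) (p, T) n.+2 c
| ExIteF (t : sym -> bool) P Q p T n c : ~~ t (T p) -> exec Q (p, T) n c -> exec (Ite t P Q) (p, T) n.+2 c
| ExWhlF (t : sym -> bool) P p T : ~~ t (T p) -> exec (Whl t P) (p, T) 2 (p, T)
| ExWhlT (t : sym -> bool) P p T m c n c' : t (T p) -> exec P (p, T) m c -> exec (Whl t P) c n c' ->
    exec (Whl t P) (p, T) (m + n).+2 c'.

(** * Compilation of structured programs to Turing machines *)

Definition instr := sym -> nat * sym * dir.

Definition imv d k : instr := fun s => (k, s, d).
Definition iwr s d k : instr := fun _ => (k, s, d).
(* A machine must move at each step, so a test moves left and comes back. *)
Definition itest (t : sym -> bool) k1 k2 : instr :=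
  fun s => (if t s then k1 else k2, s, DLeft).

Fixpoint psize (P : prog) : nat :=
  match P with
  | Mv _ | Wr _ _ => 1
  | Seq P Q => psize P + psize Q
  | Ite _ P Q => (psize P + psize Q).+3
  | Whl _ P => (psize P).+3
  end.

Lemma psize_gt0 P : 0 < psize P.
Proof. by elim: P => //= P IP Q _; rewrite ltn_addr. Qed.

Fixpoint asm (P : prog) (o k : nat) : seq instr :=
  match P with
  | Mv d => [:: imv d k]
  | Wr s d => [:: iwr s d k]
  | Seq P Q => asm P o (o + psize P) ++ asm Q (o + psize P) k
  | Ite t P Q =>
      [:: itest t o.+1 o.+2; imv DRight o.+3; imv DRight (o.+3 + psize P)]
      ++ asm P o.+3 k ++ asm Q (o.+3 + psize P) k
  | Whl t P =>
      [:: itest t o.+1 o.+2; imv DRight o.+3; imv DRight k] ++ asm P o.+3 o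
  end.

Lemma size_asm P o k : size (asm P o k) = psize P.
Proof.
elim: P o k => //= [P IP Q IQ|t P IP Q IQ|t P IP] o k.
- by rewrite size_cat IP IQ.
- by rewrite size_cat IP IQ.
- by rewrite IP.
Qed.

Section Machine.
Variable code : seq instr.

Definition machine : TM :=
  {| tm_state := 'I_(size code).+2;
     tm_start := ord0;
     tm_halt := fun q => if nat_of_ord q == size code then Some true
                         else if nat_of_ord q == (size code).+1 then Some false else None;
     tm_step := fun q s =>
       let: (k, s', d) := nth (imv DLeft 0) code q s in (inord k, s', d) |}.

(** Reading the lists with the default blank makes the relation insensitive to trailing blanks. The
    left list runs through increasing coordinates. *)
Definition repc (c : config machine) (pc : nat) (x : Z * tape) : Prop :=
  let: (q, L, h, R) := c in let: (p, T) := x in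
  [/\ nat_of_ord q = pc, h = T p,
      forall i, nth None L i = T (p + 1 + Z.of_nat i)%Z &
      forall i, nth None R i = T (p - 1 - Z.of_nat i)%Z].

Lemma repc_step c pc p T k s d :
  repc c pc (p, T) -> pc < size code -> k <= (size code).+1 ->
  nth (imv DLeft 0) code pc (T p) = (k, s, d) ->
  repc (tm_next c) k (mv d p, upd T p s).
Proof.
case: c => [[[q L] h] R] [qE hE LE RE] pc_lt k_le stepE.
rewrite /tm_next /= qE !ltn_eqF ?leqW // hE stepE.
have kE : nat_of_ord (inord k : 'I_(size code).+2) = k by rewrite inordK.
have updN q' : q' <> p -> upd T p s q' = T q'.
  by rewrite /upd; case: Z.eqb_spec.
have updE : upd T p s p = s by rewrite /upd Z.eqb_refl.
case: d {stepE} => /=.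
- have h0 : T (p + 1)%Z = nth None L 0 by rewrite LE; congr T; lia.
  have sh i : T (p + 1 + 1 + Z.of_nat i)%Z = nth None (behead L) i.
    by rewrite nth_behead LE; congr T; lia.
  have sR i : nth None (s :: R) i = upd T p s (p + 1 - 1 - Z.of_nat i)%Z.
    case: i => [|i] /=.
      by rewrite (_ : (_ - _)%Z = p) ?updE //; lia.
    rewrite updN; last by lia.
    by rewrite RE; congr T; lia.
  case: L LE h0 sh => [|x L] LE h0 sh; split=> //; rewrite ?updN ?h0 //=; try lia;
    by move=> i; rewrite updN ?sh ?nth_nil //; lia.
- have h0 : T (p - 1)%Z = nth None R 0 by rewrite RE; congr T; lia.
  have sh i : T (p - 1 - 1 - Z.of_nat i)%Z = nth None (behead R) i.
    by rewrite nth_behead RE; congr T; lia.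
  have sL i : nth None (s :: L) i = upd T p s (p - 1 + 1 + Z.of_nat i)%Z.
    case: i => [|i] /=.
      by rewrite (_ : (_ + _)%Z = p) ?updE //; lia.
    rewrite updN; last by lia.
    by rewrite LE; congr T; lia.
  case: R RE h0 sh => [|x R] RE h0 sh; split=> //; rewrite ?updN ?h0 //=; try lia;
    by move=> i; rewrite updN ?sh ?nth_nil //; lia.
Qed.

(** Moves and tests are treated as writing back the scanned symbol, which gives back the tape only
    up to pointwise equality. *)
Lemma repc_ext c pc p T T' :
  T =1 T' -> repc c pc (p, T) -> repc c pc (p, T').
Proof.
by move=> eT; case: c => [[[q L] h] R] [? ? LE RE]; split; rewrite -?eT // => i; rewrite -eT.
Qed.

Lemma upd_id T p : upd T p (T p) =1 T.
Proof. by move=> q; rewrite /upd; case: Z.eqb_spec => [->|]. Qed.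

Lemma repc_test c pc p T k1 k2 k t :
  repc c pc (p, T) -> pc < size code ->
  (if t (T p) then k1 else k2) < size code -> k <= (size code).+1 ->
  nth (imv DLeft 0) code pc = itest t k1 k2 ->
  nth (imv DLeft 0) code (if t (T p) then k1 else k2) = imv DRight k ->
  repc (iter 2 (@tm_next machine) c) k (p, T).
Proof.
move=> rc pc_lt j_lt k_le e1 e2.
have r1 : repc (tm_next c) (if t (T p) then k1 else k2) (mv DLeft p, T).
  apply: repc_ext (upd_id T p) _.
  by apply: (repc_step rc pc_lt (ltnW (leqW j_lt))); rewrite e1.
have r2 : repc (tm_next (tm_next c)) k (mv DRight (mv DLeft p), T).
  apply: repc_ext (upd_id T (mv DLeft p)) _.
  by apply: (repc_step r1) => //; rewrite e2.
by rewrite (_ : p = mv DRight (mv DLeft p)) // /mv; lia.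
Qed.

Definition code_at (o : nat) (s : seq instr) : Prop :=
  o + size s <= size code /\
  forall i, i < size s -> nth (imv DLeft 0) code (o + i) = nth (imv DLeft 0) s i.

Lemma code_at_cat o s1 s2 :
  code_at o (s1 ++ s2) -> code_at o s1 /\ code_at (o + size s1) s2.
Proof.
rewrite /code_at size_cat => -[le E]; split; split; try lia.
- by move=> i lti; rewrite E ?nth_cat ?lti //; lia.
- move=> i lti; rewrite -addnA E ?nth_cat; last by lia.
  by rewrite ltnNge leq_addr /= addKn.
Qed.

(** Induction on the execution, for all addresses [o] and continuations [k]: the body of a loop is
    compiled with the loop itself as its continuation. *)
Lemma asm_correct P x n y o k c :
  exec P x n y -> code_at o (asm P o k) -> k < size code -> repc c o x ->
  repc (iter n (@tm_next machine) c) k y.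
Proof.
move=> e; elim: e o k c => {P x n y}
  [d p T|s d p T|P Q c1 c2 c3 m n _ IP _ IQ|t P Q p T n c' tT _ IH|t P Q p T n c' tF _ IH
  |t P p T tF|t P p T m c1 n c' tT _ IP _ IW] o k c.
- move=> [le E] kl rc; move: (E 0 isT) le; rewrite addn0 addn1 /= => e le.
  apply: repc_ext (upd_id T p) _.
  by apply: (repc_step rc) => //; [lia|rewrite e].
- move=> [le E] kl rc; move: (E 0 isT) le; rewrite addn0 addn1 /= => e le.
  by apply: (repc_step rc) => //; [lia|rewrite e].
- move=> /= /code_at_cat [cP]; rewrite size_asm => cQ kl rc.
  rewrite addnC iterD; apply: (IQ (o + psize P)) => //.
  apply: (IP o) => //; case: cQ; rewrite size_asm.
  by have := psize_gt0 Q; lia.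
- move=> cc kl rc; rewrite -addn2 iterD.
  case/code_at_cat: (cc); rewrite /= addn3 => -[le E] /code_at_cat [cP _].
  apply: (IH o.+3) => //.
  have := E 0 isT; have := E 1 isT; rewrite /= addn0 addn1 => E1 E0; rewrite /= in le.
  apply: (repc_test rc _ _ _ E0); rewrite ?tT //; try lia.
- move=> cc kl rc; rewrite -addn2 iterD.
  case/code_at_cat: (cc); rewrite /= addn3 => -[le E] /code_at_cat [_ cQ].
  rewrite size_asm in cQ; apply: (IH (o.+3 + psize P)) => //.
  have := E 0 isT; have := E 2 isT; rewrite /= addn0 addn2 => E1 E0; rewrite /= in le.
  apply: (repc_test rc _ _ _ E0); rewrite ?(negbTE tF) //; try lia.
  by case: cQ; lia.
- move=> cc kl rc; case/code_at_cat: (cc); rewrite /= addn3 => -[le E] _.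
  have := E 0 isT; have := E 2 isT; rewrite /= addn0 addn2 => E1 E0; rewrite /= in le.
  apply: (repc_test rc _ _ _ E0); rewrite ?(negbTE tF) //; try lia.
- move=> cc kl rc; rewrite -addn2 addnAC addnC iterD.
  apply: (IW o) => //; rewrite iterD.
  case/code_at_cat: (cc); rewrite /= addn3 => -[le E] cP.
  have := E 0 isT; have := E 1 isT; rewrite /= addn0 addn1 => E1 E0; rewrite /= in le.
  apply: (IP o.+3) => //; first lia.
  apply: (repc_test rc _ _ _ E0); rewrite ?tT //; try lia.
Qed.

End Machine.

(* For an empty alphabet the time bound is 1, so the first instruction answers. *)
Definition full_code (P : prog) : seq instr :=
  (fun s => (if s == Some false then (psize P).+2 else 1, s, DLeft))
  :: asm P 1 (psize P).+1
  ++ [:: fun s => (if s == Some true then (psize P).+2 else (psize P).+3, s, DLeft)].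

Definition input_tape (x : seq bool) : tape :=
  fun z => if Z.leb z (-2)%Z then nth None (map Some x) (Z.to_nat (-2 - z)%Z) else None.

Lemma size_full P : size (full_code P) = (psize P).+2.
Proof. by rewrite /= size_cat size_asm addn1. Qed.

Lemma repc_init P x : repc (@tm_init (machine (full_code P)) x) 0 (-2, input_tape x)%Z.
Proof.
have far i : input_tape x (-2 + 1 + Z.of_nat i)%Z = None.
  by rewrite /input_tape; case: Z.leb_spec => //; lia.
have nr i : input_tape x (-2 - Z.of_nat i)%Z = nth None (map Some x) i.
  by rewrite /input_tape; case: Z.leb_spec => [_|]; [congr nth; lia|lia].
case: x far nr => [|b x] far nr; split=> //.
- by move=> i; rewrite nth_nil far.
- by move=> i; rewrite nth_nil (_ : _ - _ = -2 - Z.of_nat i.+1)%Z ?nr //; lia.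
- by move=> i; rewrite nth_nil far.
- by move=> i; rewrite (_ : _ - _ = -2 - Z.of_nat i.+1)%Z ?nr //; lia.
Qed.

Lemma machine_false P x : halts_within (machine (full_code P)) (false :: x) 1 true.
Proof.
exists 1; split=> //; rewrite /tm_iter /=.
by rewrite size_cat size_asm /= addn1 inordK ?eqxx.
Qed.

Lemma machine_run P x n p T :
  exec P (-1, input_tape (true :: x))%Z n (p, T) ->
  halts_within (machine (full_code P)) (true :: x) n.+2 (T p == Some true).
Proof.
move=> e; set M := machine _; exists n.+2; split=> //.
have r0 := repc_init P (true :: x); rewrite -/M in r0.
have sz := size_full P.
have r1 : repc (tm_next (@tm_init M (true :: x))) 1 (-1, input_tape (true :: x))%Z.
  apply: repc_ext (upd_id _ (-2)%Z) _.
  by apply: (@repc_step _ _ _ _ _ 1 _ DLeft r0); rewrite ?sz.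
have cat : code_at (full_code P) 1 (asm P 1 (psize P).+1).
  split; first by rewrite size_asm sz; lia.
  by move=> i; rewrite size_asm => lti; rewrite /= nth_cat size_asm lti.
have := asm_correct e cat; rewrite sz => /(_ _ (leqnn _) r1).
set c := iter n _ _ => r2.
have r3 : repc (tm_next c) (if T p == Some true then (psize P).+2 else (psize P).+3)
               (mv DLeft p, upd T p (T p)).
  apply: (repc_step r2); rewrite ?sz; first lia.
    by case: ifP; lia.
  by rewrite /= nth_cat size_asm ltnn subnn.
rewrite (_ : tm_iter _ _ = tm_next c); last first.
  by rewrite /tm_iter -addn2 addnC iterD /= /c -iterSr.
move: r3; case: (tm_next c) => [[[q L] h] R] [qE _ _ _] /=.
rewrite qE size_cat size_asm addn1.
by case: (T p == _); rewrite ?eqxx // eqn_leq ltnn.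
Qed.

(** * Registers and bit arrays on the tape *)

Definition runs (P : prog) (x y : Z * tape) (n : nat) : Prop :=
  exists2 m, m <= n & exec P x m y.

Lemma runs_le P x y m n : m <= n -> runs P x y m -> runs P x y n.
Proof. by move=> mn [k km e]; exists k => //; apply: leq_trans mn. Qed.

Lemma runs_seq P Q x y z m n : runs P x y m -> runs Q y z n -> runs (Seq P Q) x z (m + n).
Proof.
move=> [m' lm eP] [n' ln eQ]; exists (m' + n'); first exact: leq_add.
exact: ExSeq eP eQ.
Qed.

Definition marked (s : sym) : bool := s == Some true.
Definition unmarked (s : sym) : bool := ~~ marked s.

(** There is no empty program, so the move by 0 goes left and comes back; hence two steps more than
    [n]. *)
Fixpoint mvs (d : dir) (n : nat) : prog :=
  if n is n'.+1 then Seq (Mv d) (mvs d n') else Seq (Mv DLeft) (Mv DRight).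

Lemma runs_left n p T : runs (mvs DLeft n) (p, T) (p + Z.of_nat n, T)%Z n.+2.
Proof.
elim: n p => [|n IH] p /=.
  exists 2 => //; rewrite (_ : p + 0 = mv DRight (mv DLeft p))%Z; last by rewrite /mv /=; lia.
  exact: (ExSeq (ExMv _ _ _) (ExMv _ _ _)).
rewrite -[n.+3]add1n; apply: (@runs_seq _ _ _ (p + 1, T)%Z).
  by exists 1 => //; exact: (ExMv DLeft).
by have := IH (p + 1)%Z; rewrite (_ : p + 1 + Z.of_nat n = p + Z.of_nat n.+1)%Z //; lia.
Qed.

Lemma runs_right n p T : runs (mvs DRight n) (p, T) (p - Z.of_nat n, T)%Z n.+2.
Proof.
elim: n p => [|n IH] p /=.
  exists 2 => //; rewrite (_ : p - 0 = mv DRight (mv DLeft p))%Z; last by rewrite /mv /=; lia.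
  exact: (ExSeq (ExMv _ _ _) (ExMv _ _ _)).
rewrite -[n.+3]add1n; apply: (@runs_seq _ _ _ (p - 1, T)%Z).
  by exists 1 => //; exact: (ExMv DRight).
by have := IH (p - 1)%Z; rewrite (_ : p - 1 - Z.of_nat n = p - Z.of_nat n.+1)%Z //; lia.
Qed.

Lemma runs_whl (t : sym -> bool) P (f : nat -> Z * tape) m c :
  (forall i, i < m -> t ((f i).2 (f i).1) /\ runs P (f i) (f i.+1) c) ->
  ~~ t ((f m).2 (f m).1) -> runs (Whl t P) (f 0) (f m) (m * (c + 2) + 2).
Proof.
elim: m f => [|m IH] f H tm.
  by exists 2 => //; case: (f 0) tm => p T /= tm; exact: ExWhlF.
have [t0 [k kc e]] := H 0 isT.
have [|k' k'c e'] := IH (fun i => f i.+1) _ tm.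
  by move=> i im; exact: H.
exists (k + k').+2; first by rewrite mulSn; lia.
by case: (f 0) t0 e => p T /= t0 e; exact: ExWhlT e e'.
Qed.

Record st := St { reg : nat -> nat; bits : bool -> nat -> bool; inp : seq bool }.

Definition setr (s : st) (r v : nat) : st :=
  St (fun q => if q == r then v else reg s q) (bits s) (inp s).
Definition setm (s : st) (a : bool) (k : nat) : st :=
  St (reg s) (fun b i => ((b == a) && (i == k)) || bits s b i) (inp s).

Lemma st_eq s s' :
  reg s =1 reg s' -> (forall a, bits s a =1 bits s' a) -> inp s = inp s' -> s = s'.
Proof.
case: s => g m x; case: s' => g' m' x' /= eg em ex.
congr St => //; first exact: functional_extensionality.
by do 2!apply: functional_extensionality => ?; exact: em.
Qed.

Lemma setr_same s r : setr s r (reg s r) = s.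
Proof. by apply: st_eq => //= q; case: eqP => // ->. Qed.

Lemma setr_setr s r u v : setr (setr s r u) r v = setr s r v.
Proof. by apply: st_eq => //= q; case: eqP. Qed.

Lemma reg_setr s r v : reg (setr s r v) r = v.
Proof. by rewrite /= eqxx. Qed.

Definition atrack (a : bool) : nat := if a then 1 else 2.

Section Tracks.
Variable K : nat.
Hypothesis K4 : 3 < K.

(* The workspace is cut into cells of K squares; square j of cell i carries
   position i of track j, a set bit being Some true.  Track 0 marks the cell 0,
   tracks 1 and 2 are the two bit arrays, the other tracks are registers in
   unary. *)
Definition cell (i j : nat) : Z := Z.of_nat (K * i + j).

Definition rep (s : st) (T : tape) : Prop :=
  [/\ forall i, marked (T (cell i 0)) = (i == 0),
      forall a i, marked (T (cell i (atrack a))) = bits s a i,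
      forall r i, 2 < r < K -> marked (T (cell i r)) = (i < reg s r),
      T (-1)%Z = None &
      forall i, T (-2 - Z.of_nat i)%Z = nth None (map Some (inp s)) i].

(** Every program starts and ends on square 0, so that state transformers compose without mention of
    the head. *)
Variant RT (P : prog) (s s' : st) (n : nat) : Prop :=
  MkRT of forall T, rep s T -> exists2 T', rep s' T' & runs P (0%Z, T) (0%Z, T') n.

Lemma RT_le P s s' m n : m <= n -> RT P s s' m -> RT P s s' n.
Proof. by move=> mn [H]; split=> T /H[T' r' e]; exists T' => //; exact: runs_le e. Qed.

Lemma RT_seq P Q s1 s2 s3 m n : RT P s1 s2 m -> RT Q s2 s3 n -> RT (Seq P Q) s1 s3 (m + n).
Proof.
move=> [HP] [HQ]; split=> T /HP[T1 r1 e1]; have [T2 r2 e2] := HQ _ r1.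
by exists T2 => //; exact: runs_seq e1 e2.
Qed.

Lemma cell_inj i j i' j' : j < K -> j' < K -> cell i j = cell i' j' -> i = i' /\ j = j'.
Proof.
move=> jK jK' /Nat2Z.inj e; have K0 : 0 < K by lia.
have /(congr1 (fun x => x %/ K)) : i * K + j = i' * K + j' by rewrite ![_ * K]mulnC.
by rewrite !divnMDl // !divn_small // !addn0 => ei; move: e; rewrite ei => /addnI.
Qed.

Lemma upd_cell T i j b i' j' : j < K -> j' < K ->
  marked (upd T (cell i j) b (cell i' j')) =
  if (i' == i) && (j' == j) then marked b else marked (T (cell i' j')).
Proof.
move=> jK jK'; rewrite /upd; case: Z.eqb_spec => [/(cell_inj jK' jK)[-> ->]|ne].
  by rewrite !eqxx.
by case: eqP => // ei; case: eqP => // ej; case: ne; rewrite ei ej.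
Qed.

Lemma upd_neg T i j b z : (z < 0)%Z -> upd T (cell i j) b z = T z.
Proof. by rewrite /upd /cell => z0; case: Z.eqb_spec => // e; lia. Qed.

Lemma atrack_lt a : atrack a < 3. Proof. by case: a. Qed.
Lemma atrack_gt0 a : 0 < atrack a. Proof. by case: a. Qed.

Lemma rep_setr s T r v (i : nat) b : 2 < r < K -> rep s T ->
  (forall q : nat, q != i -> (q < v) = (q < reg s r)) -> (i < v) = marked b ->
  rep (setr s r v) (upd T (cell i r) b).
Proof.
move=> rK [r0 r1 r2 r3 r4] H1 H2; have rltK : r < K by lia.
split=> [q|a q|r' q r'K||q].
- by rewrite upd_cell; try lia; rewrite (_ : 0 == r = false) ?andbF //; lia.
- have aK := atrack_lt a; rewrite upd_cell; try lia.
  by rewrite (_ : atrack a == r = false) ?andbF ?r1 //; lia.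
- rewrite upd_cell /=; try lia.
  case: (r' =P r) => [->|_]; last by rewrite andbF r2.
  case: (q =P i) => [-> //|/eqP qi] /=; by rewrite r2 // H1.
- by rewrite upd_neg.
- by rewrite upd_neg ?r4 //; lia.
Qed.

Lemma rep_setm s T a i : rep s T -> rep (setm s a i) (upd T (cell i (atrack a)) (Some true)).
Proof.
have aK := atrack_lt a; have a0 := atrack_gt0 a.
move=> [r0 r1 r2 r3 r4]; split=> [q|a' q|r' q r'K||q].
- by rewrite upd_cell; try lia; rewrite (_ : 0 == _ = false) ?andbF //; lia.
- have a'K := atrack_lt a'; rewrite upd_cell /=; try lia.
  have -> : (atrack a' == atrack a) = (a' == a) by case: (a) (a') => [] [].
  by rewrite andbC; case: ifP => //= _; rewrite r1.
- rewrite upd_cell /=; try lia.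
  by rewrite (_ : r' == _ = false) ?andbF ?r2 //; lia.
- by rewrite upd_neg.
- by rewrite upd_neg ?r4 //; lia.
Qed.

(** The first unmarked square of a unary register lies in the cell whose index is its value. It is
    the square to fill for an increment, and its cell contains the array entries to which the
    register points. *)
Definition seek (r : nat) : prog := Seq (mvs DLeft r) (Whl marked (mvs DLeft K)).
Definition home (a : nat) : prog := Seq (mvs DRight a) (Whl unmarked (mvs DRight K)).

Lemma runs_seek s T r : 2 < r < K -> rep s T ->
  runs (seek r) (0%Z, T) (cell (reg s r) r, T) ((reg s r).+1 * (K + 4)).
Proof.
move=> rK [_ _ r2 _ _]; pose f i := (cell i r, T).
apply: (@runs_le _ _ _ (r.+2 + (reg s r * (K.+2 + 2) + 2))); first by rewrite mulSn; lia.
apply: (@runs_seq _ _ _ (f 0)).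
  by rewrite /f (_ : cell 0 r = 0 + Z.of_nat r)%Z; [exact: runs_left|rewrite /cell; lia].
apply: runs_whl => [i im|]; rewrite /f /= r2 //; last by rewrite ltnn.
split=> //; rewrite (_ : cell i.+1 r = cell i r + Z.of_nat K)%Z; first exact: runs_left.
by rewrite /cell mulnS; lia.
Qed.

Lemma runs_home T i a : (forall i, marked (T (cell i 0)) = (i == 0)) -> a < K ->
  runs (home a) (cell i a, T) (0%Z, T) (i.+1 * (K + 4)).
Proof.
move=> r0 aK; pose f q := (cell (i - q) 0, T).
apply: (@runs_le _ _ _ (a.+2 + (i * (K.+2 + 2) + 2))); first by rewrite mulSn; lia.
apply: (@runs_seq _ _ _ (f 0)).
  rewrite /f (_ : cell (i - 0) 0 = cell i a - Z.of_nat a)%Z; first exact: runs_right.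
  by rewrite /cell; lia.
rewrite (_ : (0%Z, T) = f i); last by rewrite /f subnn /cell; congr pair; lia.
apply: runs_whl => [q qi|]; rewrite /f /unmarked /= r0; last by rewrite subnn.
split; first by lia.
rewrite (_ : cell (i - q.+1) 0 = cell (i - q) 0 - Z.of_nat K)%Z; first exact: runs_right.
by rewrite /cell (_ : i - q = (i - q.+1).+1) ?mulnS; lia.
Qed.

Definition inc (r : nat) : prog := Seq (seek r) (Seq (Wr (Some true) DRight) (home r.-1)).
Definition dec (r : nat) : prog :=
  Seq (seek r) (Seq (mvs DRight K) (Seq (Wr None DRight) (home r.-1))).
Definition setbit (a : bool) (r : nat) : prog :=
  Seq (seek r) (Seq (mvs DRight (r - atrack a))
    (Seq (Wr (Some true) DRight) (home (atrack a).-1))).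
Definition getbit (a : bool) (r d : nat) : prog :=
  Seq (seek r) (Seq (mvs DRight (r - atrack a))
    (Ite marked (Seq (home (atrack a)) (inc d)) (home (atrack a)))).
(** A register is non-zero iff its square in cell 0 is marked, so the test needs only a fixed
    move. *)
Definition whilenz (r : nat) (P : prog) : prog :=
  Seq (mvs DLeft r) (Seq (Whl marked (Seq (mvs DRight r) (Seq P (mvs DLeft r)))) (mvs DRight r)).

Lemma runs_wr s T i j : 0 < j ->
  runs (Wr s DRight) (cell i j, T) (cell i j.-1, upd T (cell i j) s) 1.
Proof.
move=> j0; exists 1 => //; rewrite (_ : cell i j.-1 = mv DRight (cell i j)).
  exact: ExWr.
by rewrite /mv /cell /=; lia.
Qed.

Lemma RT_inc s r : 2 < r < K -> RT (inc r) s (setr s r (reg s r).+1) ((reg s r).+1 * (4 * (K + 4))).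
Proof.
move=> rK; split=> T rT; exists (upd T (cell (reg s r) r) (Some true)).
  apply: rep_setr => //; last by rewrite ltnSn.
  by move=> q; rewrite ltnS leq_eqVlt => /negbTE ->.
have [r0 _ _ _ _] := rT.
apply: (@runs_le _ _ _ ((reg s r).+1 * (K + 4) + (1 + (reg s r).+1 * (K + 4)))); first by lia.
apply: runs_seq (runs_seek rK rT) _.
apply: runs_seq (runs_wr _ _ _ _) _; first by lia.
apply: runs_home; last by lia.
by move=> i; rewrite upd_cell ?r0; try lia; rewrite (_ : 0 == r = false) ?andbF //; lia.
Qed.

Lemma RT_dec s r : 2 < r < K -> 0 < reg s r ->
  RT (dec r) s (setr s r (reg s r).-1) ((reg s r).+1 * (4 * (K + 4))).
Proof.
move=> rK v0; split=> T rT; exists (upd T (cell (reg s r).-1 r) None).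
  apply: rep_setr => //; last by rewrite ltnn.
  by move=> q; lia.
have [r0 _ _ _ _] := rT.
apply: (@runs_le _ _ _ ((reg s r).+1 * (K + 4) + (K.+2 + (1 + (reg s r).-1.+1 * (K + 4))))).
  by rewrite prednK // mulSn; lia.
apply: runs_seq (runs_seek rK rT) _.
apply: (@runs_seq _ _ _ (cell (reg s r).-1 r, T)).
  rewrite (_ : cell (reg s r).-1 r = cell (reg s r) r - Z.of_nat K)%Z; first exact: runs_right.
  by rewrite /cell -{2}(prednK v0) mulnS; lia.
apply: runs_seq (runs_wr _ _ _ _) _; first by lia.
apply: runs_home; last by lia.
by move=> i; rewrite upd_cell ?r0; try lia; rewrite (_ : 0 == r = false) ?andbF //; lia.
Qed.

Lemma runs_to_array s T r a : 2 < r < K -> rep s T ->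
  runs (mvs DRight (r - atrack a)) (cell (reg s r) r, T) (cell (reg s r) (atrack a), T) (K + 2).
Proof.
move=> rK rT; have := atrack_lt a => aK.
apply: (@runs_le _ _ _ (r - atrack a).+2); first by lia.
rewrite (_ : cell _ (atrack a) = cell (reg s r) r - Z.of_nat (r - atrack a))%Z.
  exact: runs_right.
by rewrite /cell; lia.
Qed.

Lemma RT_setbit s a r : 2 < r < K ->
  RT (setbit a r) s (setm s a (reg s r)) ((reg s r).+1 * (4 * (K + 4))).
Proof.
move=> rK; split=> T rT; exists (upd T (cell (reg s r) (atrack a)) (Some true)); first exact: rep_setm.
have [r0 _ _ _ _] := rT; have aK := atrack_lt a; have a0 := atrack_gt0 a.
apply: (@runs_le _ _ _ ((reg s r).+1 * (K + 4) + (K + 2 + (1 + (reg s r).+1 * (K + 4))))).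
  by lia.
apply: runs_seq (runs_seek rK rT) _.
apply: runs_seq (runs_to_array _ rK rT) _.
apply: runs_seq (runs_wr _ _ _ _) _; first by lia.
apply: runs_home; last by lia.
by move=> i; rewrite upd_cell ?r0; try lia; rewrite (_ : 0 == _ = false) ?andbF //; lia.
Qed.

Lemma RT_getbit s a r d : 2 < r < K -> 2 < d < K ->
  RT (getbit a r d) s (setr s d (bits s a (reg s r) + reg s d))
     ((reg s r + reg s d).+1 * (8 * (K + 4))).
Proof.
move=> rK dK; split=> T rT; have [r0 r1 _ _ _] := rT; have aK := atrack_lt a.
have hm : runs (home (atrack a)) (cell (reg s r) (atrack a), T) (0%Z, T)
            ((reg s r).+1 * (K + 4)) by apply: runs_home => //; lia.
case E: (bits s a (reg s r)); rewrite ?add1n ?add0n.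
- have [/(_ _ rT)[T' rT' eT']] := RT_inc s dK; exists T' => //.
  have [n le e] := runs_seq hm eT'.
  apply: (@runs_le _ _ _ ((reg s r).+1 * (K + 4) + (K + 2 + n.+2))); first by lia.
  apply: runs_seq (runs_seek rK rT) _.
  apply: runs_seq (runs_to_array _ rK rT) _.
  by exists n.+2 => //; apply: ExIteT => //; rewrite r1.
- rewrite setr_same; exists T => //; have [n le e] := hm.
  apply: (@runs_le _ _ _ ((reg s r).+1 * (K + 4) + (K + 2 + n.+2))); first by lia.
  apply: runs_seq (runs_seek rK rT) _.
  apply: runs_seq (runs_to_array _ rK rT) _.
  by exists n.+2 => //; apply: ExIteF => //; rewrite r1 E.
Qed.

Lemma RT_while (f : nat -> st) r P m t : 2 < r < K ->
  (forall i, i < m -> 0 < reg (f i) r /\ RT P (f i) (f i.+1) t) -> reg (f m) r = 0 ->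
  RT (whilenz r P) (f 0) (f m) (m.+1 * (t + 2 * (K + 4))).
Proof.
move=> rK H fm; split=> T rT.
(* [RT] gives some next tape for each tape, so the tapes between the iterations have to be chosen
   along the trace [f]. *)
have [g gr gp] : exists2 g : nat -> tape, g 0 = T &
    forall i, (i <= m -> rep (f i) (g i)) /\
      (i < m -> runs P (0%Z, g i) (0%Z, g i.+1) t).
  have [g [g0 g1 g2]] : exists g : nat -> tape, [/\ g 0 = T, 
      forall i, i <= m -> rep (f i) (g i) &
      forall i, i < m -> runs P (0%Z, g i) (0%Z, g i.+1) t].
    elim: m H {fm} => [|m IH] H; first by exists (fun=> T); split=> // -[].
    have [i im|g [g0 g1 g2]] := IH; first by apply: H; lia.
    have [_ [/(_ _ (g1 _ (leqnn _)))[T' rT' eT']]] := H m (ltnSn m).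
    exists (fun i => if i <= m then g i else T'); split=> [//|i|i].
      move=> im1; have [->|ne] := eqVneq i m.+1; first by rewrite ltnn.
      have im : i <= m by lia.
      by rewrite im; exact: g1.
    move=> im1; have [->|ne] := eqVneq i m; first by rewrite leqnn ltnn.
    have im : i < m by lia.
    by rewrite im (ltnW im); exact: g2.
  by exists g => // i; split; [exact: g1|exact: g2].
exists (g m); first by apply gp.
have testE i : i <= m -> marked (g i (cell 0 r)) = (0 < reg (f i) r).
  by move=> im; have [/(_ im)[_ _ -> //]] := gp i.
have c0 : (0 + Z.of_nat r = cell 0 r)%Z by rewrite /cell; lia.
have c1 : (cell 0 r - Z.of_nat r = 0)%Z by rewrite /cell; lia.
pose h i := (cell 0 r, g i).
apply: (@runs_le _ _ _ (r.+2 + (m * ((r.+2 + (t + r.+2)) + 2) + 2 + r.+2))).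
  by rewrite mulSn; nia.
apply: runs_seq; first exact: runs_left.
rewrite c0 -gr; apply: (@runs_seq _ _ _ (h m)); last first.
  by rewrite -[0%Z in X in runs _ _ X _]c1; exact: runs_right.
rewrite -/(h 0); apply: runs_whl => [i im|]; last by rewrite /h /= testE // fm.
rewrite /h /= testE ?(ltnW im) //; split; first by case: (H i im).
apply: (@runs_seq _ _ _ (0, g i)%Z).
  by rewrite -[0%Z in X in runs _ _ X _]c1; exact: runs_right.
apply: (@runs_seq _ _ _ (0, g i.+1)%Z); first by apply gp.
by rewrite -c0; exact: runs_left.
Qed.

End Tracks.

(** * Polynomial-time computable functions *)

(** All costs are kept as powers of one quantity [S] that dominates the number of tracks and the
    arguments. This law brings sequences back to that form, [loop_cost] does so for loops. *)
Lemma exp_sum S a b : 1 < S -> S ^ a + S ^ b <= S ^ (a + b + 1).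
Proof.
move=> S1; have ha : 0 < S ^ a by rewrite expn_gt0; lia.
have hb : 0 < S ^ b by rewrite expn_gt0; lia.
rewrite !expnD expn1; apply: (@leq_trans (S ^ a * S ^ b * 2)); last by rewrite leq_mul.
by rewrite muln2 -addnn leq_add // ?leq_pmulr ?leq_pmull.
Qed.

Lemma exp_mono S a b : 1 < S -> a <= b -> S ^ a <= S ^ b.
Proof. by move=> S1 ab; rewrite leq_pexp2l //; lia. Qed.

Lemma loop_cost S K m t p q : 3 < K -> K <= S -> m <= S ^ p -> t <= S ^ q ->
  m.+1 * (t + 2 * (K + 4)) <= S ^ (p + q + 5).
Proof.
move=> K4 KS mp tq; have S1 : 1 < S by lia.
have hq : 0 < S ^ q by rewrite expn_gt0; lia.
have hp : 0 < S ^ p by rewrite expn_gt0; lia.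
apply: (@leq_trans (S ^ (p + 1) * S ^ (q + 4))); last by rewrite -expnD exp_mono //; lia.
apply: leq_mul; first by rewrite expnD expn1; nia.
apply: (@leq_trans (S ^ q + S ^ 3)); last by rewrite (leq_trans (exp_sum _ _ S1)) // exp_mono //; lia.
apply: leq_add => //; have e : S ^ 3 = S * S * S by rewrite !expnS expn0; lia.
by rewrite e; nia.
Qed.

Definition fn := (bool -> nat -> bool) -> seq nat -> nat.

Definition clean (s : st) (r : nat) : Prop := forall q, r <= q -> reg s q = 0.

Section Basic.
Variables (K S : nat).
Hypotheses (K4 : 3 < K) (KS : K <= S).

Lemma prim_cost v p a : a <= 2 -> v <= S ^ p ->
  v.+1 * (4 * a * (K + 4)) <= S ^ (p + 2 + a.+1).
Proof.
move=> a2 vp; have hp : 0 < S ^ p by rewrite expn_gt0; lia.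
have S4 : 4 <= S by lia.
have S16 : 16 <= S * S by exact: (leq_mul S4 S4).
apply: (@leq_trans (2 * S ^ p * (4 * a * (2 * S)))).
  by apply: leq_mul; [lia|rewrite leq_mul //; lia].
have aS : a <= S ^ a by rewrite ltnW // ltn_expl //; lia.
have := leq_mul S16 aS; rewrite !expnD [S ^ a.+1]expnS -mulnn.
by move: (S ^ p) (S ^ a) hp => X Y hp h; have := leq_mul (leqnn (X * S)) h; nia.
Qed.

Lemma RT_inc_le s r p : 2 < r < K -> reg s r <= S ^ p ->
  RT K (inc K r) s (setr s r (reg s r).+1) (S ^ (p + 4)).
Proof.
move=> rK v; apply: RT_le (RT_inc K4 s rK).
by have := prim_cost (a := 1) isT v; rewrite muln1 -addnA.
Qed.

Lemma RT_dec_le s r p : 2 < r < K -> 0 < reg s r -> reg s r <= S ^ p ->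
  RT K (dec K r) s (setr s r (reg s r).-1) (S ^ (p + 4)).
Proof.
move=> rK v0 v; apply: RT_le (RT_dec K4 rK v0).
by have := prim_cost (a := 1) isT v; rewrite muln1 -addnA.
Qed.

Lemma RT_setbit_le s a r p : 2 < r < K -> reg s r <= S ^ p ->
  RT K (setbit K a r) s (setm s a (reg s r)) (S ^ (p + 4)).
Proof.
move=> rK v; apply: RT_le (RT_setbit K4 s a rK).
by have := prim_cost (a := 1) isT v; rewrite muln1 -addnA.
Qed.

Lemma RT_getbit_le s a r d p : 2 < r < K -> 2 < d < K -> reg s r <= S ^ p -> reg s d = 0 ->
  RT K (getbit K a r d) s (setr s d (bits s a (reg s r))) (S ^ (p + 5)).
Proof.
move=> rK dK v d0; have := RT_getbit K4 s a rK dK; rewrite d0 !addn0; apply: RT_le.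
by have := prim_cost (a := 2) isT v; rewrite -addnA.
Qed.

Definition clear r := whilenz r (dec K r).

Lemma RT_clear s r p : 2 < r < K -> reg s r <= S ^ p ->
  RT K (clear r) s (setr s r 0) (S ^ (p + p + 9)).
Proof.
move=> rK v; pose f i := setr s r (reg s r - i).
have f0 : f 0 = s by rewrite /f subn0 setr_same.
have -> : setr s r 0 = f (reg s r) by rewrite /f subnn.
rewrite -{1}f0; apply: RT_le (@RT_while K K4 f r _ (reg s r) (S ^ (p + 4)) rK _ _).
- by apply: leq_trans (loop_cost K4 KS v (leqnn _)) _; rewrite exp_mono //; lia.
- move=> i im; rewrite reg_setr; split; first by lia.
  have fi : reg (f i) r = reg s r - i by rewrite reg_setr.
  have -> : f i.+1 = setr (f i) r (reg (f i) r).-1 by rewrite fi setr_setr /f; congr setr; lia.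
  by apply: RT_dec_le => //; rewrite fi; lia.
- by rewrite reg_setr subnn.
Qed.

Definition move_to a b := whilenz a (Seq (dec K a) (inc K b)).

Lemma RT_move s a b p : 2 < a < K -> 2 < b < K -> a != b -> reg s b = 0 -> reg s a <= S ^ p ->
  RT K (move_to a b) s (setr (setr s a 0) b (reg s a)) (S ^ (p + (p + 4 + (p + 4) + 1) + 5)).
Proof.
move=> aK bK ab b0 v; pose f i := setr (setr s a (reg s a - i)) b i.
have ba : b != a by rewrite eq_sym.
have f0 : f 0 = s.
  by rewrite /f subn0 setr_same -b0 setr_same.
have -> : setr (setr s a 0) b (reg s a) = f (reg s a) by rewrite /f subnn.
have fa i : reg (f i) a = reg s a - i by rewrite /= eqxx (negbTE ab).
rewrite -{1}f0.
apply: RT_le (@RT_while K K4 f a _ (reg s a) (S ^ (p + 4) + S ^ (p + 4)) aK _ _).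
- by apply: (loop_cost K4 KS v); apply: exp_sum; lia.
- move=> i im; rewrite fa; split; first by lia.
  apply: (@RT_seq _ _ _ _ (setr (f i) a (reg (f i) a).-1)).
    by apply: RT_dec_le => //; rewrite fa; lia.
  set s' := setr (f i) _ _.
  have s'b : reg s' b = i by rewrite /s' /= (negbTE ba) eqxx.
  have -> : f i.+1 = setr s' b (reg s' b).+1.
    rewrite s'b /s' fa /f; apply: st_eq => // q /=.
    by do 2!case: eqP => // _; lia.
  by apply: RT_inc_le => //; rewrite s'b; lia.
- by rewrite fa subnn.
Qed.

(** Reading a unary register empties it, so two copies are made, the second of which restores
    [a]. *)
Definition copy_to a r := 
  Seq (whilenz a (Seq (dec K a) (Seq (inc K r) (inc K r.+1)))) (move_to r.+1 a).

Lemma RT_copy s a r p : 2 < a < r -> r.+1 < K -> reg s r = 0 -> reg s r.+1 = 0 ->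
  reg s a <= S ^ p ->
  RT K (copy_to a r) s (setr s r (reg s a)) (S ^ (7 * p + 40)).
Proof.
move=> aK rK r0 r10 v; have S1 : 1 < S by lia.
pose f i := setr (setr (setr s a (reg s a - i)) r i) r.+1 i.
have ar : (a == r) = false by lia.
have ar1 : (a == r.+1) = false by lia.
have ra : (r == a) = false by lia.
have r1a : (r.+1 == a) = false by lia.
have rr1 : (r == r.+1) = false by lia.
have r1r : (r.+1 == r) = false by lia.
have f0 : f 0 = s.
  rewrite /f subn0 setr_same; apply: st_eq => // q /=.
  case: (q =P r.+1) => [->|_]; first by rewrite r10.
  by case: (q =P r) => [->|_].
have fa i : reg (f i) a = reg s a - i by rewrite /= eqxx ar ar1.
apply: (@RT_le _ _ _ _ (S ^ (p + (p + 4 + (p + 4 + (p + 4) + 1) + 1) + 5) +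
    S ^ (p + (p + 4 + (p + 4) + 1) + 5))).
  by rewrite (leq_trans (exp_sum _ _ _)) // exp_mono //; lia.
apply: (@RT_seq _ _ _ _ (f (reg s a))).
  rewrite -{1}f0.
  apply: RT_le (@RT_while K K4 f a _ (reg s a) (S ^ (p + 4) + (S ^ (p + 4) + S ^ (p + 4))) _ _ _).
  - apply: (loop_cost K4 KS v); apply: leq_trans (exp_sum _ _ S1).
    by rewrite leq_add2l exp_sum.
  - by lia.
  - move=> i im; rewrite fa; split; first by lia.
    apply: (@RT_seq _ _ _ _ (setr (f i) a (reg (f i) a).-1)).
      by apply: RT_dec_le; rewrite ?fa; lia.
    set s1 := setr (f i) _ _.
    apply: (@RT_seq _ _ _ _ (setr s1 r (reg s1 r).+1)).
      by apply: RT_inc_le; rewrite /= ?ra ?eqxx ?rr1; lia.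
    set s2 := setr s1 r _.
    have -> : f i.+1 = setr s2 r.+1 (reg s2 r.+1).+1.
      apply: st_eq => // q; rewrite /s2 /s1 fa /f /=.
      rewrite r1r r1a rr1 ra !eqxx.
      by do 3!case: eqP => // _; lia.
    by apply: RT_inc_le; rewrite /= ?r1r ?r1a ?eqxx; lia.
  - by rewrite fa subnn.
have fm : reg (f (reg s a)) r.+1 = reg s a by rewrite /= eqxx.
have -> : setr s r (reg s a) = setr (setr (f (reg s a)) r.+1 0) a (reg (f (reg s a)) r.+1).
  rewrite fm; apply: st_eq => // q; rewrite /f /=.
  case: (q =P a) => [->|_]; first by rewrite ar.
  case: (q =P r.+1) => [->|_]; first by rewrite r1r r10.
  by case: (q =P r).
by apply: RT_move; rewrite ?fm ?fa ?r1a; lia.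
Qed.

End Basic.

(* The number K of tracks is fixed last, when the needs w of all the functions
   are known. *)
Definition computable (f : fn) : Prop :=
  exists w c, forall K E r, 3 < K -> all (fun q => 2 < q < r) E -> 2 < r -> r + w < K ->
  exists P, forall s S, K <= S -> (forall q, q \in E -> reg s q <= S) -> clean s r ->
    RT K P s (setr s r (f (bits s) (map (reg s) E))) (S ^ c) /\
    f (bits s) (map (reg s) E) <= S ^ c.

Lemma map_reg_setr s r v E : all (fun q => 2 < q < r) E -> map (reg (setr s r v)) E = map (reg s) E.
Proof.
by move=> h; apply/eq_in_map => q /(allP h) qr /=; rewrite (_ : q == r = false) //; lia.
Qed.

Lemma exp_gt1 S c : 1 < S -> 0 < c -> 1 < S ^ c.
Proof. by move=> S1 c0; rewrite -{1}(expn0 S) ltn_exp2l. Qed.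

Lemma RT_skip K s t : 1 < t -> RT K (mvs DLeft 0) s s t.
Proof.
move=> t1; split=> T rT; exists T => //; exists 2 => //.
rewrite -{2}(_ : mv DRight (mv DLeft 0) = 0)%Z //.
exact: (ExSeq (ExMv _ _ _) (ExMv _ _ _)).
Qed.

Lemma comp_var i : computable (fun _ rho => nth 0 rho i).
Proof.
exists 2, 47 => K E r K4 EK r2 rw.
case: (ltnP i (size E)) => iE; last first.
  exists (mvs DLeft 0) => s S KS ES cl; rewrite nth_default ?size_map //; split=> //.
  rewrite (_ : setr s r 0 = s); first by apply: RT_skip; apply: exp_gt1; lia.
  by apply: st_eq => // q /=; case: eqP => // ->; rewrite cl.
exists (copy_to K (nth 0 E i) r) => s S KS ES cl; rewrite (nth_map 0) //.
have qE : nth 0 E i \in E by exact: mem_nth.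
have := allP EK _ qE => /= qr.
split; last by rewrite (leq_trans (ES _ qE)) // -{1}(expn1 S) exp_mono //; lia.
apply: (@RT_copy _ _ K4 KS _ _ _ 1) => //; first by lia.
- exact: cl.
- by apply: cl; lia.
- by rewrite expn1; exact: ES.
Qed.

Lemma comp_zero : computable (fun _ _ => 0).
Proof.
exists 0, 1 => K E r K4 EK r2 rw; exists (mvs DLeft 0) => s S KS ES cl; split=> //.
rewrite (_ : setr s r 0 = s); first by apply: RT_skip; lia.
by apply: st_eq => // q /=; case: eqP => // ->; rewrite cl.
Qed.

Lemma comp_succ f : computable f -> computable (fun M rho => (f M rho).+1).
Proof.
move=> [w [c H]]; exists w, (c + (c + 4) + 1) => K E r K4 EK r2 rw.
have [P HP] := H K E r K4 EK r2 rw.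
exists (Seq P (inc K r)) => s S KS ES cl; have [R B] := HP s S KS ES cl.
have S1 : 1 < S by lia.
split; last first.
  apply: (@leq_trans (S ^ c + S ^ (c + 4))); last exact: exp_sum.
  by rewrite -addn1 leq_add // expn_gt0; lia.
apply: RT_le (exp_sum _ _ S1) _; apply: RT_seq R _.
rewrite -[in X in RT _ _ _ X](reg_setr s r (f (bits s) (map (reg s) E))).
rewrite -[X in RT _ _ _ X](setr_setr s r (f (bits s) (map (reg s) E))).
by apply: RT_inc_le; rewrite ?reg_setr //; lia.
Qed.

Lemma comp_get a f : computable f -> computable (fun M rho => M a (f M rho)).
Proof.
move=> [w [c H]].
pose cm := c + (c + 4 + (c + 4) + 1) + 5.
exists w.+2, (c + (c + 5 + (c + c + 9 + 17 + 1) + 1) + 1) => K E r K4 EK r2 rw.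
have [|P HP] := H K E r K4 EK r2; first by lia.
exists (Seq P (Seq (getbit K a r r.+1) (Seq (clear K r) (move_to K r.+1 r)))) => s S KS ES cl.
have [R B] := HP s S KS ES cl; have S1 : 1 < S by lia.
split; last first.
  by apply: (@leq_trans (S ^ 0)); [rewrite expn0; case: (bits s a _)|apply: exp_mono; lia].
apply: RT_le (exp_sum _ _ S1) _; apply: RT_seq R _; set v := f _ _ in B *.
set s1 := setr s r v.
have rr : (r == r.+1) = false by lia.
have rr' : (r.+1 == r) = false by lia.
have r1 : reg s1 r = v by rewrite reg_setr.
have r10 : reg s1 r.+1 = 0 by rewrite /= rr' cl.
apply: RT_le (exp_sum _ _ S1) _; apply: RT_seq.
  by apply: (@RT_getbit_le _ _ K4 KS _ _ _ _ c) => //; rewrite ?r1; lia.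
set s2 := setr s1 _ _.
apply: RT_le (exp_sum _ _ S1) _; apply: RT_seq.
  by apply: (@RT_clear _ _ K4 KS _ _ c); rewrite /= ?rr ?eqxx //; lia.
set s3 := setr s2 r 0.
have r3 : reg s3 r.+1 = bits s a v by rewrite /= rr' !eqxx.
rewrite (_ : setr s r _ = setr (setr s3 r.+1 0) r (reg s3 r.+1)).
  apply: (@RT_move _ _ K4 KS _ _ _ 1); rewrite ?r3 ?expn1 //= ?rr' ?eqxx //; try lia.
rewrite r3; apply: st_eq => // q /=.
by case: eqP => // /eqP qr; case: eqP => // ->; rewrite cl.
Qed.

Fixpoint prec (F : nat -> nat -> nat) (a n : nat) : nat :=
  if n is n'.+1 then F (prec F a n') n' else a.

(** Without the bound on the intermediate values, iterated squaring would leave polynomial time.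
    With it, each iteration runs on polynomially large arguments. *)
Lemma comp_rec n init body b : computable n -> computable init -> computable body ->
  (forall M rho S, 3 < S -> all (fun v => v <= S) rho -> forall i, i <= n M rho ->
     prec (fun acc j => body M [:: acc, j & rho]) (init M rho) i <= S ^ b) ->
  computable (fun M rho => prec (fun acc j => body M [:: acc, j & rho]) (init M rho) (n M rho)).
Proof.
move=> [wn [cn Hn]] [wi [ci Hi]] [wb [cb Hb]] bnd.
pose p := (cn + b + 1) * cb + cn + ci + b + 1.
pose q1 := p + p + 9.
pose q2 := p + (p + 4 + (p + 4) + 1) + 5.
pose q3 := p + 4.
pose t := p + (q1 + (q2 + (q3 + q3 + 1) + 1) + 1) + 1.
pose q4 := p + t + 5.
exists (wn + wi + wb).+4, (p + (p + (q4 + (q2 + q1 + 1) + 1) + 1) + 1) => K E r K4 EK r2 rw.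
have [|Pn HPn] := Hn K E r K4 EK r2; first by lia.
have EK1 : all (fun q => 2 < q < r.+1) E by apply: sub_all EK => q; lia.
have [||Pi HPi] := Hi K E r.+1 K4 EK1; try lia.
have EK3 : all (fun q => 2 < q < r.+3) [:: r.+1, r.+2 & E].
  by apply/and3P; split; [lia|lia|apply: sub_all EK => q; lia].
have [||Pb HPb] := Hb K _ r.+3 K4 EK3; try lia.
pose L := Seq Pb (Seq (clear K r.+1) (Seq (move_to K r.+3 r.+1) (Seq (inc K r.+2) (dec K r)))).
exists (Seq Pn (Seq Pi (Seq (whilenz r L) (Seq (move_to K r.+1 r) (clear K r.+2))))) => s S KS ES cl.
have S1 : 1 < S by lia.
have S4 : 3 < S by lia.
have pS x y : x <= S ^ y -> y <= p -> x <= S ^ p.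
  by move=> h yp; apply: leq_trans h _; exact: exp_mono.
set rho := map (reg s) E.
have rhoS : all (fun v => v <= S) rho.
  by apply/allP => v /mapP[q qE ->]; exact: ES.
have B := bnd (bits s) rho S S4 rhoS; set F := (fun acc j => _) in B *.
set N := n (bits s) rho in B *; set A := init (bits s) rho in B *.
have bp i : i <= N -> prec F A i <= S ^ p by move=> iN; apply: pS (B i iN) _; rewrite /p; lia.
split; last by apply: leq_trans (bp N (leqnn _)) _; apply: exp_mono => //; lia.
have [Rn Bn] := HPn s S KS ES cl; rewrite -/rho -/N in Rn Bn.
apply: RT_le (exp_sum _ _ S1) _; apply: RT_seq.
  by apply: RT_le Rn; apply: exp_mono => //; rewrite /p; lia.
have [Ri Bi] : RT K Pi (setr s r N) (setr (setr s r N) r.+1 A) (S ^ ci) /\ A <= S ^ ci.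
  have := HPi (setr s r N) S KS; rewrite map_reg_setr // -/rho; apply.
    by move=> q qE /=; case: eqP => // [e|_]; [have := allP EK _ qE; lia|exact: ES].
  by move=> q rq /=; rewrite ifF; [apply: cl; lia|lia].
apply: RT_le (exp_sum _ _ S1) _; apply: RT_seq.
  by apply: RT_le Ri; apply: exp_mono => //; rewrite /p; lia.
(* Register [r] counts down, [r.+1] holds the accumulator and [r.+2] the index; the body delivers
   its result in [r.+3]. *)
pose f i := setr (setr (setr s r (N - i)) r.+1 (prec F A i)) r.+2 i.
have fE i q : reg (f i) q = if q == r.+2 then i else if q == r.+1 then prec F A i
   else if q == r then N - i else reg s q by [].
have fm i : bits (f i) = bits s by [].
have f0 : f 0 = setr (setr s r N) r.+1 A.
  rewrite /f subn0; apply: st_eq => // q /=; case: (q =P r.+2) => // ->.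
  by rewrite cl ?ifF //; lia.
have n01 : (r == r.+1) = false by lia.
have n02 : (r == r.+2) = false by lia.
have n12 : (r.+1 == r.+2) = false by lia.
have n21 : (r.+2 == r.+1) = false by lia.
have n20 : (r.+2 == r) = false by lia.
have n23 : (r.+2 == r.+3) = false by lia.
have fr i : reg (f i) r = N - i by rewrite fE n01 n02 eqxx.
have fr1 i : reg (f i) r.+1 = prec F A i by rewrite fE n12 eqxx.
have fr2 i : reg (f i) r.+2 = i by rewrite fE eqxx.
apply: RT_le (exp_sum _ _ S1) _; apply: (@RT_seq _ _ _ _ (f N)).
  rewrite -f0; apply: RT_le (@RT_while K K4 f r L N (S ^ t) _ _ _); last 1 first.
  - by rewrite fr subnn.
  - by apply: (loop_cost K4 KS) => //; apply: pS Bn _; rewrite /p; lia.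
  - by lia.
  move=> i iN; rewrite fr; split; first by lia.
  have iS : i <= S ^ p by apply: leq_trans (ltnW iN) _; apply: pS Bn _; rewrite /p; lia.
  (* Accumulator and index may exceed [S], so the body is run with the bound [V], which multiplies
     its exponent [cb]. *)
  pose V := S ^ (cn + b + 1).
  have VS : S <= V by rewrite -{1}(expn1 S) exp_mono //; lia.
  have mE : map (reg (f i)) [:: r.+1, r.+2 & E] = [:: prec F A i, i & rho].
    rewrite !map_cons fr1 fr2; congr [:: _, _ & _]; apply/eq_in_map => q /(allP EK) qr.
    by rewrite fE !ifF //; lia.
  have [|||Rb Bb] := HPb (f i) V; first by lia.
  - move=> q; rewrite !inE => /or3P[/eqP ->|/eqP ->|qE].
    + by rewrite fr1; apply: leq_trans (B i (ltnW iN)) _; apply: exp_mono => //; lia.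
    + by rewrite fr2; apply: leq_trans (ltnW iN) _; apply: leq_trans Bn _; apply: exp_mono; lia.
    + by rewrite fE !ifF; [apply: leq_trans (ES _ qE) VS|..]; have := allP EK _ qE; lia.
  - by move=> q rq; rewrite fE !ifF; [apply: cl|..]; lia.
  rewrite mE fm -/(F (prec F A i) i) -/(prec F A i.+1) /V -!expnM in Rb Bb.
  have Bb' : prec F A i.+1 <= S ^ p by exact: bp.
  apply: RT_le (exp_sum _ _ S1) _; apply: RT_seq.
    by apply: RT_le Rb; apply: exp_mono => //; rewrite /p; lia.
  set s1 := setr (f i) _ _.
  have s1E q : reg s1 q = if q == r.+3 then prec F A i.+1 else reg (f i) q by [].
  apply: RT_le (exp_sum _ _ S1) _; apply: RT_seq.
    apply: (@RT_clear _ _ K4 KS _ _ p); first by lia.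
    by rewrite s1E ifF ?fr1; [apply: bp; lia|lia].
  set s2 := setr s1 _ _.
  have s2E q : reg s2 q = if q == r.+1 then 0 else reg s1 q by [].
  apply: RT_le (exp_sum _ _ S1) _; apply: RT_seq.
    apply: (@RT_move _ _ K4 KS _ _ _ p); try lia; first by rewrite s2E eqxx.
    by rewrite s2E s1E eqxx ifF //; lia.
  set s3 := setr _ r.+1 _.
  have s3E q : reg s3 q = if q == r.+1 then prec F A i.+1 else if q == r.+3 then 0 else
      reg (f i) q.
    rewrite /s3 /=; case: eqP => // _; first by rewrite eqxx ifF //; lia.
    by case: eqP.
  apply: RT_le (exp_sum _ _ S1) _; apply: RT_seq.
    by apply: (@RT_inc_le _ _ K4 KS _ _ p); rewrite ?s3E ?fr2 ?ifF ?fr2 //; lia.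
  set s4 := setr _ _ _.
  have n03 : (r == r.+3) = false by lia.
  have s4E q : reg s4 q = if q == r.+2 then (reg s3 r.+2).+1 else reg s3 q by [].
  have s4r : reg s4 r = N - i by rewrite s4E n02 s3E n01 n03 fr.
  rewrite (_ : f i.+1 = setr s4 r (reg s4 r).-1).
    apply: (@RT_dec_le _ _ K4 KS _ _ p); rewrite ?s4r //; try lia.
    by apply: leq_trans (leq_subr _ _) _; apply: pS Bn _; rewrite /p; lia.
  apply: st_eq => // q; rewrite fE.
  have s32 : reg s3 r.+2 = i by rewrite s3E n21 n23 fr2.
  rewrite [RHS](_ : _ = if q == r then (reg s4 r).-1 else reg s4 q) // s4r s4E s32 s3E.
  case: (q =P r) => [->|/eqP qr]; first by rewrite n02 n01; lia.
  case: (q =P r.+2) => // /eqP qr2; case: (q =P r.+1) => // /eqP qr1.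
  case: (q =P r.+3) => [->|/eqP qr3]; first by apply: cl; lia.
  by rewrite fE (negbTE qr2) (negbTE qr1) (negbTE qr).
apply: RT_le (exp_sum _ _ S1) _; apply: RT_seq.
  apply: (@RT_move _ _ K4 KS _ _ _ p); rewrite ?fr ?subnn ?fr1 //; try lia.
  exact: bp.
rewrite (_ : setr s r _ = setr (setr (setr (f N) r.+1 0) r (reg (f N) r.+1)) r.+2 0).
  apply: (@RT_clear _ _ K4 KS _ _ p); first by lia.
  rewrite (_ : reg _ r.+2 = N); first by apply: pS Bn _; rewrite /p; lia.
  by rewrite /= n20 n21 eqxx.
rewrite fr1; apply: st_eq => // q /=.
case: (q =P r.+2) => [->|_]; first by rewrite ifF ?cl //; lia.
case: (q =P r) => // _; case: (q =P r.+1) => // ->; by rewrite cl.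
Qed.

(** * The universal tree and nested fixed points *)

Lemma lex_lt M a b r r' : r < M -> r' < M ->
  (a * M + r < b * M + r') = (a < b) || ((a == b) && (r < r')).
Proof.
move=> rM r'M; case: (ltngtP a b) => [ab|ba|->] /=.
- by have := leq_mul ab (leqnn M); rewrite mulSn; lia.
- by have := leq_mul ba (leqnn M); rewrite mulSn; lia.
- by rewrite ltn_add2l.
Qed.

Section Measure.
Variable H : nat.
Let B := H.*2.+1.

(* A digit is read as its offset from the centre H. *)
Definition big (j x : nat) : bool := (H + j <= x) || (x + j <= H).
Definition cdig (j x : nat) : nat := if big j x then x else H.

(* The value of a digit list cut at its first digit of absolute value below j:
   comparing these values orders the leaves of a universal tree by their
   ancestors at height j. *)
Fixpoint cutval (j : nat) (s : seq nat) : nat :=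
  if s is x :: s' then
    cdig j x * B ^ size s' + (if big j x then cutval j s' else 0) else 0.

Definition digits (s : seq nat) : bool := all (fun x => x < B) s.

Lemma cdig_lt j x : x < B -> cdig j x < B.
Proof. by rewrite /cdig /B; case: ifP => //; lia. Qed.

Lemma cutval_lt j s : digits s -> cutval j s < B ^ size s.
Proof.
elim: s => //= x s IH /andP[xB /IH h]; have := cdig_lt j xB.
rewrite -(leq_pmul2r (_ : 0 < B ^ size s)) ?expn_gt0 // mulSn expnS.
by case: ifP => _; lia.
Qed.

Lemma cutval_tail_lt j x s : digits s -> (if big j x then cutval j s else 0) < B ^ size s.
Proof. by move=> ds; case: ifP => _; [exact: cutval_lt|rewrite expn_gt0]. Qed.

Lemma cutval_mono i j s t : 0 < j <= i -> size s = size t -> digits s -> digits t ->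
  cutval i s < cutval i t -> cutval j s < cutval j t.
Proof.
move=> ji; elim: s t => [|x s IH] [|y t] //= [st] /andP[xB ds] /andP[yB dt].
have tl k : (if big k x then cutval k s else 0) < B ^ size t by rewrite -st cutval_tail_lt.
have tr k : (if big k y then cutval k t else 0) < B ^ size t by rewrite cutval_tail_lt.
rewrite st !lex_lt //.
case/orP=> [lt|/andP[/eqP eq lt]].
  apply/orP; left; move: lt; rewrite /cdig /big.
  by do 4!case: ifP; lia.
have IH' := IH t st ds dt; move: lt eq IH'; rewrite /cdig /big.
by do 4!case: ifP; lia.
Qed.

Lemma cutval_head_lt j x y s t : size s = size t -> digits s -> digits t ->
  cdig j x < cdig j y -> cutval j (x :: s) < cutval j (y :: t).
Proof.
by move=> st ds dt lt; rewrite /= st lex_lt ?lt // ?cutval_tail_lt // -st cutval_tail_lt.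
Qed.

Lemma cutval_cons_lt j x s t : size s = size t -> big j x ->
  (cutval j (x :: s) < cutval j (x :: t)) = (cutval j s < cutval j t).
Proof. by move=> st bx; rewrite /= bx st ltn_add2l. Qed.

Lemma cutval_small j s t : size s = size t -> all (fun x => ~~ big j x) s ->
  all (fun x => ~~ big j x) t -> cutval j s = cutval j t.
Proof.
case: s t => [|x s] [|y t] //= [st] /andP[/negbTE bx _] /andP[/negbTE by_ _].
by rewrite /cdig bx by_ st.
Qed.

(** Priorities 2q and 2q+1 share the ancestor at height q+1, the odd one requiring strict descent.
    At height [H.+1] every digit is cut and all values agree, so the even priority 2H imposes
    nothing. *)
Definition progress (p : nat) (u u' : seq nat) : bool :=
  if odd p then cutval p./2.+1 u' < cutval p./2.+1 u else cutval p./2.+1 u' <= cutval p./2.+1 u.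

End Measure.

(** * Limits of priority sequences and infinite descent *)

Definition limsup (f : nat -> nat) (P : nat) : Prop :=
  inf_often (fun i => f i = P) /\ exists N, forall i, N <= i -> f i <= P.

Lemma limsup_exists f I : (forall i, f i < I) -> exists P, limsup f P.
Proof.
move=> fI.
have : exists N, forall i, N <= i -> f i < I by exists 0.
elim: I {fI} => [|I IH] [N H].
  by have := H N (leqnn N).
have [io|nio] := classic (inf_often (fun i => f i = I)).
  by exists I; split=> //; exists N => i /H.
apply: IH; have [m Hm] : exists m, forall i, m <= i -> f i <> I.
  apply: NNPP => h; apply: nio => m; apply: NNPP => h'; apply: h; exists m => i mi fi.
  by apply: h'; exists i.
exists (maxn m N) => i; rewrite geq_max => /andP[mi Ni].
by have := H i Ni; have := Hm i mi; lia.
Qed.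

Lemma limsup_unique f P Q : limsup f P -> limsup f Q -> P = Q.
Proof.
move=> [ioP [N HN]] [ioQ [M HM]]; apply/eqP; rewrite eqn_leq; apply/andP; split.
  by have [i [Mi <-]] := ioP M; exact: HM.
by have [i [Ni <-]] := ioQ N; exact: HN.
Qed.

Lemma parity_acceptingE f I : (forall i, f i < I) ->
  parity_accepting f <-> exists2 P, limsup f P & ~~ odd P.
Proof.
move=> /limsup_exists[P limP]; split=> [[p [iop [maxp evp]]]|[Q [ioQ [N HN]] evQ]].
  exists P => //; rewrite (_ : P = p) //; case: limP => ioP [N HN].
  apply/eqP; rewrite eqn_leq maxp //=.
  by have [i [Ni <-]] := iop N; exact: HN.
exists Q; split=> //; split=> // q ioq.
by have [i [Ni <-]] := ioq N; exact: HN.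
Qed.

Lemma no_inf_descent (v : nat -> nat) N :
  (forall i, N <= i -> v i.+1 <= v i) -> ~ inf_often (fun i => v i.+1 < v i).
Proof.
move=> mono io.
have mono2 i k : N <= i -> v (i + k) <= v i.
  move=> Ni; elim: k => [|k IH]; first by rewrite addn0.
  by rewrite addnS; apply: leq_trans (mono _ _) IH; lia.
have : forall m i, N <= i -> v i <= m -> False.
  elim=> [|m IH] i Ni vi.
    have [k [ik]] := io i; have := mono2 i (k - i) Ni; rewrite subnKC //; lia.
  have [k [ik lt]] := io i; apply: (IH k.+1); first by lia.
  by have := mono2 i (k - i) Ni; rewrite subnKC //; lia.
by move/(_ (v N) N (leqnn _) (leqnn _)).
Qed.

Lemma progress_sound H l (f : nat -> nat) (u : nat -> seq nat) P :
  (forall i, size (u i) = l /\ digits H (u i)) ->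
  (forall i, progress H (f i) (u i) (u i.+1)) -> limsup f P -> ~~ odd P.
Proof.
move=> uP relu [io [N HN]]; apply/negP => oddP.
(* An increase at the height of [P] would persist at the lower height of the smaller priority [f i],
   against its progress condition. *)
have weak i : N <= i -> cutval H P./2.+1 (u i.+1) <= cutval H P./2.+1 (u i).
  move=> Ni; rewrite leqNgt; apply/negP => lt.
  have [s1 d1] := uP i; have [s2 d2] := uP i.+1.
  have fP : 0 < (f i)./2.+1 <= P./2.+1 by rewrite /= ltnS half_leq // HN.
  have := @cutval_mono H _ _ _ _ fP (etrans s1 (esym s2)) d1 d2 lt.
  by have := relu i; rewrite /progress; case: ifP => _; lia.
apply: (no_inf_descent weak) => m; have [i [mi fi]] := io m; exists i; split=> //.
by have := relu i; rewrite /progress fi oddP.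
Qed.

(** * Ranks in nested least and greatest fixed points *)

Fixpoint nlt (m : nat) (s t : seq nat) : bool :=
  match m, s, t with
  | m'.+1, x :: s', y :: t' => (x < y) || (x == y) && nlt m' s' t'
  | _, _, _ => false
  end.

(** Ranks have one component for each of the [h] odd priorities, the largest first. Those that are
    at least [p] fill the first [h - p./2] components, and only these are compared after priority
    [p]. *)
Definition nrel (h p : nat) (s s' : seq nat) : bool :=
  if odd p then nlt (h - p./2) s' s else ~~ nlt (h - p./2) s s'.

Lemma nltN m s t : size s = size t -> ~~ nlt m t s -> nlt m s t \/ take m s = take m t.
Proof.
elim: m s t => [|m IH] [|x s] [|y t] //=; try by right.
move=> [st]; case: (ltngtP x y) => [xy|yx|->] //=; first by left.
by move/(IH _ _ st) => [h|->]; [left|right].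
Qed.

Section Fixpoints.
Variable T : finType.
Implicit Types (P : nat -> {set T}) (X : {set T}).

Definition setp P (i : nat) X : nat -> {set T} := fun p => if p == i then X else P p.

Definition monotone (C : (nat -> {set T}) -> {set T}) : Prop :=
  forall P P', (forall p, P p \subset P' p) -> C P \subset C P'.

(* win C i P nests least (odd) and greatest (even) fixed points over the
   priorities below i; P says where a higher priority may lead. *)
Fixpoint win (C : (nat -> {set T}) -> {set T}) (i : nat) P : {set T} :=
  if i is i'.+1 then
    let F X := win C i' (setp P i' X) in if odd i' then fixset F else cofixset F
  else C P.

Section Win.
Variable C : (nat -> {set T}) -> {set T}.
Hypothesis C_mono : monotone C.

Lemma setp_sub P P' i X X' : (forall p, P p \subset P' p) -> X \subset X' ->
  forall p, setp P i X p \subset setp P' i X' p.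
Proof. by move=> sP sX p; rewrite /setp; case: ifP. Qed.

Lemma fixset_sub (F G : {set T} -> {set T}) :
  {homo G : X Y / X \subset Y} -> (forall X, F X \subset G X) -> fixset F \subset fixset G.
Proof.
move=> Gm FG; rewrite /fixset; elim: #|T| => [|n IH]; first exact: sub0set.
by rewrite !iterS; apply: subset_trans (FG _) (Gm _ _ IH).
Qed.

Lemma cofixset_sub (F G : {set T} -> {set T}) :
  {homo F : X Y / X \subset Y} -> (forall X, F X \subset G X) -> cofixset F \subset cofixset G.
Proof.
move=> Fm FG; rewrite /cofixset setCS; apply: fixset_sub.
  by move=> X Y XY; rewrite /funsetC setCS Fm // setCS.
by move=> X; rewrite /funsetC setCS.
Qed.

Lemma win_mono i P P' : (forall p, P p \subset P' p) -> win C i P \subset win C i P'.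
Proof.
elim: i P P' => [|i IH] P P' sP /=; first exact: C_mono.
have m Q : {homo (fun X => win C i (setp Q i X)) : X Y / X \subset Y}.
  by move=> X Y XY; apply: IH; apply: setp_sub.
have s X : win C i (setp P i X) \subset win C i (setp P' i X).
  by apply: IH; apply: setp_sub.
by case: ifP => _; [apply: fixset_sub (m P') s|apply: cofixset_sub (m P) s].
Qed.

Lemma win_setp_mono i P : {homo (fun X => win C i (setp P i X)) : X Y / X \subset Y}.
Proof. by move=> X Y XY; apply: win_mono; apply: setp_sub. Qed.

(* The rank of a position lists, for each least fixed point from the outermost
   inwards, the stage at which the position enters it. *)
Lemma win_rank i P : {phi : T -> seq nat | (forall v, size (phi v) = i./2) /\
  forall v, v \in win C i P ->
    v \in C (fun p => if p < i then [set v' in win C i P | nrel i./2 p (phi v) (phi v')]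
                      else P p)}.
Proof.
elim: i P => [|i IH] P; first by exists (fun=> [::]).
rewrite /=; case: ifP => oddi; last first.
  set F := fun X => _; have Fm : {homo F : X Y / X \subset Y} by exact: win_setp_mono.
  (* A greatest fixed point equals its own unfolding, so it serves itself as the target of priority
     [i] and no stage is recorded. *)
  have WE := cofixsetK Fm; set W := cofixset F in WE *.
  have [phi [sz H]] := IH (setp P i W); exists phi; split=> [v|v vW].
    by rewrite sz uphalf_half oddi.
  have := H v; rewrite [win _ _ _]WE => /(_ vW); apply: subsetP; apply: C_mono => p.
  rewrite uphalf_half oddi add0n ltnS; case: (ltngtP p i) => [//|ip|->].
    by rewrite /setp gtn_eqF.
  rewrite /setp eqxx; apply/subsetP => v' v'W.
  by rewrite inE v'W /nrel oddi subnn.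
set F := fun X => _; have Fm : {homo F : X Y / X \subset Y} by exact: win_setp_mono.
pose X k := iter k F set0.
have [psi psiP] : {psi : nat -> T -> seq nat | forall k, (forall v, size (psi k v) = i./2) /\
    forall v, v \in X k.+1 ->
      v \in C (fun p => if p < i then [set v' in X k.+1 | nrel i./2 p (psi k v) (psi k v')]
                        else setp P i (X k) p)}.
  by exists (fun k => sval (IH (setp P i (X k)))) => k; exact: svalP (IH (setp P i (X k))).
pose rk := fix_order F.
(* A position entering at stage [rk v] lies in one unfolding over the previous stage and takes the
   inner rank belonging to it. Positions with equal heads thus share one inner rank function, so
   their tails are comparable. *)
exists (fun v => rk v :: psi (rk v).-1 v); split=> [v|v vW].
  by rewrite /= (psiP _).1 uphalf_half oddi.
have rk0 : 0 < rk v by rewrite fix_order_gt0.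
have rkE : (rk v).-1.+1 = rk v by exact: prednK.
have [sz H] := psiP (rk v).-1.
have vX : v \in X (rk v) by rewrite in_iter_fixE // rk0 leqnn.
have := H v; rewrite rkE => /(_ vX); apply: subsetP; apply: C_mono => p.
rewrite uphalf_half oddi add1n ltnS; case: (ltngtP p i) => [pi|ip|->].
- apply/subsetP => v'; rewrite !inE in_iter_fixE // => /andP[/andP[r0 rv'] nr].
  rewrite -fix_order_gt0 r0 /=.
  have hp : p./2 <= i./2 by apply: half_leq; lia.
  move: nr; rewrite /nrel subSn //=.
  rewrite -/(rk v') in rv' r0.
  case: (ltngtP (rk v') (rk v)) rv' => //= [lt _ _|-> _].
    by case: ifP.
  by case: ifP.
- by rewrite /setp gtn_eqF.
- rewrite /setp eqxx; apply/subsetP => v'; rewrite !inE in_iter_fixE // => /andP[r0 rv'].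
  rewrite -fix_order_gt0 r0 /= /nrel oddi subSnn /=.
  by rewrite -/(rk v') in rv'; rewrite (_ : rk v' < rk v) //; lia.
Qed.

Lemma fixset_ext (F G : {set T} -> {set T}) : F =1 G -> fixset F = fixset G.
Proof. by move=> FG; rewrite /fixset; exact: eq_iter. Qed.

(* The game seen by Adam: shifting the priorities by one exchanges the parities. *)
Definition dual (P : nat -> {set T}) : {set T} := ~: C (fun p => ~: P p.+1).

Lemma dual_mono : monotone dual.
Proof. by move=> P P' sP; rewrite /dual setCS; apply: C_mono => p; rewrite setCS. Qed.

Lemma C_ext P P' : (forall p, P p = P' p) -> C P = C P'.
Proof. by move=> e; apply/eqP; rewrite eqEsubset !C_mono // => p; rewrite e. Qed.

End Win.

Lemma win_dual C i P P' : monotone C -> (forall p, P' p.+1 = ~: P p) ->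
  win (dual C) i.+1 P' = ~: win C i P.
Proof.
move=> Cm; have Dm := dual_mono Cm.
elim: i P P' => [|i IH] P P' PP'.
  (* After the shift no move has priority 0, so the innermost fixed point of the dual is that of a
     constant map. *)
  rewrite /= -[LHS]cofixsetK /=; last first.
    by move=> X Y XY; apply: Dm => p; apply: setp_sub.
  rewrite /dual; congr (~: _); apply: (C_ext Cm) => p.
  by rewrite /setp PP' setCK.
pose F X := win C i (setp P i X); pose G X := win (dual C) i.+1 (setp P' i.+1 X).
have GE X : G X = funsetC F X.
  rewrite /G (IH (setp P i (~: X))) // => p.
  by rewrite /setp eqSS; case: ifP; rewrite ?setCK.
rewrite (_ : win (dual C) i.+2 P' = if ~~ odd i then fixset G else cofixset G) //.
rewrite (_ : win C i.+1 P = if odd i then fixset F else cofixset F) //.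
case: (odd i) => /=; last by rewrite /cofixset setCK; exact: fixset_ext.
rewrite /cofixset; congr (~: _); apply: fixset_ext => X.
by rewrite {1}/funsetC GE /funsetC !setCK.
Qed.

End Fixpoints.

(** For the least [m] with at least [2 ^ l] values up to it, minimality bounds the part below and
    subtraction the part above. A set too small to have such an [m] satisfies both bounds anyway. *)
Lemma median (T : finType) (X : {set T}) (k : T -> nat) l : #|X| < 2 ^ l.+1 ->
  exists m, #|[set v in X | k v < m]| < 2 ^ l /\ #|[set v in X | m < k v]| < 2 ^ l.
Proof.
move=> Xl; case: (ltnP #|X| (2 ^ l)) => [lt|ge].
  exists 0; split; last by apply: leq_ltn_trans lt; apply: subset_leq_card; apply/subsetP => v; rewrite inE => /andP[].
  rewrite (_ : [set v in X | _] = set0) ?cards0 ?expn_gt0 //.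
  by apply/setP => v; rewrite !inE ltn0 andbF.
have ex : exists m, 2 ^ l <= #|[set v in X | k v <= m]|.
  exists (\max_(v in X) k v); apply: leq_trans ge _; apply: subset_leq_card.
  by apply/subsetP => v vX; rewrite inE vX /=; exact: leq_bigmax_cond.
case: (ex_minnP ex) => m hm minm; exists m; split.
  case: m minm {hm} => [|m] minm.
    rewrite (_ : [set v in X | _] = set0) ?cards0 ?expn_gt0 //.
    by apply/setP => v; rewrite !inE ltn0 andbF.
  rewrite ltnNge; apply/negP => /minm.
  by rewrite ltnn.
have := cardsID [set v | k v <= m] X.
rewrite (_ : X :&: _ = [set v in X | k v <= m]); last by apply/setP => v; rewrite !inE.
rewrite (_ : X :\: _ = [set v in X | m < k v]); last first.
  by apply/setP => v; rewrite !inE -ltnNge andbC.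
by move=> cE; move: Xl; rewrite -cE expnS; lia.
Qed.

(* The first component of the rank is split at its median m: positions below and
   above m get the extreme digits and are at most half as many, those at m lose
   one component. *)
Lemma embed (T : finType) H h l (X : {set T}) (phi : T -> seq nat) :
  h <= H -> (forall v, v \in X -> size (phi v) = h) -> #|X| < 2 ^ l ->
  exists e : T -> seq nat,
    (forall v, size (e v) = l /\ all (fun x => H <= x + h <= H + h + h) (e v)) /\
    forall v v' j, v \in X -> v' \in X -> 0 < j <= h.+1 ->
      (nlt (h.+1 - j) (phi v) (phi v') -> cutval H j (e v) < cutval H j (e v')) /\
      (take (h.+1 - j) (phi v) = take (h.+1 - j) (phi v') -> cutval H j (e v) = cutval H j (e v')).
Proof.
elim: h l X phi => [|h IHh] l X phi hH szphi.
  exists (fun=> nseq l H); split=> [v|v v' j vX v'X j0]; last first.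
    by rewrite (_ : 1 - j = 0); last lia.
  by rewrite size_nseq; split=> //; apply/allP => x /nseqP[-> _]; lia.
elim: l X szphi => [|l IHl] X szphi Xl.
  exists (fun=> [::]); split=> // v v' j vX.
  by move: Xl; rewrite expn0 ltnS leqn0 cards_eq0 => /eqP X0; rewrite X0 inE in vX.
pose k v := head 0 (phi v).
have phiE v : v \in X -> phi v = k v :: behead (phi v).
  by rewrite /k => /szphi; case: (phi v).
have [m [Sm Rm]] := median k Xl.
have sub (Q : pred T) : {subset [set v in X | Q v] <= X} by move=> v; rewrite inE => /andP[].
have [|e1 [e1P e1R]] := IHl [set v in X | k v < m] _ Sm; first by move=> v /sub/szphi.
have [|e3 [e3P e3R]] := IHl [set v in X | m < k v] _ Rm; first by move=> v /sub/szphi.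
have [|v /sub/szphi|| e2 [e2P e2R]] :=
  IHh l.+1 [set v in X | k v == m] (fun v => behead (phi v)).
- by lia.
- by rewrite size_behead => ->.
- by apply: leq_ltn_trans Xl; apply: subset_leq_card; apply/subsetP => v; exact: sub.
(* The extreme digits are at distance [h.+1] from the centre and are cut only at height [h.+2]. At
   all lower heights they enclose strictly the digits of the middle part, whose distance is at most
   [h]. *)
pose e v := if k v < m then H - h.+1 :: e1 v else if m < k v then H + h.+1 :: e3 v else e2 v.
have eP v : size (e v) = l.+1 /\ all (fun x => H <= x + h.+1 <= H + h.+1 + h.+1) (e v).
  rewrite /e; case: ifP => _ /=; last case: ifP => _ /=.
  - by have [-> ->] := e1P v; rewrite andbT; split=> //; lia.
  - by have [-> ->] := e3P v; rewrite andbT; split=> //; lia.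
  - have [-> a2] := e2P v; split=> //; apply: sub_all a2 => x; lia.
exists e; split=> // v v' j vX v'X j0.
have dg s : all (fun x => H <= x + h.+1 <= H + h.+1 + h.+1) s -> digits H s.
  by apply: sub_all => x; lia.
(* At the root all digits are cut and the compared prefixes of ranks are empty. *)
case: (j =P h.+2) => [->|jh].
  rewrite subnn; split=> // _; have [sv av] := eP v; have [sv' av'] := eP v'.
  by apply: cutval_small; rewrite ?sv ?sv' //; [apply: sub_all av|apply: sub_all av'] => x;
    rewrite /big; lia.
have jm : h.+2 - j = (h.+1 - j).+1 by lia.
have lead2 v0 : exists x s, [/\ e2 v0 = x :: s, size s = l, H - h <= cdig H j x,
    cdig H j x <= H + h & digits H s].
  have [sz al] := e2P v0; case: (e2 v0) sz al => //= x s [sz] /andP[xh al].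
  exists x, s; split=> //; try by rewrite /cdig; case: ifP => _; lia.
  by apply: dg; apply: sub_all al => y; lia.
have bl : big H j (H - h.+1) by rewrite /big; lia.
have br : big H j (H + h.+1) by rewrite /big; lia.
have cl : cdig H j (H - h.+1) = H - h.+1 by rewrite /cdig bl.
have cr : cdig H j (H + h.+1) = H + h.+1 by rewrite /cdig br.
have d1 v0 : size (e1 v0) = l /\ digits H (e1 v0) by have [? /dg] := e1P v0.
have d3 v0 : size (e3 v0) = l /\ digits H (e3 v0) by have [? /dg] := e3P v0.
rewrite jm (phiE v vX) (phiE v' v'X) /= /e.
have gt v1 v2 (a b : nat) : k v2 < k v1 ->
    ((k v1 < k v2) || (k v1 == k v2) && nlt (h.+1 - j) (behead (phi v1)) (behead (phi v2)) ->
    a < b) /\ (k v1 :: take (h.+1 - j) (behead (phi v1)) =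
                k v2 :: take (h.+1 - j) (behead (phi v2)) -> a = b).
  by move=> lt; rewrite ltnNge (ltnW lt) gtn_eqF //; split=> // -[kk]; rewrite kk ltnn in lt.
have lt v1 v2 (a b : nat) : k v1 < k v2 -> a < b ->
    ((k v1 < k v2) || (k v1 == k v2) && nlt (h.+1 - j) (behead (phi v1)) (behead (phi v2)) ->
    a < b) /\ (k v1 :: take (h.+1 - j) (behead (phi v1)) =
                k v2 :: take (h.+1 - j) (behead (phi v2)) -> a = b).
  by move=> ltk ab; split=> // -[kk]; rewrite kk ltnn in ltk.
have [x [s [e2v sz lo hi ds]]] := lead2 v; have [x' [s' [e2v' sz' lo' hi' ds']]] := lead2 v'.
have [s1v d1v] := d1 v; have [s1v' d1v'] := d1 v'.
have [s3v d3v] := d3 v; have [s3v' d3v'] := d3 v'.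
case: (ltngtP (k v) m) => [vm|vm|vm]; case: (ltngtP (k v') m) => [v'm|v'm|v'm].
- have vS : v \in [set v in X | k v < m] by rewrite inE vX.
  have v'S : v' \in [set v in X | k v < m] by rewrite inE v'X.
  have [] := e1R v v' j vS v'S j0.
  rewrite jm (phiE v vX) (phiE v' v'X) /= => lt' eq'.
  split=> [/lt' h'|/eq' ->]; last by rewrite s1v s1v'.
  by have := @cutval_cons_lt H j _ (e1 v) (e1 v') (etrans s1v (esym s1v')) bl; rewrite /= h'.
- apply: lt; first exact: ltn_trans vm v'm.
  apply: (@cutval_head_lt H j (H - h.+1) (H + h.+1)); rewrite ?cl ?cr ?s1v //.
  by clear -hH; lia.
- apply: lt; first by rewrite v'm.
  rewrite e2v'; apply: (@cutval_head_lt H j (H - h.+1) x'); rewrite ?cl ?s1v //.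
  by clear -hH lo'; lia.
- by apply: gt; exact: ltn_trans v'm vm.
- have vS : v \in [set v in X | m < k v] by rewrite inE vX.
  have v'S : v' \in [set v in X | m < k v] by rewrite inE v'X.
  have [] := e3R v v' j vS v'S j0.
  rewrite jm (phiE v vX) (phiE v' v'X) /= => lt' eq'.
  split=> [/lt' h'|/eq' ->]; last by rewrite s3v s3v'.
  by have := @cutval_cons_lt H j _ (e3 v) (e3 v') (etrans s3v (esym s3v')) br; rewrite /= h'.
- by apply: gt; rewrite v'm.
- by apply: gt; rewrite vm.
- apply: lt; first by rewrite vm.
  rewrite e2v; apply: (@cutval_head_lt H j x (H + h.+1)); rewrite ?cr ?sz //.
  by clear -hi; lia.
- have vS : v \in [set v in X | k v == m] by rewrite inE vX vm eqxx.
  have v'S : v' \in [set v in X | k v == m] by rewrite inE v'X v'm eqxx.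
  have jh1 : 0 < j <= h.+1 by clear -j0 jh; lia.
  have [lt' eq'] := e2R v v' j vS v'S jh1.
  by rewrite vm v'm ltnn eqxx /=; split=> [/lt'|[/eq']].
Qed.

(** * The inclusion game *)

Lemma dependent_choice T (Inv : nat -> T -> Prop) (R : nat -> T -> T -> Prop) x0 :
  Inv 0 x0 -> (forall i x, Inv i x -> exists2 y, R i x y & Inv i.+1 y) ->
  exists f : nat -> T, f 0 = x0 /\ forall i, Inv i (f i) /\ R i (f i) (f i.+1).
Proof.
move=> I0 step.
have step' i (x : {x | Inv i x}) : {y : {y | Inv i.+1 y} | R i (sval x) (sval y)}.
  apply: constructive_indefinite_description.
  by have [y Rxy Iy] := step i _ (svalP x); exists (exist _ y Iy).
pose g := fix g i : {x | Inv i x} :=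
  if i is i'.+1 then sval (step' i' (g i')) else exist _ x0 I0.
exists (fun i => sval (g i)); split=> // i; split; first exact: svalP (g i).
exact: svalP (step' i (g i)).
Qed.

(* A play tracks the largest priority m of B since the last time A showed the
   priority e, and emits it then; D is a sticky odd value recording that Eve
   left B. *)
Section Output.
Variables (e D : nat).

(** If priorities above [e] recur, then [e] is not Adam's limit and Eve must win: they emit [D.+1],
    which is even for odd [D] and exceeds every other output. Those below [e] emit the harmless
    0. *)
Definition outp (x m : nat) : nat := if e < x then D.+1 else if x == e then m else 0.
Definition nextm (x m : nat) : nat := if (x == e) && (m != D) then 0 else m.

Variables (x y m : nat -> nat).
Hypothesis oddD : odd D.
Hypothesis y_le : forall i, y i <= D.
Hypothesis m0 : m 0 = 0.
Hypothesis mS : forall i, m i.+1 = nextm (x i) (maxn (m i) (y i)).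
Let o i := outp (x i) (maxn (m i) (y i)).

Lemma memory_le i : m i <= D.
Proof.
elim: i => [|i IH]; first by rewrite m0.
by rewrite mS /nextm; have := y_le i; case: ifP => _; lia.
Qed.

Lemma output_le i : o i <= D.+1.
Proof.
by rewrite /o /outp; have := y_le i; have := memory_le i; repeat (case: ifP => ?); lia.
Qed.

Lemma output_limsup Q : limsup x e -> (forall i, y i <> D) -> limsup y Q -> limsup o Q.
Proof.
move=> [iox [N1 H1]] yD [ioy [N2 H2]].
have mD i : m i < D.
  elim: i => [|i IH]; first by rewrite m0; case: (D) oddD.
  rewrite mS /nextm; have := y_le i; have := yD i; case: ifP => _; last by lia.
  by case: (D) oddD.
have reset i : x i = e -> m i.+1 = 0.
  move=> xe; rewrite mS /nextm xe eqxx /= ifT //.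
  by have := mD i; have := yD i; have := y_le i; lia.
(* After a reset beyond both thresholds the memory only collects values up to [Q]. *)
have [i0 [Ni0 xi0]] := iox (maxn N1 N2).
have mQ i : i0 < i -> m i <= Q.
  elim: i => // i IH ii; have [<-|ne] := eqVneq i0 i; first by rewrite reset.
  have hm : m i <= Q by apply: IH; lia.
  have hy : y i <= Q by apply: H2; lia.
  by rewrite mS /nextm; case: ifP => // _; rewrite geq_max hm.
have oQ i : i0 < i -> o i <= Q.
  move=> ii; have hm := mQ i ii; have hy : y i <= Q by apply: H2; lia.
  have hx : x i <= e by apply: H1; lia.
  rewrite /o /outp.
  by repeat (case: ifP => ?); lia.
split; last by exists i0.+1.
move=> k; have [i [ki yi]] := ioy (maxn k i0.+1).
have [j [ij xj]] := iox i.
(* At the first occurrence of [e] from [i] on, the value [Q] seen at [i] is still in memory and is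
   emitted. *)
have [j' /andP[ij' xj'] minj'] := ex_minnP (ex_intro (fun j => (i <= j) && (x j == e)) j (introT andP (conj ij (introT eqP xj)))).
have keep d : i + d <= j' -> Q <= maxn (m (i + d)) (y (i + d)).
  elim: d => [|d IH] le; first by rewrite addn0 yi leq_maxr.
  have := IH (ltnW _); rewrite -addnS => /(_ le) h.
  rewrite addnS mS /nextm ifF; first by lia.
  apply/negbTE/nandP; left; apply/negP => xe.
  by have := minj' (i + d); rewrite xe leq_addr; lia.
exists j'; split; first by lia.
apply/eqP; rewrite eqn_leq oQ /=; last by lia.
have := keep (j' - i); rewrite subnKC // => /(_ (leqnn _)).
by rewrite /o /outp (eqP xj') ltnn eqxx.
Qed.

Lemma output_limsup_dead i : limsup x e -> y i = D -> limsup o D.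
Proof.
move=> [iox [N H]] yi.
have dead j : i <= j -> maxn (m j) (y j) = D.
  elim: j => [|j IH]; first by rewrite leqn0 => /eqP i0; rewrite m0 -yi i0 max0n.
  rewrite leq_eqVlt => /orP[/eqP <-|/IH h].
    by rewrite yi; have := memory_le i; lia.
  rewrite mS h /nextm eqxx andbF; have := y_le j.+1; lia.
split; last first.
  exists (maxn i N) => j ij; rewrite /o /outp dead; last by lia.
  by have := H j; repeat (case: ifP => ?); lia.
move=> k; have [j [kj xj]] := iox (maxn i k); exists j; split; first by lia.
by rewrite /o /outp xj ltnn eqxx dead //; lia.
Qed.

(** The outputs [D.+1] and 0 are even. Below an odd limit the former dies out, so Adam stays at or
    below [e]; and the odd value itself can only be emitted at an occurrence of [e]. *)
Lemma output_odd Q : limsup o Q -> odd Q -> limsup x e.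
Proof.
move=> [io [N H]] oddQ.
have QD : Q <> D.+1 by move=> QD; move: oddQ; rewrite QD /= oddD.
have xe i : N <= i -> x i <= e.
  move=> Ni; rewrite leqNgt; apply/negP => lt.
  have := H i Ni; rewrite {1}/o /outp lt => DQ.
  have [j [_ oj]] := io 0; have := output_le j; rewrite oj; lia.
split; last by exists N.
move=> k; have [i [ki oi]] := io (maxn k N); exists i; split; first by lia.
move: oi; rewrite /o /outp; case: ifP => [|_]; first by have := xe i; lia.
by case: ifP => [/eqP //|_ Q0]; rewrite -Q0 in oddQ.
Qed.

End Output.

Section Game.
Variables (k n1 n2 : nat) (A : npa k n1) (B : npa k n2) (dB e : nat).
Hypothesis B_le : prio_bounded B dB.
(** An odd value above all priorities of B, whatever the parity of [dB]. *)
Let D := dB.*2.+1.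

Definition pos : finType := ('I_n1 * 'I_n2 * 'I_D.+1)%type.
(** Eve may move to any state, so she is never stuck; a move that is no transition of B shows the
    value [D], which the memory never forgets. *)
Definition yprio (q : 'I_n2) (a : 'I_k) (q' : 'I_n2) : nat :=
  if npa_trans B q a q' then npa_prio B q a q' else D.
Definition seen (v : pos) a q' : nat := maxn v.2 (yprio v.1.2 a q').
Definition gout (v : pos) (a : 'I_k) (qA : 'I_n1) (qB : 'I_n2) : nat :=
  outp e D (npa_prio A v.1.1 a qA) (seen v a qB).
Definition gnext (v : pos) (a : 'I_k) (qA : 'I_n1) (qB : 'I_n2) : pos :=
  (qA, qB, inord (nextm e D (npa_prio A v.1.1 a qA) (seen v a qB))).
Definition ginit : pos := (npa_init A, npa_init B, ord0).

Let oddD : odd D. Proof. by rewrite /D /= odd_double. Qed.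

Lemma yprio_le q a q' : yprio q a q' <= D.
Proof. by rewrite /yprio /D; case: ifP => // /B_le; lia. Qed.

Lemma yprio_ltP q a q' : reflect (yprio q a q' <> D) (npa_trans B q a q').
Proof.
apply: (iffP idP); rewrite /yprio; last by case: ifP.
by move=> tr; rewrite tr; have := B_le tr; rewrite /D; lia.
Qed.

Lemma seen_le v a q : seen v a q <= D.
Proof. by rewrite /seen geq_max yprio_le andbT -ltnS. Qed.

Lemma gout_le v a qA qB : gout v a qA qB <= D.+1.
Proof. by rewrite /gout /outp; have := seen_le v a qB; repeat (case: ifP => ?); lia. Qed.

Lemma gnextE v a qA qB :
  (gnext v a qA qB).2 = nextm e D (npa_prio A v.1.1 a qA) (seen v a qB) :> nat.
Proof.
rewrite /gnext inordK //= ltnS /nextm; have := seen_le v a qB.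
by case: ifP => _ //.
Qed.

(** The labels tell Eve how to answer the given run of A. A move outside B would make the odd [D]
    the limit of the outputs, which the labels exclude; so she builds a run of B, and its limit is
    that of the outputs, hence even. *)
Lemma game_sound (good : pos -> seq nat -> Prop) H l u0 w r :
  (forall v u, good v u -> size u = l /\ digits H u) ->
  (forall v u a qA, good v u -> npa_trans A v.1.1 a qA ->
     exists qB u', good (gnext v a qA qB) u' /\ progress H (gout v a qA qB) u u') ->
  good ginit u0 -> is_run A w r -> limsup (run_prio A w r) e -> lang B w.
Proof.
move=> goodP step g0 [r0 rS] lim.
have [||f [f0 fP]] := @dependent_choice (pos * seq nat)
  (fun i vu => good vu.1 vu.2 /\ vu.1.1.1 = r i)
  (fun i vu vu' => exists qB, vu'.1 = gnext vu.1 (w i) (r i.+1) qB /\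
     progress H (gout vu.1 (w i) (r i.+1) qB) vu.2 vu'.2) (ginit, u0).
- by rewrite r0.
- move=> i [v u] /= [gv vr]; have tr := rS i; rewrite -vr in tr.
  have [qB [u' [g' re]]] := step v u _ _ gv tr.
  by exists (gnext v (w i) (r i.+1) qB, u'); [exists qB|split].
pose rB i := (f i).1.1.2; pose y i := yprio (rB i) (w i) (rB i.+1).
pose m i : nat := (f i).1.2; pose x := run_prio A w r.
have fS i : (f i.+1).1 = gnext (f i).1 (w i) (r i.+1) (rB i.+1).
  by have [_ [qB [E _]]] := fP i; rewrite /rB E.
have fr i : (f i).1.1.1 = r i by have [[]] := fP i.
have mS i : m i.+1 = nextm e D (x i) (maxn (m i) (y i)).
  by rewrite /m fS gnextE fr.
have m0 : m 0 = 0 by rewrite /m f0.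
have y_le i : y i <= D by exact: yprio_le.
pose o i := outp e D (x i) (maxn (m i) (y i)).
have oE i : o i = gout (f i).1 (w i) (r i.+1) (rB i.+1) by rewrite /o /gout fr.
have relo i : progress H (o i) (f i).2 (f i.+1).2.
  have [_ [qB [E re]]] := fP i; rewrite oE (_ : rB i.+1 = qB) //.
  by rewrite /rB E.
have even Q : limsup o Q -> ~~ odd Q.
  apply: (@progress_sound H l o (fun i => (f i).2)) => // i.
  by have [[/goodP]] := fP i.
have legal i : npa_trans B (rB i) (w i) (rB i.+1).
  apply/yprio_ltP => yi; have := output_limsup_dead oddD y_le m0 mS lim yi.
  by move/even; rewrite oddD.
have [Q limQ] := @limsup_exists y D.+1 y_le.
have yD i : y i <> D by apply/yprio_ltP.
have yE : run_prio B w rB =1 y by move=> i; rewrite /y /yprio legal.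
exists rB; split; first by split=> //; rewrite /rB f0.
apply/(@parity_acceptingE _ D.+1) => [i|]; first by rewrite yE ltnS.
exists Q; last by apply: even; exact: (output_limsup oddD y_le m0 mS lim yD limQ).
case: limQ => io [N HN]; split; last by exists N => i; rewrite yE; exact: HN.
by move=> j; have [i [ji yi]] := io j; exists i; rewrite yE.
Qed.

Definition cpre (P : nat -> {set pos}) : {set pos} :=
  [set v | [forall a, forall qA, npa_trans A v.1.1 a qA ==>
             [exists qB, gnext v a qA qB \in P (gout v a qA qB)]]].

Lemma cpreP (P : nat -> {set pos}) (v : pos) : reflect
  (forall a qA, npa_trans A v.1.1 a qA -> exists qB, gnext v a qA qB \in P (gout v a qA qB))
  (v \in cpre P).
Proof.
rewrite inE; apply: (iffP forallP) => [h a qA tr|h a].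
  by have /forallP/(_ qA)/implyP/(_ tr)/existsP := h a.
by apply/forallP => qA; apply/implyP => tr; apply/existsP; exact: h.
Qed.

Lemma cpre_mono : monotone cpre.
Proof.
move=> P P' sP; apply/subsetP => v /cpreP h; apply/cpreP => a qA tr.
by have [qB h'] := h a qA tr; exists qB; apply: subsetP h'.
Qed.

Lemma nrel_progress (T : finType) (X : {set T}) (H h : nat) (phi : T -> seq nat) (ee : T -> seq nat) p v v' : 
  (forall v, v \in X -> size (phi v) = h) ->
  (forall v v' j, v \in X -> v' \in X -> 0 < j <= h.+1 ->
      (nlt (h.+1 - j) (phi v) (phi v') -> cutval H j (ee v) < cutval H j (ee v')) /\
      (take (h.+1 - j) (phi v) = take (h.+1 - j) (phi v') -> cutval H j (ee v) = cutval H j (ee v'))) ->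
  v \in X -> v' \in X -> p./2 <= h -> nrel h p (phi v) (phi v') -> progress H p (ee v) (ee v').
Proof.
move=> sz emb vX v'X ph; have j0 : 0 < p./2.+1 <= h.+1 by rewrite ltnS.
have [lt eq] := emb v' v _ v'X vX j0; rewrite subSS in lt eq.
rewrite /nrel /progress; case: ifP => // _ /nltN[|/lt h'|/eq -> //]; first by rewrite !sz.
exact: ltnW.
Qed.

Variable d1 : nat.
Hypothesis A_le : prio_bounded A d1.
Hypothesis e_even : ~~ odd e.

(** This is where the resolver acts. If Adam won, his labels would force an odd limit of the outputs
    against it; an odd limit requires [e] to be the limit of the run of A, so his word is in both
    languages and the resolver's run is accepting, with an even limit of outputs. *)
Lemma win_init l : history_deterministic B -> (forall w, lang A w -> lang B w) ->
  #|pos| < 2 ^ l -> ginit \in win cpre D.+2 (fun=> setT).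
Proof.
move=> [s HD] incl Vl; rewrite -[_ \in _]negbK -in_setC; apply/negP.
rewrite -(@win_dual _ _ D.+2 (fun=> setT) (fun=> set0) cpre_mono); last by move=> p; rewrite setCT.
set W := win _ _ _ => init.
(* The shifted outputs range up to [D.+2], which gives [dB.+2] odd values. *)
pose h := dB.+2; have hE : D.+3./2 = h by rewrite /D /= doubleK.
have [phi [sz H]] := win_rank (dual_mono cpre_mono) D.+3 (fun=> set0); rewrite -/W hE in sz H.
have Wl : #|W| < 2 ^ l by apply: leq_ltn_trans (max_card _) Vl.
have [u [uP uR]] := embed (leqnn h) (fun v _ => sz v) Wl.
have move_ex v : v \in W -> exists aq : 'I_k * 'I_n1, npa_trans A v.1.1 aq.1 aq.2 /\
    forall qB, gnext v aq.1 aq.2 qB \in W /\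
      progress h (gout v aq.1 aq.2 qB).+1 (u v) (u (gnext v aq.1 aq.2 qB)).
  move=> vW; have := H v vW; rewrite /dual inE => /cpreP h0.
  have [a ha] := not_all_ex_not _ _ h0; have [qA hq] := not_all_ex_not _ _ ha.
  have [tr nex] := imply_to_and _ _ hq; exists (a, qA); split=> // qB.
  have := not_ex_all_not _ _ nex qB; rewrite inE !ltnS gout_le => /negP; rewrite negbK inE.
  move=> /andP[v'W nr]; split=> //; apply: (nrel_progress _ uR) nr => //.
  by rewrite -hE; apply: half_leq; rewrite !ltnS leqW // gout_le.
have [aq0 _] := move_ex _ init.
have /fin_all_exists[ch chP] : forall v : pos, exists aq : 'I_k * 'I_n1, v \in W ->
    npa_trans A v.1.1 aq.1 aq.2 /\
    forall qB, gnext v aq.1 aq.2 qB \in W /\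
      progress h (gout v aq.1 aq.2 qB).+1 (u v) (u (gnext v aq.1 aq.2 qB)).
  by move=> v; case: (boolP (v \in W)) => [/move_ex[aq] h0|_]; [exists aq|exists aq0].
(* The play of Adam's positional strategy against the resolver, together with the letters played,
   which are all that the resolver sees. *)
pose st := fix st i : pos * seq 'I_k := if i is i'.+1 then
  let: (v, p) := st i' in
  (gnext v (ch v).1 (ch v).2 (s (rcons p (ch v).1)), rcons p (ch v).1) else (ginit, [::]).
pose w : word k := fun i => (ch (st i).1).1.
have pre i : Defs.prefix w i = (st i).2.
  elim: i => // i IH; rewrite /Defs.prefix mkseqS -/(Defs.prefix w i) IH /= /w.
  by case: (st i).
pose r i := (st i).1.1.1; pose rB := strat_run B s w.
have stS i : (st i.+1).1 = gnext (st i).1 (w i) (r i.+1) (rB i.+1).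
  rewrite /rB /strat_run /r pre /= /w; by case: (st i).
have rE i : r i.+1 = (ch (st i).1).2 by rewrite /r /=; case: (st i).
have rBE i : rB i = (st i).1.1.2.
  by case: i => // i; rewrite stS.
have stW i : (st i).1 \in W.
  by elim: i => // i IH; rewrite stS rE /w; exact: ((chP _ IH).2 _).1.
have runA : is_run A w r.
  by split=> // i; rewrite rE; exact: (chP _ (stW i)).1.
pose x := run_prio A w r; pose y i := yprio (rB i) (w i) (rB i.+1).
pose m i : nat := (st i).1.2.
have mS i : m i.+1 = nextm e D (x i) (maxn (m i) (y i)).
  by rewrite /m stS gnextE /x /run_prio /y (rBE i).
have y_le i : y i <= D by exact: yprio_le.
pose o i := outp e D (x i) (maxn (m i) (y i)).
have oE i : o i = gout (st i).1 (w i) (r i.+1) (rB i.+1).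
  by rewrite /o /x /run_prio /y (rBE i).
have [Q limQ] : exists Q, limsup o Q.
  by apply: (@limsup_exists _ D.+2) => i; rewrite oE ltnS gout_le.
(* Outputs are shifted by one in the dual game, so the even limit guaranteed there is an odd limit
   here. *)
have oddQ : odd Q.
  rewrite -[odd Q]negbK; apply: (@progress_sound h l (fun i => (o i).+1) (fun i => u (st i).1) Q.+1).
  - by move=> i; have [? al] := uP (st i).1; split=> //; apply: sub_all al => z; clear; lia.
  - by move=> i; rewrite oE stS rE; exact: ((chP _ (stW i)).2 _).2.
  - case: limQ => io [N HN]; split; last by exists N => i /HN.
    by move=> i; have [j [ij oj]] := io i; exists j; rewrite oj.
have limx : limsup x e := output_odd oddD y_le (erefl : m 0 = 0) mS limQ oddQ.
have x_le i : x i < d1.+1 by rewrite ltnS; apply: A_le; case: runA.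
have /HD[[_ runB]] : lang B w.
  by apply: incl; exists r; split=> //; apply/(parity_acceptingE x_le); exists e.
have yE : run_prio B w rB =1 y by move=> i; rewrite /y /yprio runB.
have y_lt i : run_prio B w rB i < D.+1 by rewrite yE ltnS.
move=> /(parity_acceptingE y_lt)[P limP].
have limy : limsup y P.
  case: limP => io [N HN]; split; last by exists N => i; rewrite -yE; exact: HN.
  by move=> i; have [j [ij yj]] := io i; exists j; rewrite -yE.
have yD i : y i <> D by apply/yprio_ltP; exact: runB.
have := output_limsup oddD y_le (erefl : m 0 = 0) mS limx yD limy.
by move/(limsup_unique limQ) => <-; rewrite oddQ.
Qed.

Lemma game_complete l H : H = dB.+1 ->
  history_deterministic B -> (forall w, lang A w -> lang B w) ->
  #|pos| < 2 ^ l -> exists good : pos -> seq nat -> Prop,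
  [/\ forall v u, good v u -> size u = l /\ digits H u,
      forall v u a qA, good v u -> npa_trans A v.1.1 a qA ->
       exists qB u', good (gnext v a qA qB) u' /\ progress H (gout v a qA qB) u u' &
      exists u, good ginit u].
Proof.
move=> HE HD incl Vl; have init := win_init HD incl Vl.
(* The outputs range up to [D.+1], which gives [dB.+1] odd values; hence the digit bound [H]. *)
have hE : D.+2./2 = H by rewrite HE /D /= uphalf_double.
have [phi [sz R]] := win_rank cpre_mono D.+2 (fun=> setT); set W := win _ _ _ in R init.
rewrite hE in sz R.
have Wl : #|W| < 2 ^ l by apply: leq_ltn_trans (max_card _) Vl.
have [u [uP uR]] := embed (leqnn H) (fun v _ => sz v) Wl.
exists (fun v s => v \in W /\ s = u v); split; last by exists (u ginit).
- move=> v _ [_ ->]; have [? al] := uP v; split=> //; apply: sub_all al => z; clear; lia.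
- move=> v _ a qA [vW ->] tr; have /cpreP/(_ a qA tr)[qB] := R v vW.
  rewrite ltnS gout_le inE => /andP[v'W nr].
  exists qB, (u (gnext v a qA qB)); split=> //.
  apply: (nrel_progress _ uR) nr => //.
  by rewrite -hE; apply: half_leq; rewrite leqW // gout_le.
Qed.

End Game.

(** * Closure properties of polynomial-time functions *)

Definition poly (f : fn) : Prop :=
  exists c, forall M rho S, 3 < S -> all (fun v => v <= S) rho -> f M rho <= S ^ c.

(** The bound in [computable] holds only for [S] above the number of tracks, whereas [comp_rec] asks
    for bounds for all [S > 3]; these come from [poly]. *)
Definition effective (f : fn) : Prop := poly f /\ computable f.

Lemma eff_ext (f g : fn) : (forall M rho, f M rho = g M rho) -> effective f -> effective g.
Proof.
by move=> fg; rewrite (_ : f = g) //; do 2!apply: functional_extensionality => ?.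
Qed.

Lemma eff_var i : effective (fun _ rho => nth 0 rho i).
Proof.
split; last exact: comp_var; exists 1 => M rho S S3 rhoS; rewrite expn1.
case: (ltnP i (size rho)) => h; last by rewrite nth_default.
by apply: (allP rhoS); exact: mem_nth.
Qed.

Lemma eff_zero : effective (fun _ _ => 0).
Proof. by split; last exact: comp_zero; exists 0. Qed.

Lemma eff_succ f : effective f -> effective (fun M rho => (f M rho).+1).
Proof.
move=> [[c Hc] cf]; split; last exact: comp_succ.
exists c.+1 => M rho S S3 rhoS; have := Hc M rho S S3 rhoS; rewrite expnS.
have h : 0 < S ^ c by rewrite expn_gt0; lia.
by move: (S ^ c) h => X h; clear -h S3; nia.
Qed.

Lemma eff_get a f : effective f -> effective (fun M rho => nat_of_bool (M a (f M rho))).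
Proof.
move=> [_ cf]; split; last exact: comp_get.
by exists 0 => M rho S S3 _; case: (M a _).
Qed.

Lemma eff_behead f : effective f -> effective (fun M rho => f M (behead rho)).
Proof.
move=> [[c Hc] [w [d H]]]; split.
  by exists c => M rho S S3 rhoS; apply: Hc => //; case: rho rhoS => //= ? ? /andP[].
exists w, d => K E r K4 EK r2 rw.
have EK' : all (fun q => 2 < q < r) (behead E) by case: E EK => //= ? ? /andP[].
have [P HP] := H K _ r K4 EK' r2 rw; exists P => s S KS ES cl.
rewrite (_ : behead _ = map (reg s) (behead E)); last by case: (E).
by apply: HP => // q qE; apply: ES; exact: mem_behead.
Qed.

(** An iteration puts its accumulator and index in front of the environment; removing both gives
    back the outer one, so bodies are nested as with de Bruijn indices. *)
Lemma eff_rec n init (body : (bool -> nat -> bool) -> seq nat -> nat -> nat -> nat) b :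
  effective n -> effective init ->
  effective (fun M rho => body M (behead (behead rho)) (nth 0 rho 0) (nth 0 rho 1)) ->
  (forall M rho S, 3 < S -> all (fun v => v <= S) rho -> forall i, i <= n M rho ->
     prec (body M rho) (init M rho) i <= S ^ b) ->
  effective (fun M rho => prec (body M rho) (init M rho) (n M rho)).
Proof.
move=> [_ cn] [_ ci] [_ cb] H; split.
  by exists b => M rho S S3 rhoS; exact: H.
exact: (comp_rec (b := b) cn ci cb H).
Qed.

Lemma eff_nth k i : effective (fun _ rho => nth 0 (iter k behead rho) i).
Proof.
apply: (@eff_ext (fun _ rho => nth 0 rho (k + i))); last exact: eff_var.
move=> _ rho; elim: k rho => // k IH rho.
by rewrite iterSr -IH addSn nth_behead.
Qed.

Lemma eff_const n : effective (fun _ _ => n).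
Proof. by elim: n => [|n IH]; [exact: eff_zero|exact: eff_succ IH]. Qed.

Lemma eff_add f g : effective f -> effective g -> effective (fun M rho => f M rho + g M rho).
Proof.
move=> ef eg; have E a n : prec (fun acc _ => acc.+1) a n = a + n.
  by elim: n => [|n IH] /=; rewrite ?addn0 // IH addnS.
apply: (@eff_ext (fun M rho => prec (fun acc _ => acc.+1) (f M rho) (g M rho))) => [*|].
  exact: E.
case: (ef) (eg) => [[a Ha] _] [[b Hb] _].
apply: (@eff_rec g f (fun _ _ acc _ => acc.+1) (a + b + 1)) => //.
  by apply: eff_succ; exact: (eff_nth 0 0).
move=> M rho S S3 rhoS i ig; rewrite E; apply: leq_trans (exp_sum a b _); last by lia.
by rewrite leq_add ?Ha // (leq_trans ig) ?Hb.
Qed.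

Lemma eff_pred f : effective f -> effective (fun M rho => (f M rho).-1).
Proof.
move=> ef; have E n : prec (fun _ i => i) 0 n = n.-1 by case: n.
apply: (@eff_ext (fun M rho => prec (fun _ i => i) 0 (f M rho))) => [*|]; first exact: E.
case: (ef) => [[a Ha] _].
apply: (@eff_rec f (fun _ _ => 0) (fun _ _ _ i => i) a) => //.
- exact: eff_zero.
- exact: (eff_nth 0 1).
- by move=> M rho S S3 rhoS i ig; rewrite E; have := Ha M rho S S3 rhoS; lia.
Qed.

Lemma eff_sub f g : effective f -> effective g -> effective (fun M rho => f M rho - g M rho).
Proof.
move=> ef eg; have E a n : prec (fun acc _ => acc.-1) a n = a - n.
  by elim: n => [|n IH] /=; rewrite ?subn0 // IH; lia.
apply: (@eff_ext (fun M rho => prec (fun acc _ => acc.-1) (f M rho) (g M rho))) => [*|].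
  exact: E.
case: (ef) => [[a Ha] _].
apply: (@eff_rec g f (fun _ _ acc _ => acc.-1) a) => //.
  by apply: eff_pred; exact: (eff_nth 0 0).
by move=> M rho S S3 rhoS i ig; rewrite E; have := Ha M rho S S3 rhoS; lia.
Qed.

Lemma eff_behead2 f : effective f -> effective (fun M rho => f M (behead (behead rho))).
Proof. by move=> ef; apply: (@eff_behead (fun M rho => f M (behead rho))); exact: eff_behead. Qed.

Lemma eff_mul f g : effective f -> effective g -> effective (fun M rho => f M rho * g M rho).
Proof.
move=> ef eg; have E a n : prec (fun acc _ => acc + a) 0 n = a * n.
  by elim: n => [|n IH] /=; rewrite ?muln0 // IH mulnS addnC.
apply: (@eff_ext (fun M rho => prec (fun acc _ => acc + f M rho) 0 (g M rho))) => [*|].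
  exact: E.
case: (ef) (eg) => [[a Ha] _] [[b Hb] _].
apply: (@eff_rec g (fun _ _ => 0) (fun M rho acc _ => acc + f M rho) (a + b)) => //.
- exact: eff_zero.
- by apply: eff_add; [exact: (eff_nth 0 0)|exact: eff_behead2].
move=> M rho S S3 rhoS i ig; rewrite E expnD; apply: leq_mul; first exact: Ha.
by rewrite (leq_trans ig) ?Hb.
Qed.

Lemma eff_not (p : (bool -> nat -> bool) -> seq nat -> bool) :
  effective (fun M rho => p M rho) -> effective (fun M rho => ~~ p M rho).
Proof.
move=> ep; apply: (@eff_ext (fun M rho => 1 - p M rho)).
  by move=> M rho; case: (p M rho).
exact: eff_sub (eff_const 1) ep.
Qed.

Lemma eff_and (p q : (bool -> nat -> bool) -> seq nat -> bool) :
  effective (fun M rho => p M rho) -> effective (fun M rho => q M rho) ->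
  effective (fun M rho => p M rho && q M rho).
Proof.
move=> ep eq; apply: (@eff_ext (fun M rho => p M rho * q M rho)).
  by move=> M rho; rewrite mulnb.
exact: eff_mul.
Qed.

Lemma eff_or (p q : (bool -> nat -> bool) -> seq nat -> bool) :
  effective (fun M rho => p M rho) -> effective (fun M rho => q M rho) ->
  effective (fun M rho => p M rho || q M rho).
Proof.
move=> ep eq; apply: (@eff_ext (fun M rho => ~~ (~~ p M rho && ~~ q M rho))).
  by move=> M rho; rewrite negb_and !negbK.
by apply: eff_not; apply: eff_and; exact: eff_not.
Qed.

Lemma eff_eq0 f : effective f -> effective (fun M rho => f M rho == 0).
Proof.
move=> ef; have E n : prec (fun _ _ => 0) 1 n = (n == 0) by case: n.
apply: (@eff_ext (fun M rho => prec (fun _ _ => 0) 1 (f M rho))) => [*|]; first exact: E.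
apply: (@eff_rec f (fun _ _ => 1) (fun _ _ _ _ => 0) 0) => //.
- exact: eff_const.
- exact: eff_zero.
- by move=> M rho S S3 rhoS i ig; rewrite E; case: eqP.
Qed.

Lemma eff_leq f g : effective f -> effective g -> effective (fun M rho => f M rho <= g M rho).
Proof. by move=> ef eg; exact: (eff_eq0 (eff_sub ef eg)). Qed.

Lemma eff_eq f g : effective f -> effective g -> effective (fun M rho => f M rho == g M rho).
Proof.
move=> ef eg; apply: (@eff_ext (fun M rho => (f M rho <= g M rho) && (g M rho <= f M rho))).
  by move=> M rho; rewrite eqn_leq.
by apply: eff_and; exact: eff_leq.
Qed.

Lemma eff_if (p : (bool -> nat -> bool) -> seq nat -> bool) f g :
  effective (fun M rho => p M rho) -> effective f -> effective g ->
  effective (fun M rho => if p M rho then f M rho else g M rho).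
Proof.
move=> ep ef eg.
apply: (@eff_ext (fun M rho => p M rho * f M rho + ~~ p M rho * g M rho)).
  by move=> M rho; case: (p M rho); rewrite /= ?mul1n ?mul0n ?addn0.
by apply: eff_add; apply: eff_mul => //; exact: eff_not.
Qed.

Lemma eff_maxn f g : effective f -> effective g -> effective (fun M rho => maxn (f M rho) (g M rho)).
Proof.
move=> ef eg; apply: (@eff_ext (fun M rho => f M rho + (g M rho - f M rho))).
  by move=> M rho; lia.
by apply: eff_add => //; exact: eff_sub.
Qed.

Lemma eff_minn f g : effective f -> effective g -> effective (fun M rho => minn (f M rho) (g M rho)).
Proof.
move=> ef eg; apply: (@eff_ext (fun M rho => f M rho - (f M rho - g M rho))).
  by move=> M rho; lia.
by apply: eff_sub => //; exact: eff_sub.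
Qed.

Definition nsum n (F : nat -> nat) := prec (fun acc i => acc + F i) 0 n.
Definition nmax n (F : nat -> nat) := prec (fun acc i => maxn acc (F i)) 0 n.
Definition nall n (F : nat -> bool) : bool := prec (fun acc i => (acc != 0) && F i) 1 n != 0.

Lemma nallP n (F : nat -> bool) : reflect (forall i, i < n -> F i) (nall n F).
Proof.
rewrite /nall; elim: n => [|n IH] /=; first by apply: ReflectT.
rewrite (_ : (_ != 0) = (prec (fun acc i => (acc != 0) && F i) 1 n != 0) && F n); last first.
  by case: (_ && _).
apply: (iffP andP) => [[/IH h Fn] i|h]; last by split; [apply/IH => i ni|]; apply: h; lia.
by rewrite ltnS leq_eqVlt => /orP[/eqP ->|/h].
Qed.

Definition nex n (F : nat -> bool) : bool := ~~ nall n (fun i => ~~ F i).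

Lemma nexP n (F : nat -> bool) : reflect (exists2 i, i < n & F i) (nex n F).
Proof.
apply: (iffP negP) => [h|[i ni Fi] /nallP/(_ i ni)]; last by rewrite Fi.
case: (boolP (has F (iota 0 n))) => [/hasP[i]|/hasPn hn].
  by rewrite mem_iota => ni Fi; exists i => //; lia.
by case: h; apply/nallP => i ni; apply: hn; rewrite mem_iota; lia.
Qed.

Lemma nsumE n F : nsum n F = \sum_(i < n) F i.
Proof. by elim: n => [|n IH]; rewrite ?big_ord0 // big_ord_recr -IH. Qed.

Lemma nmax_ub n F i : i < n -> F i <= nmax n F.
Proof.
elim: n => // n IH; rewrite ltnS leq_eqVlt => /orP[/eqP ->|/IH h]; first exact: leq_maxr.
by apply: leq_trans h _; exact: leq_maxl.
Qed.

Lemma nmax_lub n F m : (forall i, i < n -> F i <= m) -> nmax n F <= m.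
Proof.
elim: n => // n IH H; rewrite /nmax /= geq_max H // andbT; apply: IH => i ni.
by apply: H; lia.
Qed.

Section Bounded.
Variables (b : fn) (F : (bool -> nat -> bool) -> seq nat -> nat -> nat).
Hypothesis eb : effective b.
Hypothesis eF : effective (fun M rho => F M (behead rho) (nth 0 rho 0)).

Let eF2 : effective (fun M rho => F M (behead (behead rho)) (nth 0 rho 1)).
Proof.
apply: eff_ext (eff_behead eF) => M rho /=.
by rewrite nth_behead.
Qed.

Lemma poly_bounded : exists c, forall M rho S, 3 < S -> all (fun v => v <= S) rho ->
  b M rho <= S ^ c /\ forall i, i < b M rho -> F M rho i <= S ^ c.
Proof.
case: (eb) (eF) => [[a Ha] _] [[c Hc] _]; exists (a + a.+1 * c) => M rho S S3 rhoS.
have S1 : 1 < S by lia.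
have bS := Ha M rho S S3 rhoS; split; first by apply: leq_trans bS _; apply: exp_mono => //; lia.
move=> i ib; apply: (@leq_trans ((S ^ a.+1) ^ c)); last first.
  by rewrite -expnM; apply: exp_mono => //; lia.
apply: (Hc M (i :: rho)).
  by apply: (leq_trans S3); rewrite -{1}(expn1 S) exp_mono.
rewrite /= (leq_trans (ltnW ib)) ?(leq_trans bS) ?exp_mono //=.
by apply: sub_all rhoS => v vS; rewrite (leq_trans vS) // -{1}(expn1 S) exp_mono.
Qed.

Lemma eff_nsum : effective (fun M rho => nsum (b M rho) (F M rho)).
Proof.
have [c Hc] := poly_bounded.
apply: (@eff_rec b (fun _ _ => 0) (fun M rho acc i => acc + F M rho i) (c + c)) => //.
- exact: eff_zero.
- by apply: eff_add => //; exact: (eff_nth 0 0).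
move=> M rho S S3 rhoS i ib; have [bc Fc] := Hc M rho S S3 rhoS.
apply: (@leq_trans (i * S ^ c)); last by rewrite expnD leq_mul // (leq_trans ib).
elim: i ib => // i IH ib /=; rewrite mulSn addnC leq_add ?Fc //.
by apply: IH; lia.
Qed.

Lemma eff_nmax : effective (fun M rho => nmax (b M rho) (F M rho)).
Proof.
have [c Hc] := poly_bounded.
apply: (@eff_rec b (fun _ _ => 0) (fun M rho acc i => maxn acc (F M rho i)) c) => //.
- exact: eff_zero.
- by apply: eff_maxn => //; exact: (eff_nth 0 0).
move=> M rho S S3 rhoS i ib; have [bc Fc] := Hc M rho S S3 rhoS.
by apply: nmax_lub => j ji; apply: Fc; lia.
Qed.

End Bounded.

Lemma eff_nall b (F : (bool -> nat -> bool) -> seq nat -> nat -> bool) :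
  effective b -> effective (fun M rho => F M (behead rho) (nth 0 rho 0)) ->
  effective (fun M rho => nall (b M rho) (F M rho)).
Proof.
move=> eb eF; apply: eff_not; apply: eff_eq0.
apply: (@eff_rec b (fun _ _ => 1) (fun M rho acc i => (acc != 0) && F M rho i) 0) => //.
- exact: eff_const.
- apply: (@eff_and (fun _ rho => nth 0 rho 0 != 0)
     (fun M rho => F M (behead (behead rho)) (nth 0 rho 1))).
    by apply: eff_not; apply: eff_eq0; exact: (eff_nth 0 0).
  by apply: eff_ext (eff_behead eF) => M rho /=; rewrite nth_behead.
by move=> M rho S S3 rhoS [|i] ib //=; case: (_ && _).
Qed.

Lemma eff_nex b (F : (bool -> nat -> bool) -> seq nat -> nat -> bool) :
  effective b -> effective (fun M rho => F M (behead rho) (nth 0 rho 0)) ->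
  effective (fun M rho => nex (b M rho) (F M rho)).
Proof.
by move=> eb eF; apply: eff_not; apply: eff_nall => //; apply: eff_not.
Qed.

Lemma eff_div f g : effective f -> effective g -> effective (fun M rho => f M rho %/ g M rho).
Proof.
move=> ef eg.
(* The quotient counts the positive multiples of [n] up to [m]; the first factor gives the value 0
   for [n = 0], where the count would be [m]. *)
have E m n : m %/ n = (0 < n) * nsum m (fun j => (j.+1 * n <= m : nat)).
  case: n => [|n]; first by rewrite divn0.
  rewrite mul1n; set d := n.+1.
  have H i : nsum i (fun j => (j.+1 * d <= m : nat)) = minn i (m %/ d).
    elim: i => [|i IH]; first by rewrite min0n.
    rewrite /nsum /= -/(nsum i _) IH -leq_divRL //; case: leqP; lia.
  by rewrite H; have := leq_div m d; lia.
apply: (@eff_ext (fun M rho => (0 < g M rho) *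
   nsum (f M rho) (fun j => (j.+1 * g M rho <= f M rho : nat)))) => [*|]; first by rewrite E.
apply: eff_mul; first by apply: (@eff_leq (fun _ _ => 1)) => //; exact: eff_const.
apply: (@eff_nsum f (fun M rho j => (j.+1 * g M rho <= f M rho : nat))) => //.
apply: eff_leq; last exact: eff_behead.
by apply: eff_mul; [apply: eff_succ; exact: (eff_nth 0 0)|exact: eff_behead].
Qed.

Lemma eff_mod f g : effective f -> effective g -> effective (fun M rho => f M rho %% g M rho).
Proof.
move=> ef eg; apply: (@eff_ext (fun M rho => f M rho - f M rho %/ g M rho * g M rho)).
  by move=> M rho; rewrite {1}(divn_eq (f M rho) (g M rho)) addKn.
by apply: eff_sub => //; apply: eff_mul => //; exact: eff_div.
Qed.

(** * The predicates evaluated by the machine *)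

Lemma eff_half f : effective f -> effective (fun M rho => (f M rho)./2).
Proof.
move=> ef; apply: (@eff_ext (fun M rho => f M rho %/ 2)) => [M rho|]; first by rewrite divn2.
exact: eff_div ef (eff_const 2).
Qed.

Lemma eff_odd f : effective f -> effective (fun M rho => odd (f M rho)).
Proof.
move=> ef; apply: (@eff_ext (fun M rho => f M rho %% 2)) => [M rho|]; first by rewrite modn2.
exact: eff_mod ef (eff_const 2).
Qed.

Ltac eff_user := fail.
Ltac eff_step :=
  first
  [ assumption
  | exact: eff_const
  | exact: (eff_nth 0 _) | exact: (eff_nth 1 _) | exact: (eff_nth 2 _) | exact: (eff_nth 3 _)
  | match goal with H : effective ?f |- _ =>
      first [exact: (eff_behead H) | exact: (eff_behead2 H) | exact: (eff_behead (eff_behead2 H))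
            |exact: (eff_behead2 (eff_behead2 H))] end
  | eff_user
  | lazymatch goal with
    | |- effective (fun M rho => nat_of_bool (@?p M rho && @?q M rho)) => apply: eff_and
    | |- effective (fun M rho => nat_of_bool (@?p M rho || @?q M rho)) => apply: eff_or
    | |- effective (fun M rho => nat_of_bool (~~ @?p M rho)) => apply: eff_not
    | |- effective (fun M rho => nat_of_bool (odd _)) => apply: eff_odd
    | |- effective (fun M rho => nat_of_bool (nall _ _)) => apply: eff_nall
    | |- effective (fun M rho => nat_of_bool (nex _ _)) => apply: eff_nex
    | |- effective (fun M rho => nat_of_bool (leq _ _)) => apply: eff_leq
    | |- effective (fun M rho => nat_of_bool (_ == _)) => apply: eff_eq
    | |- effective (fun M rho => nat_of_bool (M _ _)) => apply: eff_get
    | |- effective (fun M rho => if _ then _ else _) => apply: eff_if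
    | |- effective (fun M rho => maxn _ _) => apply: eff_maxn
    | |- effective (fun M rho => minn _ _) => apply: eff_minn
    | |- effective (fun M rho => addn _ _) => apply: eff_add
    | |- effective (fun M rho => muln _ _) => apply: eff_mul
    | |- effective (fun M rho => subn _ _) => apply: eff_sub
    | |- effective (fun M rho => divn _ _) => apply: eff_div
    | |- effective (fun M rho => modn _ _) => apply: eff_mod
    | |- effective (fun M rho => half _) => apply: eff_half
    | |- effective (fun M rho => nsum _ _) => apply: eff_nsum
    | |- effective (fun M rho => nmax _ _) => apply: eff_nmax
    | |- effective (fun M rho => S _) => apply: eff_succ
    end ].
Ltac eff := repeat eff_step.

Definition memo := bool -> nat -> bool.

(* The input is stored in reverse order in the array true. *)
Definition in_bit (M : memo) (len i : nat) : bool := M true (len - i.+1).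

(** Zeros end the unary numbers, so a one belongs to the number whose index is the count of zeros
    before it; no parsing state is needed. *)
Definition in_field (M : memo) (len m : nat) : nat :=
  nsum len (fun i => in_bit M len i && (nsum i (fun j => ~~ in_bit M len j) == m)).

Lemma eff_in_field f g : effective f -> effective g ->
  effective (fun M rho => in_field M (f M rho) (g M rho)).
Proof. by move=> ef eg; rewrite /in_field /in_bit; eff. Qed.

Section Fields.
Variables (M : memo) (len : nat).
Definition in_k := in_field M len 0.
Definition in_n1 := in_field M len 1.
Definition in_init1 := in_field M len 2.
(** Three numbers precede the transitions of A, namely the size of the alphabet and the size and
    initial state of A, and each triple takes two. *)
Definition in_offset2 := 3 + 2 * (in_n1 * in_k * in_n1).
Definition in_n2 := in_field M len in_offset2.
Definition in_init2 := in_field M len in_offset2.+1.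
Definition in_trans1 p a q := in_field M len (3 + 2 * ((p * in_k + a) * in_n1 + q)) != 0.
Definition in_prio1 p a q := in_field M len (4 + 2 * ((p * in_k + a) * in_n1 + q)).
Definition in_trans2 p a q := in_field M len (in_offset2 + (2 + 2 * ((p * in_k + a) * in_n2 + q))) != 0.
Definition in_prio2 p a q := in_field M len (in_offset2 + (3 + 2 * ((p * in_k + a) * in_n2 + q))).
(** The bound [d2] is not part of the input, so the largest priority written for B replaces it;
    triples that are no transitions are written with 0. *)
Definition max_prio2 := nmax (in_n2 * in_k * in_n2) (fun i => in_field M len (in_offset2 + (3 + 2 * i))).
Definition dead_value := (2 * max_prio2).+1.
Definition height := max_prio2.+1.
Definition digit_base := (2 * height).+1.
Definition num_positions := in_n1 * in_n2 * dead_value.+1.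
End Fields.

Ltac eff_user ::= apply: eff_in_field.

Section EffFields.
Variables f p a q : fn.
Hypotheses (ef : effective f) (ep : effective p) (ea : effective a) (eq : effective q).

Lemma eff_in_k : effective (fun M rho => in_k M (f M rho)).
Proof. by rewrite /in_k; eff. Qed.
Lemma eff_in_n1 : effective (fun M rho => in_n1 M (f M rho)).
Proof. by rewrite /in_n1; eff. Qed.
Lemma eff_in_init1 : effective (fun M rho => in_init1 M (f M rho)).
Proof. by rewrite /in_init1; eff. Qed.
Lemma eff_in_n2 : effective (fun M rho => in_n2 M (f M rho)).
Proof. by rewrite /in_n2 /in_offset2 /in_n1 /in_k; eff. Qed.
Lemma eff_in_init2 : effective (fun M rho => in_init2 M (f M rho)).
Proof. by rewrite /in_init2 /in_offset2 /in_n1 /in_k; eff. Qed.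
Lemma eff_in_trans1 : effective (fun M rho => in_trans1 M (f M rho) (p M rho) (a M rho) (q M rho)).
Proof. by rewrite /in_trans1 /in_n1 /in_k; eff. Qed.
Lemma eff_in_prio1 : effective (fun M rho => in_prio1 M (f M rho) (p M rho) (a M rho) (q M rho)).
Proof. by rewrite /in_prio1 /in_n1 /in_k; eff. Qed.
Lemma eff_in_trans2 : effective (fun M rho => in_trans2 M (f M rho) (p M rho) (a M rho) (q M rho)).
Proof. by rewrite /in_trans2 /in_n2 /in_offset2 /in_n1 /in_k; eff. Qed.
Lemma eff_in_prio2 : effective (fun M rho => in_prio2 M (f M rho) (p M rho) (a M rho) (q M rho)).
Proof. by rewrite /in_prio2 /in_n2 /in_offset2 /in_n1 /in_k; eff. Qed.
Lemma eff_max_prio2 : effective (fun M rho => max_prio2 M (f M rho)).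
Proof. by rewrite /max_prio2 /in_n2 /in_offset2 /in_n1 /in_k; eff. Qed.

End EffFields.

Ltac eff_input := first [apply: eff_in_k | apply: eff_in_n1 | apply: eff_in_init1
  | apply: eff_in_n2 | apply: eff_in_init2 | apply: eff_in_trans1 | apply: eff_in_prio1 | apply: eff_in_trans2
  | apply: eff_in_prio2 | apply: eff_max_prio2 | apply: eff_in_field].
Ltac eff_user ::= eff_input.

Section EffParameters.
Variable f : fn.
Hypothesis ef : effective f.

Lemma eff_dead_value : effective (fun M rho => dead_value M (f M rho)).
Proof. by rewrite /dead_value; eff. Qed.
Lemma eff_height : effective (fun M rho => height M (f M rho)).
Proof. by rewrite /height; eff. Qed.
Lemma eff_digit_base : effective (fun M rho => digit_base M (f M rho)).
Proof. by rewrite /digit_base /height; eff. Qed.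
Lemma eff_num_positions : effective (fun M rho => num_positions M (f M rho)).
Proof. by rewrite /num_positions /dead_value; eff. Qed.

End EffParameters.

(** Repeated division avoids the power [b ^ i], which need not be polynomially bounded. *)
Definition idiv (b v i : nat) : nat := prec (fun acc _ => acc %/ b) v i.

Lemma idivE b v i : idiv b v i = v %/ b ^ i.
Proof.
elim: i => [|i IH]; first by rewrite expn0 divn1.
by rewrite /idiv /= -/(idiv b v i) IH -divnMA -expnSr.
Qed.

Lemma eff_idiv f g h : effective f -> effective g -> effective h ->
  effective (fun M rho => idiv (f M rho) (g M rho) (h M rho)).
Proof.
move=> ef eg eh; case: (eg) => [[c Hc] _].
apply: (@eff_rec h g (fun M rho acc _ => acc %/ f M rho) c) => //; first by eff.
move=> M rho S S3 rhoS i _; rewrite -/(idiv _ _ _) idivE.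
exact: leq_trans (leq_div _ _) (Hc M rho S S3 rhoS).
Qed.

Ltac eff_number := first [apply: eff_dead_value | apply: eff_height | apply: eff_digit_base | apply: eff_num_positions
  | apply: eff_idiv].
Ltac eff_user ::= first [eff_input | eff_number].

Definition bitlen (v : nat) : nat := nsum v.+1 (fun i => 0 < idiv 2 v i).

Lemma eff_bitlen f : effective f -> effective (fun M rho => bitlen (f M rho)).
Proof. by move=> ef; rewrite /bitlen; eff. Qed.

Definition digit (M : memo) (len u i : nat) : nat := idiv (digit_base M len) u i %% digit_base M len.

Lemma eff_digit f u i : effective f -> effective u -> effective i ->
  effective (fun M rho => digit M (f M rho) (u M rho) (i M rho)).
Proof. by move=> ef eu ei; rewrite /digit; eff. Qed.

Lemma eff_big f g h : effective f -> effective g -> effective h ->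
  effective (fun M rho => big (f M rho) (g M rho) (h M rho)).
Proof. by move=> ef eg eh; rewrite /big; eff. Qed.

Lemma eff_cdig f g h : effective f -> effective g -> effective h ->
  effective (fun M rho => cdig (f M rho) (g M rho) (h M rho)).
Proof. by move=> ef eg eh; rewrite /cdig /big; eff. Qed.

Ltac eff_digit := first [apply: eff_bitlen | apply: eff_digit | apply: eff_big | apply: eff_cdig].
Ltac eff_user ::= first [eff_input | eff_number | eff_digit].

(* Horner's scheme for cutval; the cap U is never reached when it is the number
   of digit lists, and keeps the function polynomially bounded. *)
Definition horner (M : memo) (len U j u : nat) : nat :=
  prec (fun acc i => minn (acc * digit_base M len +
      (if nall i (fun i' => big (height M len) j (digit M len u i'))
       then cdig (height M len) j (digit M len u i) else 0)) U) 0 (bitlen (num_positions M len)).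

Lemma eff_horner f U j u : effective f -> effective U -> effective j -> effective u ->
  effective (fun M rho => horner M (f M rho) (U M rho) (j M rho) (u M rho)).
Proof.
move=> ef eU ej eu; case: (eU) => [[c Hc] _].
apply: (@eff_rec (fun M rho => bitlen (num_positions M (f M rho))) (fun _ _ => 0)
  (fun M rho acc i => minn (acc * digit_base M (f M rho) +
      (if nall i (fun i' => big (height M (f M rho)) (j M rho) (digit M (f M rho) (u M rho) i'))
       then cdig (height M (f M rho)) (j M rho) (digit M (f M rho) (u M rho) i) else 0))
     (U M rho)) c); try by eff.
move=> M rho S S3 rhoS [|i] _ //; apply: leq_trans (Hc M rho S S3 rhoS).
exact: geq_minr.
Qed.

Definition progress_leaf (M : memo) (len U p u u' : nat) : bool :=
  if odd p then horner M len U p./2.+1 u' < horner M len U p./2.+1 u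
  else horner M len U p./2.+1 u' <= horner M len U p./2.+1 u.

Lemma eff_progress_leaf f U p u u' : effective f -> effective U -> effective p ->
  effective u -> effective u' ->
  effective (fun M rho => progress_leaf M (f M rho) (U M rho) (p M rho) (u M rho) (u' M rho)).
Proof.
move=> ef eU ep eu eu'; apply: (@eff_ext (fun M rho =>
  if odd (p M rho) then (horner M (f M rho) (U M rho) (p M rho)./2.+1 (u' M rho)
                         < horner M (f M rho) (U M rho) (p M rho)./2.+1 (u M rho) : nat)
  else horner M (f M rho) (U M rho) (p M rho)./2.+1 (u' M rho)
       <= horner M (f M rho) (U M rho) (p M rho)./2.+1 (u M rho))).
  by move=> M rho; rewrite /progress_leaf; case: ifP.
have eh v : effective v ->
    effective (fun M rho => horner M (f M rho) (U M rho) (p M rho)./2.+1 (v M rho)).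
  by move=> ev; apply: eff_horner; eff.
have h1 := eh _ eu; have h2 := eh _ eu'; by eff.
Qed.

Lemma eff_outp e D x m : effective e -> effective D -> effective x -> effective m ->
  effective (fun M rho => outp (e M rho) (D M rho) (x M rho) (m M rho)).
Proof. by move=> ee eD ex em; rewrite /outp; eff. Qed.

Lemma eff_nextm e D x m : effective e -> effective D -> effective x -> effective m ->
  effective (fun M rho => nextm (e M rho) (D M rho) (x M rho) (m M rho)).
Proof. by move=> ee eD ex em; rewrite /nextm; eff. Qed.

Definition seen_code (M : memo) (len m qB a qB' : nat) : nat :=
  maxn m (if in_trans2 M len qB a qB' then in_prio2 M len qB a qB' else dead_value M len).

Lemma eff_seen_code f m q a q' : effective f -> effective m -> effective q -> effective a ->
  effective q' ->
  effective (fun M rho => seen_code M (f M rho) (m M rho) (q M rho) (a M rho) (q' M rho)).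
Proof. by move=> ef em eq ea eq'; rewrite /seen_code; eff. Qed.

(** A mixed-radix code with [e] as its leading digit: the games for all [e] share the array [false]
    and are treated by the same sweeps. *)
Definition pos_code (M : memo) (len U e qA qB m u : nat) : nat :=
  (((e * in_n1 M len + qA) * in_n2 M len + qB) * (dead_value M len).+1 + m) * U + u.

Lemma eff_pos_code f U e qA qB m u : effective f -> effective U -> effective e ->
  effective qA -> effective qB -> effective m -> effective u ->
  effective (fun M rho => pos_code M (f M rho) (U M rho) (e M rho) (qA M rho) (qB M rho)
     (m M rho) (u M rho)).
Proof. by move=> *; rewrite /pos_code; eff. Qed.

Ltac eff_move := first [apply: eff_progress_leaf | apply: eff_outp | apply: eff_nextm
  | apply: eff_seen_code | apply: eff_pos_code].
Ltac eff_user ::= first [eff_input | eff_number | eff_digit | eff_move].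

Definition answerable (M : memo) (len U e qA qB m u a qA' : nat) : bool :=
  nex (in_n2 M len) (fun qB' => nex U (fun u' =>
    progress_leaf M len U (outp e (dead_value M len) (in_prio1 M len qA a qA') (seen_code M len m qB a qB')) u u' &&
    ~~ M false (pos_code M len U e qA' qB'
        (nextm e (dead_value M len) (in_prio1 M len qA a qA') (seen_code M len m qB a qB')) u'))).

Definition safe (M : memo) (len U e qA qB m u : nat) : bool :=
  nall (in_k M len) (fun a => nall (in_n1 M len) (fun qA' =>
    ~~ in_trans1 M len qA a qA' || answerable M len U e qA qB m u a qA')).

Lemma eff_safe f U e qA qB m u : effective f -> effective U -> effective e ->
  effective qA -> effective qB -> effective m -> effective u ->
  effective (fun M rho => safe M (f M rho) (U M rho) (e M rho) (qA M rho) (qB M rho)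
     (m M rho) (u M rho)).
Proof. by move=> *; rewrite /safe /answerable; eff. Qed.

Definition losing (M : memo) (len U p : nat) : bool :=
  ~~ safe M len U
    (p %/ U %/ (dead_value M len).+1 %/ in_n2 M len %/ in_n1 M len)
    (p %/ U %/ (dead_value M len).+1 %/ in_n2 M len %% in_n1 M len)
    (p %/ U %/ (dead_value M len).+1 %% in_n2 M len)
    (p %/ U %% (dead_value M len).+1)
    (p %% U).

Lemma eff_losing f U p : effective f -> effective U -> effective p ->
  effective (fun M rho => losing M (f M rho) (U M rho) (p M rho)).
Proof. by move=> *; rewrite /losing; apply: eff_not; apply: eff_safe; eff. Qed.

(** Since priorities are written in unary, [len] exceeds all those of A. *)
Definition verdict (M : memo) (len U : nat) : bool :=
  nall len (fun e => odd e ||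
    nex U (fun u => ~~ M false (pos_code M len U e (in_init1 M len) (in_init2 M len) 0 u))).

Lemma eff_verdict f U : effective f -> effective U ->
  effective (fun M rho => verdict M (f M rho) (U M rho)).
Proof. by move=> *; rewrite /verdict; eff. Qed.

Definition npos (M : memo) (len U : nat) : nat := len * num_positions M len * U.

Lemma eff_npos f U : effective f -> effective U ->
  effective (fun M rho => npos M (f M rho) (U M rho)).
Proof. by move=> *; rewrite /npos; eff. Qed.

(** * Copying the input *)

Definition somep (s : sym) : bool := s != None.

Definition erase : prog := Seq (Wr None DLeft) (Seq (Whl somep (Mv DLeft)) (Mv DLeft)).

(** Taking bits from the end keeps the rest of the input contiguous, so its last bit is always next
    to the first blank. This is what reverses the copy. *)
Definition pop_last (K : nat) : prog :=
  Seq (Whl somep (Mv DRight)) (Seq (Mv DLeft)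
    (Seq (Ite marked (Seq erase (setbit K true 3)) erase) (Seq (inc K 3) (mvs DRight 2)))).

Definition copied (s : st) (x : seq bool) : st :=
  St (fun q => if q == 3 then reg s 3 + size x else reg s q)
     (fun b i => bits s b i || [&& b, reg s 3 <= i & nth false (rev x) (i - reg s 3)]) [::].

Section Copy.
Variables (K S : nat).
Hypotheses (K4 : 3 < K) (KS : K <= S).

Lemma rep_init_tape x :
  rep K (St (fun=> 0) (fun _ _ => false) x) (upd (input_tape x) 0 (Some true)).
Proof.
have far z : (0 <= z)%Z -> input_tape x z = None.
  by rewrite /input_tape => z0; case: Z.leb_spec => //; lia.
have cell0 i j : j < K -> marked (upd (input_tape x) 0 (Some true) (cell K i j)) = (i == 0) && (j == 0).
  move=> jK; have -> : 0%Z = cell K 0 0 by rewrite /cell; lia.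
  rewrite upd_cell ?far ?/cell //; try lia; by case: ifP.
split=> [i|a i|r i rK||i].
- by rewrite cell0 ?andbT //; lia.
- have a3 := atrack_lt a; have a0 := atrack_gt0 a; rewrite cell0; last by lia.
  by rewrite (_ : atrack a == 0 = false) ?andbF //; lia.
- rewrite cell0 /= ?ltn0; last by lia.
  by rewrite (_ : r == 0 = false) ?andbF //; lia.
- by rewrite /upd /input_tape.
- rewrite /upd /input_tape; case: Z.eqb_spec; first by lia.
  by case: Z.leb_spec => [_ _|]; [congr nth; lia|lia].
Qed.

Lemma rep_pop s T x b : inp s = rcons x b -> rep K s T ->
  rep K (St (reg s) (bits s) x) (upd T (-2 - Z.of_nat (size x))%Z None).
Proof.
move=> sx [r0 r1 r2 r3 r4].
have e i j : upd T (-2 - Z.of_nat (size x))%Z None (cell K i j) = T (cell K i j).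
  by rewrite /upd /cell; case: Z.eqb_spec => //; lia.
split=> [i|a i|r i rK||i].
- by rewrite e.
- by rewrite e r1.
- by rewrite e r2.
- by rewrite /upd; case: Z.eqb_spec => //; lia.
rewrite /upd; case: Z.eqb_spec => [h|h].
  by rewrite nth_default //= size_map; lia.
rewrite r4 sx map_rcons nth_rcons size_map; case: ltnP => // h'.
by rewrite ifF ?[RHS]nth_default ?size_map //; lia.
Qed.

Lemma runs_mv d p T : runs (Mv d) (p, T) (mv d p, T) 1.
Proof. by exists 1 => //; exact: ExMv. Qed.

Lemma runs_erase s T x b : inp s = rcons x b -> rep K s T -> size x <= S ->
  runs erase (-2 - Z.of_nat (size x), T)%Z
    (0, upd T (-2 - Z.of_nat (size x)) None)%Z (3 * S + 4).
Proof.
move=> sx rT xS; set T' := upd T _ None; have [_ _ _ r3 r4] := rep_pop sx rT.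
rewrite -/T' in r3 r4.
pose f i := (-1 - Z.of_nat (size x - i), T')%Z.
apply: (@runs_le _ _ _ (1 + (size x * (1 + 2) + 2 + 1))); first by lia.
apply: (@runs_seq _ _ _ (f 0)).
  exists 1 => //; rewrite /f subn0 (_ : -1 - Z.of_nat (size x) = mv DLeft (-2 - Z.of_nat (size x)))%Z; last by rewrite /mv; lia.
  exact: ExWr.
apply: (@runs_seq _ _ _ (f (size x))); last first.
  rewrite /f subnn; exact: (@runs_mv DLeft).
apply: runs_whl => [i im|]; last first.
  by rewrite -[(f _).2 _]/(T' (-1 - Z.of_nat (size x - size x))%Z) subnn [T' _]r3.
rewrite -[(f i).2 _]/(T' (-1 - Z.of_nat (size x - i))%Z); split.
  rewrite (_ : -1 - Z.of_nat (size x - i) = -2 - Z.of_nat (size x - i.+1))%Z; last by lia.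
  by rewrite r4 /= (nth_map false) //; lia.
rewrite /f (_ : -1 - Z.of_nat (size x - i.+1) = mv DLeft (-1 - Z.of_nat (size x - i)))%Z.
  exact: runs_mv.
by rewrite /mv; lia.
Qed.

Lemma runs_pop s T x b : inp s = rcons x b -> rep K s T -> size x < S -> reg s 3 <= S -> 
  exists2 T', rep K (St (fun q => if q == 3 then (reg s 3).+1 else reg s q)
     (fun a i => ([&& a, b & i == reg s 3]) || bits s a i) x) T' &
  runs (pop_last K) (-2, T)%Z (-2, T')%Z (S ^ 15).
Proof.
move=> sx rT xS vS; have S1 : 1 < S by lia.
pose s1 := St (reg s) (bits s) x.
have r1 := rep_pop sx rT; rewrite -/s1 in r1; set T1 := upd T _ None in r1.
have K3 : 2 < 3 < K by lia.
have e3 : reg s1 3 <= S ^ 1 by rewrite expn1.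
pose s2 := if b then setm s1 true (reg s 3) else s1.
have [T2 r2 e2] : exists2 T2, rep K s2 T2 &
    runs (Ite marked (Seq erase (setbit K true 3)) erase) (-2 - Z.of_nat (size x), T)%Z (0%Z, T2)
      (3 * S + 4 + S ^ 5 + 2).
  have ee := runs_erase sx rT (ltnW xS); rewrite -/T1 in ee.
  have [_ _ _ _ r4] := rT.
  have rd : T (-2 - Z.of_nat (size x))%Z = Some b.
    by rewrite r4 sx map_rcons nth_rcons size_map ltnn eqxx.
  case: b rd @s2 {sx} => rd s2.
  - have [/(_ _ r1)[T2 r2 e2]] := RT_setbit_le K4 KS true K3 e3.
    exists T2 => //; have [m le e] := runs_seq ee e2; exists m.+2; first by lia.
    by apply: ExIteT => //; rewrite rd.
  - exists T1 => //; have [m le e] := ee; exists m.+2; first by lia.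
    by apply: ExIteF => //; rewrite rd.
have s23 : reg s2 3 <= S ^ 1 by rewrite /s2; case: (b).
have [/(_ _ r2)[T3 r3 e3']] := RT_inc_le K4 KS K3 s23.
exists T3.
  rewrite (_ : St _ _ x = setr s2 3 (reg s2 3).+1) //.
  apply: st_eq => [q|a i|]; rewrite /s2; case: (b) => //=; rewrite ?andbF //.
  by case: a.
apply: (@runs_le _ _ _ (S * 3 + 2 + (1 + (3 * S + 4 + S ^ 5 + 2 + (S ^ (1 + 4) + 4))))).
  have h5 := exp_sum 5 5 S1; apply: leq_trans (exp_sum 3 11 S1).
  apply: (@leq_trans (6 * S + 13 + (S ^ 5 + S ^ 5))); last first.
    apply: leq_add => //; have S4 : 4 <= S by lia.
    have S16 : 16 <= S * S by exact: (leq_mul S4 S4).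
    have := leq_mul (leqnn S) S16; rewrite !expnS expn0 muln1.
    by move: (S * (S * S)) => X; clear -KS K4; lia.
  by rewrite (_ : 1 + 4 = 5) //; move: (S ^ 5) => X; clear; lia.
pose f i := (-2 - Z.of_nat i, T)%Z; pose n := (size x).+1.
have [_ _ _ _ r4] := rT.
apply: (@runs_seq _ _ _ (f n)).
  apply: (@runs_le _ _ _ (n * (1 + 2) + 2)); first by rewrite /n; lia.
  rewrite (_ : (-2, T)%Z = f 0); last by rewrite /f Z.sub_0_r.
  apply: runs_whl => [i im|]; last first.
    by rewrite -[(f n).2 _]/(T (-2 - Z.of_nat n)%Z) r4 sx nth_default // size_map size_rcons.
  rewrite -[(f i).2 _]/(T (-2 - Z.of_nat i)%Z) r4 sx (nth_map false) ?size_rcons //; split=> //.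
  rewrite /f.
  rewrite (_ : -2 - Z.of_nat i.+1 = mv DRight (-2 - Z.of_nat i))%Z; first exact: runs_mv.
  by rewrite /mv; lia.
apply: (@runs_seq _ _ _ (-2 - Z.of_nat (size x), T)%Z).
  rewrite /f (_ : -2 - Z.of_nat (size x) = mv DLeft (-2 - Z.of_nat n))%Z; first exact: runs_mv.
  by rewrite /mv /n; lia.
apply: (runs_seq e2); apply: (runs_seq e3').
exact: (runs_right 2 0).
Qed.

Lemma runs_copy s T x : inp s = x -> rep K s T -> reg s 3 + size x < S ->
  exists2 T', rep K (copied s x) T' &
  runs (Whl somep (pop_last K)) (-2, T)%Z (-2, T')%Z (size x * (S ^ 15 + 2) + 2).
Proof.
elim/last_ind: x s T => [|x b IH] s T sx rT xS; have [_ _ _ _ r4] := rT.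
  exists T.
    rewrite (_ : copied s [::] = s) //; apply: st_eq => [q|a i|] //=.
      by case: eqP => // ->; rewrite addn0.
    by rewrite nth_nil !andbF orbF.
  exists 2 => //; apply: ExWhlF; have := r4 0; rewrite sx /= => -> //.
rewrite size_rcons in xS.
have [||T1 rT1 e1] := runs_pop sx rT; try lia.
set s1 := St _ _ x in rT1.
have [|T2 rT2 e2] := IH s1 T1 erefl rT1; first by rewrite /s1 /=; lia.
exists T2.
  rewrite (_ : copied s (rcons x b) = copied s1 x) //.
  apply: st_eq => [q|a i|] //=; first by rewrite size_rcons; case: eqP => // _; lia.
  rewrite rev_rcons; case: a => /=; last by [].
  case: (ltngtP i (reg s 3)) => h.
  - by rewrite andbF.
  - by rewrite andbF /= (_ : i - reg s 3 = (i - (reg s 3).+1).+1) //; lia.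
  - by rewrite h subnn /= andbT orbF orbC.
have [m1 l1 x1] := e1; have [m2 l2 x2] := e2.
exists (m1 + m2).+2; first by rewrite size_rcons mulSn; lia.
apply: ExWhlT x1 x2; have := r4 0; rewrite sx /=.
by case: (x) => [|? ?] /= ->.
Qed.

Definition copy_input : prog :=
  Seq (Seq (Mv DLeft) (Seq (Wr (Some true) DLeft) (Mv DRight)))
    (Seq (mvs DRight 2) (Seq (Whl somep (pop_last K)) (mvs DLeft 2))).

Lemma runs_copy_input x : size x < S -> exists2 T,
  rep K (copied (St (fun=> 0) (fun _ _ => false) x) x) T &
  runs copy_input (-1, input_tape x)%Z (0%Z, T) (S ^ 20).
Proof.
move=> xS; have [|T rT e] := @runs_copy (St (fun=> 0) (fun _ _ => false) x) _ x erefl (rep_init_tape x); first by [].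
have S1 : 1 < S by lia.
exists T => //; apply: (@runs_le _ _ _ (3 + (4 + (size x * (S ^ 15 + 2) + 2 + 4)))).
  have S4 : 4 <= S by lia.
    have S16 : 16 <= S * S by exact: (leq_mul S4 S4).
  have h15 : 16 <= S ^ 15.
    by apply: (@leq_trans (S ^ 2)); [rewrite -mulnn|exact: exp_mono].
  rewrite (expnD S 15 5) (expnD S 1 4) expn1.
  have h2 : 16 <= S ^ 4 by apply: (@leq_trans (S ^ 2)); [rewrite -mulnn|exact: exp_mono].
  move: (S ^ 15) (S ^ 4) h15 h2 => X Y hX hY.
  have h3 := leq_mul (leqnn (X * S)) hY; rewrite mulnA; apply: leq_trans h3.
  have h4 := leq_mul (ltnW xS) (leqnn X); rewrite [X * S]mulnC.
  have h5 := leq_mul (leqnn S) hX; rewrite mulnDr.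
  by move: (S * X) (size x * X) h4 h5 => u v; clear -xS S1; lia.
apply: runs_seq.
  exists 3 => //; apply: (@ExSeq _ _ _ _ _ 1 2); first exact: ExMv.
  apply: (@ExSeq _ _ _ _ _ 1 1); first exact: ExWr.
  exact: ExMv.
apply: runs_seq; first exact: (runs_right 2 0).
apply: (runs_seq e); exact: (runs_left 2 (-2)%Z).
Qed.

End Copy.

(** * The main program *)

(** In the sweeps, registers 3 to 8 hold the input length, the number of leaves, the steps done, the
    steps left, a truth value and the pair under test. *)
Definition regs (a b c d e g : nat) : nat -> nat :=
  fun q => match q with 3 => a | 4 => b | 5 => c | 6 => d | 7 => e | 8 => g | _ => 0 end.

Definition state_of (M : memo) a b c d e g : st := St (regs a b c d e g) M [::].

Definition mark (M : memo) (p : nat) : memo := fun b q => ((b == false) && (q == p)) || M b q.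

Definition sweep_step (len U : nat) (M : memo) (i : nat) : memo :=
  if losing M len U (i %% npos M len U) then mark M (i %% npos M len U) else M.

Fixpoint sweep (len U : nat) (M : memo) (i : nat) : memo :=
  if i is j.+1 then sweep_step len U (sweep len U M j) j else M.

Lemma setr_state_of M a b c d e g v :
  [/\ setr (state_of M a b c d e g) 4 v = state_of M a v c d e g,
      setr (state_of M a b c d e g) 5 v = state_of M a b v d e g,
      setr (state_of M a b c d e g) 6 v = state_of M a b c v e g,
      setr (state_of M a b c d e g) 7 v = state_of M a b c d v g &
      setr (state_of M a b c d e g) 8 v = state_of M a b c d e v].
Proof. by split; apply: st_eq => //; do 9?[case=> //]. Qed.

Definition M0 (x : seq bool) : memo := fun b i => b && nth false (rev x) i.

Lemma RT_seqS K S P Q s1 s2 s3 a b : 1 < S -> RT K P s1 s2 (S ^ a) -> RT K Q s2 s3 (S ^ b) ->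
  RT K (Seq P Q) s1 s3 (S ^ (a + b + 1)).
Proof. by move=> S1 HP HQ; apply: RT_le (RT_seq HP HQ); exact: exp_sum. Qed.

Lemma RT_whileS K S (f : nat -> st) r P m p q : 3 < K -> K <= S -> 2 < r < K ->
  m <= S ^ p -> (forall i, i < m -> 0 < reg (f i) r /\ RT K P (f i) (f i.+1) (S ^ q)) ->
  reg (f m) r = 0 -> RT K (whilenz r P) (f 0) (f m) (S ^ (p + q + 5)).
Proof.
move=> K4 KS rK mp H fm; apply: RT_le (RT_while K4 rK H fm).
exact: loop_cost.
Qed.

Lemma effective_run (f : fn) (E : seq nat) r : effective f -> 2 < r ->
  all (fun q => 2 < q < r) E -> exists w c, forall K, r + w < K -> exists P,
  forall M len U i d e g S, K <= S ->
    all (fun v => v <= S) (map (regs len U i d e g) E) ->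
    (forall q, r <= q -> regs len U i d e g q = 0) ->
    RT K P (state_of M len U i d e g)
      (setr (state_of M len U i d e g) r (f M (map (regs len U i d e g) E))) (S ^ c) /\
    f M (map (regs len U i d e g) E) <= S ^ c.
Proof.
move=> [_ [w [c H]]] r2 EK; exists w, c => K rK.
have [|P HP] := H K E r _ EK r2 rK; first by lia.
exists P => M len U i d e g S KS ES cl; apply: (HP (state_of M len U i d e g) S KS _ cl).
by move=> q qE; apply: (allP ES); exact: map_f.
Qed.

(** Each of the [npos] pairs is marked at most once, so [npos] plus one sweeps suffice for one that
    marks nothing new. *)
Definition rounds (M : memo) (len U : nat) : nat := npos M len U * (npos M len U).+1.

Lemma main_run : exists K P c, [/\ 7 < K & forall x S, let len := size x in
  let M := M0 x in let U := digit_base M len ^ bitlen (num_positions M len) in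
  K <= S -> len < S -> U <= S -> exists T,
  rep K (state_of (sweep len U M (rounds M len U)) len U (rounds M len U) 0
    (verdict (sweep len U M (rounds M len U)) len U) 0) T /\
  runs P (-1, input_tape x)%Z (0%Z, T) (S ^ c)].
Proof.
have v0 : effective (fun _ rho => nth 0 rho 0) := eff_var 0.
have v1 : effective (fun _ rho => nth 0 rho 1) := eff_var 1.
have v2 : effective (fun _ rho => nth 0 rho 2) := eff_var 2.
have [w1 [c1 H1]] := @effective_run (fun M rho => bitlen (num_positions M (nth 0 rho 0))) [:: 3] 6
   (eff_bitlen (eff_num_positions v0)) isT isT.
have [w2 [c2 H2]] := @effective_run (fun M rho => nth 0 rho 1 * digit_base M (nth 0 rho 0)) [:: 3; 4] 7
   (eff_mul v1 (eff_digit_base v0)) isT isT.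
have e3 : effective (fun M rho => npos M (nth 0 rho 0) (nth 0 rho 1)) by exact: eff_npos.
have [w3 [c3 H3]] := @effective_run (fun M rho => rounds M (nth 0 rho 0) (nth 0 rho 1)) [:: 3; 4] 6
   (eff_mul e3 (eff_succ e3)) isT isT.
have e5 : effective (fun M rho => nth 0 rho 2 %% npos M (nth 0 rho 0) (nth 0 rho 1)).
  exact: eff_mod v2 e3.
have [w4 [c4 H4]] := @effective_run
   (fun M rho => losing M (nth 0 rho 0) (nth 0 rho 1) (nth 0 rho 2 %% npos M (nth 0 rho 0) (nth 0 rho 1)))
   [:: 3; 4; 5] 7 (eff_losing v0 v1 e5) isT isT.
have [w5 [c5 H5]] := @effective_run _ [:: 3; 4; 5] 8 e5 isT isT.
have [w6 [c6 H6]] := @effective_run (fun M rho => verdict M (nth 0 rho 0) (nth 0 rho 1))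
   [:: 3; 4] 7 (eff_verdict v0 v1) isT isT.
pose K := 20 + w1 + w2 + w3 + w4 + w5 + w6.
have [|P1 R1] := H1 K; first by rewrite /K; lia.
have [|P2 R2] := H2 K; first by rewrite /K; lia.
have [|P3 R3] := H3 K; first by rewrite /K; lia.
have [|P4 R4] := H4 K; first by rewrite /K; lia.
have [|P5 R5] := H5 K; first by rewrite /K; lia.
have [|P6 R6] := H6 K; first by rewrite /K; lia.
have K4 : 3 < K by rewrite /K; lia.
have K9 : 9 < K by rewrite /K; lia.
(* The number of leaves is not polynomially bounded, so register 4 is multiplied by the digit base
   in an explicit loop, and [S] is required to bound the result. *)
pose A2 := Seq P2 (Seq (clear K 4) (Seq (move_to K 7 4) (dec K 6))).
(* Register 7 holds the truth value of the test, so the loop on it runs at most once and acts as a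
   conditional. *)
pose A5 := Seq P4 (Seq P5 (Seq (whilenz 7 (Seq (setbit K false 8) (dec K 7)))
   (Seq (clear K 8) (Seq (inc K 5) (dec K 6))))).
(* The step counter is bounded only by a power of [S], hence the factor [c3.+1] in the exponents of
   the programs that read it. *)
pose d4 := c3.+1 * c4; pose d5 := c3.+1 * c5.
pose L2 := c1 + (c2 + (1 + 1 + 9 + (c2 + (c2 + 4 + (c2 + 4) + 1) + 5 + (c1 + 4) + 1) + 1) + 1) + 5.
pose L5 := c3 + (d4 + (d5 + (0 + (d5 + 4 + (0 + 4) + 1) + 5 +
  (d5 + d5 + 9 + (c3 + 4 + (c3 + 4) + 1) + 1) + 1) + 1) + 1) + 5.
eexists K, (Seq (copy_input K) (Seq (inc K 4) (Seq P1 (Seq (whilenz 6 A2)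
  (Seq P3 (Seq (whilenz 6 A5) P6)))))), _; split=> // x S len M U KS lenS US.
have S1 : 1 < S by lia.
have lenS' := ltnW lenS.
have [T0 rT0 eT0] := runs_copy_input K4 KS lenS.
rewrite (_ : copied _ x = state_of M len 0 0 0 0 0) in rT0; last first.
  by apply: st_eq => //; [do 9?[case=> //]|move=> a i; rewrite /= subn0].
set N := rounds M len U.
suff H : RT K (Seq (inc K 4) (Seq P1 (Seq (whilenz 6 A2) (Seq P3 (Seq (whilenz 6 A5) P6)))))
    (state_of M len 0 0 0 0 0) (state_of (sweep len U M N) len U N 0 (verdict (sweep len U M N) len U) 0)
    (S ^ (1 + 4 + (c1 + (L2 + (c3 + (L5 + c6 + 1) + 1) + 1) + 1) + 1)).
  case: H => /(_ _ rT0)[T rT eT]; exists T; split=> //.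
  apply: runs_le (exp_sum _ _ S1) _; exact: runs_seq eT0 eT.
have E4 M' a b c d e g v : setr (state_of M' a b c d e g) 4 v = state_of M' a v c d e g.
  by case: (setr_state_of M' a b c d e g v).
have E5 M' a b c d e g v : setr (state_of M' a b c d e g) 5 v = state_of M' a b v d e g.
  by case: (setr_state_of M' a b c d e g v).
have E6 M' a b c d e g v : setr (state_of M' a b c d e g) 6 v = state_of M' a b c v e g.
  by case: (setr_state_of M' a b c d e g v).
have E7 M' a b c d e g v : setr (state_of M' a b c d e g) 7 v = state_of M' a b c d v g.
  by case: (setr_state_of M' a b c d e g v).
have E8 M' a b c d e g v : setr (state_of M' a b c d e g) 8 v = state_of M' a b c d e v.
  by case: (setr_state_of M' a b c d e g v).
apply: (RT_seqS S1 (s2 := state_of M len 1 0 0 0 0)).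
  rewrite -(E4 _ _ 0 _ _ _ _ 1); apply: (@RT_inc_le _ _ K4 KS _ 4 1) => //.
have [||r1 b1] := R1 M len 1 0 0 0 0 S KS; rewrite /= ?lenS' //.
  by do 9?[case=> //].
rewrite E6 /= in r1 b1; set L := bitlen _ in r1 b1.
apply: (RT_seqS S1 r1).
pose f i := state_of M len (digit_base M len ^ i) 0 (L - i) 0 0.
have base1 : 1 < digit_base M len by rewrite /digit_base /height; lia.
apply: (RT_seqS S1 (s2 := f L)).
  rewrite (_ : state_of _ _ _ _ _ _ _ = f 0); last by rewrite /f expn0 subn0.
  apply: RT_whileS => //.
  move=> i iL; split; first by rewrite /f /=; lia.
  have biS : digit_base M len ^ i <= S.
    by apply: leq_trans US; apply: exp_mono => //; exact: ltnW.
  have [||r2 b2] := R2 M len (digit_base M len ^ i) 0 (L - i) 0 0 S KS; rewrite /= ?lenS' ?biS //.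
    by do 9?[case=> //].
  rewrite E7 /= -expnSr in r2 b2.
  apply: (RT_seqS S1 r2).
  apply: (RT_seqS S1 (s2 := state_of M len 0 0 (L - i) (digit_base M len ^ i.+1) 0)).
    rewrite -(E4 _ _ (digit_base M len ^ i) _ _ _ _ 0); apply: (@RT_clear _ _ K4 KS _ 4 1); first by lia.
    by rewrite expn1.
  apply: (RT_seqS S1 (s2 := state_of M len (digit_base M len ^ i.+1) 0 (L - i) 0 0)).
    have := @RT_move _ _ K4 KS (state_of M len 0 0 (L - i) (digit_base M len ^ i.+1) 0) 7 4 c2.
    by rewrite E7 E4; apply => //; lia.
  have := @RT_dec_le _ _ K4 KS (state_of M len (digit_base M len ^ i.+1) 0 (L - i) 0 0) 6 c1.
  rewrite E6 /= /f subnS; apply=> //; first by lia.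
  exact: (leq_trans (leq_subr _ _) b1).
- by rewrite /f /= subnn.
rewrite /f subnn -/U.
have [||r3 b3] := R3 M len U 0 0 0 0 S KS; rewrite /= ?lenS' ?US //.
  by do 9?[case=> //].
rewrite E6 /= -/N in r3 b3; apply: (RT_seqS S1 r3).
pose g i := state_of (sweep len U M i) len U i (N - i) 0 0.
pose V := S ^ c3.+1.
have VS : S <= V by rewrite -{1}(expn1 S) exp_mono.
have NV : N <= V by apply: leq_trans b3 _; apply: exp_mono.
apply: (RT_seqS S1 (s2 := g N)).
  rewrite (_ : state_of _ _ _ _ _ _ _ = g 0); last by rewrite /g subn0.
  apply: RT_whileS => //.
  move=> i iN; split; first by rewrite /g /=; lia.
  set M' := sweep len U M i; set p := i %% npos M' len U.
  have iV : i <= V by lia.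
  have iS : i <= S ^ c3 by lia.
  have NiS : N - i <= S ^ c3 by lia.
  have lenV : len <= V by lia.
  have UV : U <= V by lia.
  have KV : K <= V by lia.
  have [||r4 b4] := R4 M' len U i (N - i) 0 0 V KV; rewrite /= ?lenV ?UV ?iV //.
    by do 9?[case=> //].
  rewrite E7 /= -/p -expnM in r4 b4.
  apply: (RT_seqS S1 r4).
  have [||r5 b5] := R5 M' len U i (N - i) (losing M' len U p) 0 V KV; rewrite /= ?lenV ?UV ?iV //.
    by do 9?[case=> //].
  rewrite E8 /= -/p -expnM in r5 b5.
  apply: (RT_seqS S1 r5).
  pose h j := if j is 0 then state_of M' len U i (N - i) (losing M' len U p) p
              else state_of (mark M' p) len U i (N - i) 0 p.
  have hm : h (losing M' len U p) = state_of (sweep len U M i.+1) len U i (N - i) 0 p.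
    by rewrite /= /sweep_step -/M' -/p /h; case: (losing _ _ _ _).
  apply: (RT_seqS S1 (s2 := h (losing M' len U p))).
    rewrite -[state_of _ _ _ _ _ _ _]/(h 0); apply: RT_whileS => //.
    - by rewrite expn0; case: (losing _ _ _ _).
    - case=> [|j]; last by case: (losing _ _ _ _).
      move=> l1; split => //; rewrite /h; case: (losing M' len U p) l1 => // _.
      apply: (RT_seqS S1 (s2 := state_of (mark M' p) len U i (N - i) 1 p)).
        rewrite (_ : state_of (mark _ _) _ _ _ _ _ _ = setm (state_of M' len U i (N - i) 1 p) false p) //.
        by apply: (@RT_setbit_le _ _ K4 KS _ false 8 d5) => //; lia.
      have := @RT_dec_le _ _ K4 KS (state_of (mark M' p) len U i (N - i) 1 p) 7 0.
      by rewrite E7 /=; apply => //; lia.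
    - by rewrite hm.
  rewrite hm; set M'' := sweep len U M i.+1.
  apply: (RT_seqS S1 (s2 := state_of M'' len U i (N - i) 0 0)).
    rewrite -(E8 _ _ _ _ _ _ p 0); apply: (@RT_clear _ _ K4 KS _ 8 d5); first by lia.
    exact: b5.
  apply: (RT_seqS S1 (s2 := state_of M'' len U i.+1 (N - i) 0 0)).
    by rewrite -(E5 _ _ _ i _ _ _ i.+1); apply: (@RT_inc_le _ _ K4 KS _ 5 c3) => //; lia.
  rewrite /g subnS -(E6 _ _ _ _ (N - i) _ _ (N - i).-1); apply: (@RT_dec_le _ _ K4 KS _ 6 c3); rewrite //=; lia.
- by rewrite /g /= subnn.
rewrite /g subnn; set W := sweep len U M N.
have [||r6 b6] := R6 W len U N 0 0 0 S KS; rewrite /= ?lenS' ?US //.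
  by do 9?[case=> //].
by rewrite E7 /= in r6.
Qed.

(** * Decoding the input *)

Definition enc_nats (ns : seq nat) : seq bool := flatten (map enc_nat ns).

Lemma size_enc_nats ns : size (enc_nats ns) = sumn ns + size ns.
Proof.
elim: ns => //= n ns IH; rewrite size_cat -/(enc_nats ns) IH /enc_nat size_rcons size_nseq; lia.
Qed.

Lemma nth_lt_size_enc ns m : m < size ns -> nth 0 ns m < size (enc_nats ns).
Proof.
rewrite size_enc_nats; elim: ns m => //= n ns IH [|m] /= lt; first by lia.
by have := IH m lt; lia.
Qed.

(* The number of ones preceded by exactly m zeros, z of which precede x. *)
Fixpoint block (x : seq bool) (z m : nat) : nat :=
  if x is b :: x' then (b && (z == m)) + block x' (z + ~~ b) m else 0.

Lemma blockE x z m :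
  \sum_(i < size x) (nth false x i && (z + \sum_(j < i) ~~ nth false x j == m)) = block x z m.
Proof.
elim: x z => [|b x IH] z; first by rewrite big_ord0.
rewrite big_ord_recl /= big_ord0 addn0 -IH; congr (_ + _); apply: eq_bigr => i _ /=.
by rewrite /bump /= add1n big_ord_recl /= addnA.
Qed.

Lemma block_enc_nats ns z m :
  block (enc_nats ns) z m = if z <= m then nth 0 ns (m - z) else 0.
Proof.
elim: ns z => [|n ns IH] z; first by rewrite nth_nil if_same.
have blockn y : block (enc_nat n ++ y) z m = n * (z == m) + block y z.+1 m.
  rewrite /enc_nat cat_rcons; elim: n {IH} => [|n IH] /=; first by rewrite addn1.
  by rewrite addn0 IH; lia.
rewrite /enc_nats /= blockn -/(enc_nats ns) IH.
case: (ltngtP z m) => [zm|zm|->]; last by rewrite subnn muln1 addn0.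
  by rewrite muln0 (_ : m - z = (m - z.+1).+1) //; lia.
by rewrite muln0.
Qed.

Lemma in_field_enc_nats ns M m : (forall i, M true i = nth false (rev (enc_nats ns)) i) ->
  in_field M (size (enc_nats ns)) m = nth 0 ns m.
Proof.
move=> Mx; set x := enc_nats ns in Mx *.
have xb i : i < size x -> in_bit M (size x) i = nth false x i.
  by move=> ix; rewrite /in_bit Mx nth_rev; [congr nth|]; lia.
rewrite -[m in RHS]subn0 -(_ : block x 0 m = nth 0 ns (m - 0)); last by rewrite block_enc_nats.
rewrite -blockE /in_field nsumE; apply: eq_bigr => i _.
rewrite xb // add0n; congr (nat_of_bool (_ && (_ == _))).
by rewrite nsumE; apply: eq_bigr => j _; rewrite xb // (ltn_trans (ltn_ord j)).
Qed.

Lemma nth_allpairs (S1 S2 R : Type) (f : S1 -> S2 -> R) s t x0 y0 z0 i j :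
  i < size s -> j < size t ->
  nth z0 [seq f x y | x <- s, y <- t] (i * size t + j) = f (nth x0 s i) (nth y0 t j).
Proof.
elim: s i => //= x s IH [|i] lt jt; rewrite nth_cat size_map.
  by rewrite mul0n jt (nth_map y0).
rewrite mulSn ifF; last by lia.
by rewrite (_ : size t + i * size t + j - size t = i * size t + j) ?IH //; lia.
Qed.

Lemma nth_pairs (T : Type) (u v : T -> nat) (L : seq T) z0 i : i < size L ->
  nth 0 (flatten [seq [:: u z; v z] | z <- L]) (2 * i) = u (nth z0 L i) /\
  nth 0 (flatten [seq [:: u z; v z] | z <- L]) (2 * i).+1 = v (nth z0 L i).
Proof. by elim: L i => //= z L IH [|i] lt //; rewrite mulnS /=; apply: IH. Qed.

Lemma size_pairs (T : Type) (u v : T -> nat) (L : seq T) :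
  size (flatten [seq [:: u z; v z] | z <- L]) = 2 * size L.
Proof. by elim: L => //= z L ->; lia. Qed.

Lemma sumn_pairs_le (T : Type) (u v : T -> nat) (L : seq T) m :
  (forall z, u z + v z <= m) -> sumn (flatten [seq [:: u z; v z] | z <- L]) <= size L * m.
Proof. by move=> H; elim: L => //= z L IH; have := H z; rewrite mulSn; lia. Qed.

Section Automaton.
Variables (k n : nat) (A : npa k n).

Definition tprio p a q : nat := if npa_trans A p a q then npa_prio A p a q else 0.
Definition triples : seq ('I_n * 'I_k * 'I_n) :=
  [seq (pa, q) | pa <- [seq (p, a) | p <- enum 'I_n, a <- enum 'I_k], q <- enum 'I_n].
Definition npa_nats : seq nat :=
  n :: nat_of_ord (npa_init A) ::
  flatten [seq [:: nat_of_bool (npa_trans A z.1.1 z.1.2 z.2); tprio z.1.1 z.1.2 z.2] | z <- triples].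

Lemma enc_npaE : enc_npa A = enc_nats npa_nats.
Proof.
rewrite /enc_npa /enc_nats /=; congr (_ ++ (_ ++ _)).
have -> L : flatten [seq enc_nat i | i <- flatten [seq [:: nat_of_bool (npa_trans A z.1.1 z.1.2 z.2);
    tprio z.1.1 z.1.2 z.2] | z <- L]] =
  flatten [seq enc_nat (npa_trans A z.1.1 z.1.2 z.2) ++ enc_nat (tprio z.1.1 z.1.2 z.2) | z <- L].
  by elim: L => //= z L ->; rewrite catA.
by congr flatten; symmetry; exact: map_allpairs.
Qed.

Lemma size_triples : size triples = n * k * n.
Proof. by rewrite !size_allpairs !size_enum_ord. Qed.

Lemma nth_triples (p : 'I_n) (a : 'I_k) (q : 'I_n) :
  nth (p, a, q) triples ((p * k + a) * n + q) = (p, a, q).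
Proof.
have := @nth_allpairs _ _ _ (fun pa q => (pa, q)) [seq (p, a) | p <- enum 'I_n, a <- enum 'I_k]
  (enum 'I_n) (p, a) q (p, a, q) (p * k + a) q.
rewrite size_allpairs !size_enum_ord => -> //; last first.
  by have := ltn_ord p; have := ltn_ord a; clear; nia.
have := @nth_allpairs _ _ _ (fun p a => (p, a)) (enum 'I_n) (enum 'I_k) p a (p, a) p a.
by rewrite !size_enum_ord => -> //; rewrite !nth_ord_enum.
Qed.

Lemma triple_index (p : 'I_n) (a : 'I_k) (q : 'I_n) : (p * k + a) * n + q < n * k * n.
Proof.
have hp := ltn_ord p; have ha := ltn_ord a; have hq := ltn_ord q.
have h : p * k + a < n * k by clear -hp ha; nia.
by clear -h hq; nia.
Qed.

Lemma nth_npa_nats (p : 'I_n) (a : 'I_k) (q : 'I_n) :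
  nth 0 npa_nats (2 + 2 * ((p * k + a) * n + q)) = npa_trans A p a q /\
  nth 0 npa_nats (3 + 2 * ((p * k + a) * n + q)) = tprio p a q.
Proof.
have lt := triple_index p a q; rewrite -size_triples in lt.
have [] := @nth_pairs _ (fun z => nat_of_bool (npa_trans A z.1.1 z.1.2 z.2))
  (fun z => tprio z.1.1 z.1.2 z.2) triples (p, a, q) _ lt.
by rewrite nth_triples.
Qed.

Lemma nth_npa_nats_le d i : prio_bounded A d -> i < n * k * n ->
  nth 0 npa_nats (3 + 2 * i) <= d.
Proof.
move=> Ad; rewrite -size_triples => lt.
case E : triples lt => [|z0 L] //; rewrite -E => lt.
have [_] := @nth_pairs _ (fun z => nat_of_bool (npa_trans A z.1.1 z.1.2 z.2))
  (fun z => tprio z.1.1 z.1.2 z.2) triples z0 _ lt.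
rewrite /npa_nats => /= ->; rewrite /tprio; case: ifP => // tr; exact: Ad.
Qed.

Lemma size_npa_nats : size npa_nats = 2 + 2 * (n * k * n).
Proof. by rewrite /= size_pairs size_triples. Qed.

Lemma size_enc_npa_le d : prio_bounded A d ->
  size (enc_nats npa_nats) <= 2 * n + 2 + n * k * n * (d + 3).
Proof.
move=> Ad; rewrite size_enc_nats size_npa_nats /=.
have := @sumn_pairs_le _ (fun z => nat_of_bool (npa_trans A z.1.1 z.1.2 z.2))
  (fun z => tprio z.1.1 z.1.2 z.2) triples (d + 1).
rewrite size_triples => H; have {}H := H _.
have h : forall z : 'I_n * 'I_k * 'I_n, npa_trans A z.1.1 z.1.2 z.2 + tprio z.1.1 z.1.2 z.2 <= d + 1.
  move=> z; rewrite /tprio; case E : (npa_trans _ _ _ _) => //.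
  by have := Ad _ _ _ E; lia.
have := H h; have := ltn_ord (npa_init A); move: (sumn _) => s; clear; nia.
Qed.

End Automaton.

(** * Leaves as numbers and stabilisation of the sweeps *)

Lemma bitlenE v : 0 < v -> bitlen v = (trunc_log 2 v).+1.
Proof.
move=> v0; have /andP[lo hi] := trunc_log_bounds (isT : 1 < 2) v0.
have H n m : nsum n (fun i => (i < m : nat)) = minn n m.
  elim: n => [|n IH]; first by rewrite min0n.
  by rewrite /nsum /= -/(nsum n _) IH; lia.
rewrite /bitlen (_ : (fun i => _) = fun i => (i < (trunc_log 2 v).+1 : nat)).
  by rewrite H; have := ltn_expl (trunc_log 2 v) (isT : 1 < 2); lia.
apply: functional_extensionality => i; congr nat_of_bool; rewrite idivE divn_gt0 ?expn_gt0 //.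
apply/idP/idP => [h|]; last first.
  by rewrite ltnS => h; apply: leq_trans lo; rewrite leq_exp2l.
by rewrite -(@ltn_exp2l 2) //; apply: leq_ltn_trans h hi.
Qed.

Lemma bitlen_gt v : v < 2 ^ bitlen v.
Proof.
case: (posnP v) => [->|v0]; first by rewrite expn_gt0.
by rewrite bitlenE //; have /andP[] := trunc_log_bounds (isT : 1 < 2) v0.
Qed.

Lemma exp_bitlen_le v : 0 < v -> 2 ^ bitlen v <= 2 * v.
Proof.
move=> v0; rewrite bitlenE // expnS leq_mul2l /=.
by have /andP[] := trunc_log_bounds (isT : 1 < 2) v0.
Qed.

Lemma cutval_rcons H j s x : cutval H j (rcons s x) =
  cutval H j s * H.*2.+1 + (if all (big H j) s then cdig H j x else 0).
Proof.
elim: s => [|y s IH] /=; first by rewrite expn0 muln1 if_same addn0.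
rewrite size_rcons IH expnS; case: ifP => _ /=; last by lia.
by move: (H.*2.+1 ^ size s) => X; lia.
Qed.

Section Digits.
Variables (M : memo) (len : nat).
Let H := height M len.
Let b := digit_base M len.
Let l := bitlen (num_positions M len).
Let U := b ^ l.

Lemma digit_baseE : b = H.*2.+1. Proof. by rewrite /b /digit_base mul2n. Qed.

(** The least significant digit comes first: the number [u] merely enumerates the leaves, and their
    order is computed by [horner]. *)
Definition digl (u : nat) : seq nat := mkseq (digit M len u) l.

Lemma digl_ok u : size (digl u) = l /\ digits H (digl u).
Proof.
split; first exact: size_mkseq.
by apply/allP => x /mapP[i _ ->]; rewrite -digit_baseE ltn_mod /digit_base.
Qed.

Lemma hornerE j u : horner M len U j u = cutval H j (digl u).
Proof.
have [sz dg] := digl_ok u; rewrite -[digl u]take_size sz /horner -/l -/H -/b.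
set F := (fun acc i => _).
suff key i : i <= l -> prec F 0 i = cutval H j (take i (digl u)) by exact: key.
elim: i => [|i IH] il; first by rewrite take0.
rewrite [LHS]/(F (prec F 0 i) i) IH 1?ltnW // /F (take_nth 0) ?sz // cutval_rcons -digit_baseE nth_mkseq //.
rewrite (_ : nall i _ = all (big H j) (take i (digl u))); last first.
  rewrite /digl /mkseq -map_take take_iota (minn_idPl (ltnW il)).
  apply/nallP/allP => [h x /mapP[i']|h i' i'i]; last first.
    by apply: h; apply: map_f; rewrite mem_iota.
  by rewrite mem_iota => i'i ->; apply: h.
(* The value of [i.+1] digits is below [b ^ i.+1], hence below [U], so the cap has no effect. *)
apply/minn_idPl; have := @cutval_lt H j (take i.+1 (digl u)).
rewrite size_take sz -digit_baseE (_ : (if _ then _ else _) = i.+1); last by case: ltnP => //; lia.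
rewrite (take_nth 0) ?sz // cutval_rcons -digit_baseE nth_mkseq // => lt.
apply: leq_trans (ltnW (lt _)) _; last by rewrite leq_exp2l // /b /digit_base /height; lia.
rewrite /digits all_rcons; apply/andP; split.
  by rewrite -digit_baseE ltn_mod /digit_base.
by apply/allP => x /mem_take xd; exact: (allP dg).
Qed.

Lemma progress_leafE p u u' : progress_leaf M len U p u u' = progress H p (digl u) (digl u').
Proof. by rewrite /progress_leaf /progress !hornerE. Qed.

Lemma digl_surj s : size s = l -> digits H s -> exists2 u, u < U & digl u = s.
Proof.
move=> sz dg; pose num := foldr (fun x acc => x + b * acc) 0.
have numP t : digits H t -> num t < b ^ size t /\
    forall i, i < size t -> idiv b (num t) i %% b = nth 0 t i.
  elim: t => [|x t IH] /=; first by rewrite expn0.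
  rewrite -digit_baseE => /andP[xb /IH[lt nt]]; split.
    by rewrite expnS; move: (num t) (b ^ size t) lt xb => m X; clear; nia.
  have b0 : 0 < b by rewrite digit_baseE.
  case=> [|i] lti; first by rewrite /idiv /= addnC mulnC modnMDl modn_small.
  rewrite [RHS]/= -nt // !idivE expnS divnMA; congr (_ %/ _ %% _).
  by rewrite addnC mulnC divnMDl // divn_small // addn0.
have [lt nt] := numP s dg; exists (num s); first by rewrite /U -sz.
apply: (@eq_from_nth _ 0); first by rewrite size_mkseq sz.
by move=> i; rewrite size_mkseq => il; rewrite nth_mkseq // /digit nt ?sz.
Qed.

End Digits.

Lemma in_field_ext (M M' : memo) len : M true = M' true -> in_field M len = in_field M' len.
Proof. by move=> e; apply: functional_extensionality => m; rewrite /in_field /in_bit e. Qed.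

Section Sweep.
Variables (len U : nat).

(** Sweeps write only the array [false], while all parameters are read from the array [true]. *)
Lemma same_params (M M' : memo) : M true = M' true ->
  [/\ in_k M len = in_k M' len, in_n1 M len = in_n1 M' len, in_n2 M len = in_n2 M' len,
      dead_value M len = dead_value M' len & npos M len U = npos M' len U].
Proof.
move=> /in_field_ext e; have {}e := e len.
have e1 : in_k M len = in_k M' len by rewrite /in_k e.
have e2 : in_n1 M len = in_n1 M' len by rewrite /in_n1 e.
have e3 : in_offset2 M len = in_offset2 M' len by rewrite /in_offset2 e1 e2.
have e4 : in_n2 M len = in_n2 M' len by rewrite /in_n2 e3 e.
have e5 : dead_value M len = dead_value M' len by rewrite /dead_value /max_prio2 e1 e3 e4 e.
by split=> //; rewrite /npos /num_positions e2 e4 e5.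
Qed.

(** Marks only remove answers of Eve, so a pair once found losing remains so while the array
    fills. *)
Lemma losing_mono (M M' : memo) p : M true = M' true -> (forall q, M false q -> M' false q) ->
  losing M len U p -> losing M' len U p.
Proof.
move=> eM sub; have [e1 e2 e3 e4 _] := same_params eM; have e := in_field_ext len eM.
have e6 : in_init1 M len = in_init1 M' len by rewrite /in_init1 e.
have e7 : in_offset2 M len = in_offset2 M' len by rewrite /in_offset2 e1 e2.
have e8 : height M len = height M' len by rewrite /height /max_prio2 e1 e3 e7 e.
have e9 : digit_base M len = digit_base M' len by rewrite /digit_base e8.
have eh j u : horner M len U j u = horner M' len U j u.
  by rewrite /horner /digit e8 e9 /num_positions e2 e3 e4.
rewrite /losing e2 e3 e4 /safe e1 e2; apply: contra => /nallP h; apply/nallP => a ak.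
have /nallP h' := h a ak; apply/nallP => q qn; have := h' q qn.
rewrite /in_trans1 e e1 e2; case: (_ != 0) => //= /nexP[qB qBn /nexP[u uU /andP[pr nm]]].
rewrite /answerable e3; apply/nexP; exists qB => //; apply/nexP; exists u => //.
move: pr nm; rewrite /progress_leaf !eh /seen_code /in_trans2 /in_prio2 /in_prio1 /pos_code e e1 e2 e3 e4 e7 => -> /=.
by apply: contra; exact: sub.
Qed.

Variable M : memo.
Let T := npos M len U.

Lemma sweep_input i : sweep len U M i true = M true.
Proof.
by elim: i => //= i IH; rewrite /sweep_step; case: ifP => _ //; rewrite -IH.
Qed.

Lemma sweep_npos i : npos (sweep len U M i) len U = T.
Proof. by have [] := same_params (sweep_input i). Qed.

Lemma sweep_incr i j q : i <= j -> sweep len U M i false q -> sweep len U M j false q.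
Proof.
move=> /subnKC <-; elim: (j - i) => [|d IH] h; first by rewrite addn0.
by rewrite addnS /= /sweep_step; case: ifP => _; rewrite ?/mark /= IH ?orbT.
Qed.

Definition stable (M' : memo) : Prop := forall p, p < T -> losing M' len U p -> M' false p.

Lemma stable_next i : 0 < T -> stable (sweep len U M i) -> sweep len U M i.+1 = sweep len U M i.
Proof.
move=> T0 st; rewrite /= /sweep_step sweep_npos; case: ifP => // h.
have m := st _ (ltn_pmod i T0) h; do 2!apply: functional_extensionality => ?.
by rewrite /mark; case: eqP => //= ->; case: eqP => //= ->; rewrite m.
Qed.

Lemma sweep_stable : stable (sweep len U M (rounds M len U)).
Proof.
case: (posnP T) => [T0|T0]; first by move=> p; rewrite T0.
pose S i := sweep len U M i; pose marked i := [set p : 'I_T | S i false p].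
have persist i d : stable (S i) -> S (i + d) = S i.
  move=> st; elim: d => [|d IH]; first by rewrite addn0.
  by rewrite addnS -[RHS]IH; apply: stable_next => //; rewrite -/(S (i + d)) IH.
(* A sweep starting from an unstable array adds at least one mark, and a stable array no longer
   changes. *)
have key r : r <= #|marked (r * T)| \/ stable (S (r * T)).
  elim: r => [|r [IH|IH]]; first by left.
    have [st|nst] := Classical_Prop.classic (stable (S (r * T))).
      by right; rewrite mulSn addnC persist.
    left; have [p [pT lp np]] : exists p, [/\ p < T, losing (S (r * T)) len U p & ~~ S (r * T) false p].
      apply: Classical_Prop.NNPP => h; apply: nst => p pT lp; apply/negPn/negP => np.
      by apply: h; exists p.
    apply: leq_ltn_trans IH _; apply: proper_card; apply/properP; split.
      by apply/subsetP => q; rewrite !inE; apply: sweep_incr; rewrite mulSn leq_addl.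
    exists (Ordinal pT); rewrite inE //=.
    (* The pair [p], losing when the sweep begins, is still losing when its turn comes at step
       [r * T + p], and it is marked then. *)
    apply: (@sweep_incr (r * T + p).+1); first by rewrite mulSn; lia.
    rewrite /= /sweep_step sweep_npos modnMDl modn_small //.
    rewrite ifT; first by rewrite /mark !eqxx.
    apply: losing_mono lp; first by rewrite /S !sweep_input.
    by move=> q; apply: sweep_incr; exact: leq_addr.
  by right; rewrite mulSn addnC persist.
rewrite /rounds -/T mulnC; have [h|//] := key T.+1.
by have := leq_trans h (max_card _); rewrite card_ord ltnn.
Qed.

(** The coinduction principle for the greatest fixed point: a set of pairs that justify each other
    is never marked. It applies to any labelling closed under the moves. *)
Lemma sweep_avoids (G : nat -> Prop) :
  (forall p, G p -> ~~ M false p) ->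
  (forall (M' : memo) p, M' true = M true -> (forall q, G q -> ~~ M' false q) -> G p ->
     ~~ losing M' len U p) ->
  forall i p, G p -> ~~ sweep len U M i false p.
Proof.
move=> G0 closed; elim=> [|i IH] p Gp //=; first exact: G0.
rewrite /sweep_step; case: ifP => lo; last exact: IH.
rewrite /mark /= negb_or IH // andbT; apply/eqP => pi; move: lo; rewrite -pi.
by apply/negP; apply: closed; rewrite ?sweep_input.
Qed.

End Sweep.

(** * Correctness of the verdict *)

Section Correctness.
Variables (k n1 n2 d1 d2 : nat) (A : npa k n1) (B : npa k n2).
Hypotheses (Ad : prio_bounded A d1) (Bd : prio_bounded B d2).
Hypothesis HD : history_deterministic B.

Let x := enc_pair A B.
Let len := size x.
Let M := M0 x.
Let U := digit_base M len ^ bitlen (num_positions M len).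

Definition pair_nats : seq nat := k :: npa_nats A ++ npa_nats B.

Lemma enc_pairE : x = enc_nats pair_nats.
Proof.
rewrite -[RHS]/(enc_nat k ++ enc_nats (npa_nats A ++ npa_nats B)).
by rewrite /x /enc_pair !enc_npaE /enc_nats map_cat flatten_cat.
Qed.

Lemma in_fieldE m : in_field M len m = nth 0 pair_nats m.
Proof. by rewrite /len enc_pairE; apply: in_field_enc_nats => i; rewrite /M /M0 /= enc_pairE. Qed.

Lemma in_kE : in_k M len = k. Proof. exact: in_fieldE. Qed.
Lemma in_n1E : in_n1 M len = n1. Proof. exact: in_fieldE. Qed.
Lemma in_init1E : in_init1 M len = npa_init A. Proof. exact: in_fieldE. Qed.

Lemma in_field1 i : i < 2 + 2 * (n1 * k * n1) -> in_field M len i.+1 = nth 0 (npa_nats A) i.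
Proof. by move=> lt; rewrite in_fieldE -[LHS]/(nth 0 (npa_nats A ++ npa_nats B) i) nth_cat size_npa_nats lt. Qed.

Lemma in_field2 i : in_field M len (in_offset2 M len + i) = nth 0 (npa_nats B) i.
Proof.
rewrite in_fieldE /in_offset2 in_n1E in_kE -[LHS]/(nth 0 (npa_nats A ++ npa_nats B) (2 + 2 * (n1 * k * n1) + i)).
by rewrite nth_cat size_npa_nats ifF; [congr nth|]; lia.
Qed.

Lemma in_n2E : in_n2 M len = n2.
Proof. by rewrite /in_n2 -[in_offset2 _ _]addn0 in_field2. Qed.
Lemma in_init2E : in_init2 M len = npa_init B.
Proof. by rewrite /in_init2 -addn1 in_field2. Qed.

Lemma in_trans1E (p : 'I_n1) (a : 'I_k) (q : 'I_n1) : in_trans1 M len p a q = npa_trans A p a q.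
Proof.
have [e _] := nth_npa_nats A p a q; have lt := triple_index p a q.
by rewrite /in_trans1 in_kE in_n1E in_field1 ?e; [case: (npa_trans _ _ _ _)|lia].
Qed.

Lemma in_prio1E (p : 'I_n1) (a : 'I_k) (q : 'I_n1) :
  npa_trans A p a q -> in_prio1 M len p a q = npa_prio A p a q.
Proof.
move=> tr; have [_ e] := nth_npa_nats A p a q; have lt := triple_index p a q.
by rewrite /in_prio1 in_kE in_n1E in_field1 ?e; [rewrite /tprio tr|lia].
Qed.

Lemma in_trans2E (p : 'I_n2) (a : 'I_k) (q : 'I_n2) : in_trans2 M len p a q = npa_trans B p a q.
Proof.
have [e _] := nth_npa_nats B p a q.
by rewrite /in_trans2 in_kE in_n2E in_field2 e; case: (npa_trans _ _ _ _).
Qed.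

Lemma in_prio2E (p : 'I_n2) (a : 'I_k) (q : 'I_n2) :
  npa_trans B p a q -> in_prio2 M len p a q = npa_prio B p a q.
Proof.
move=> tr; have [_ e] := nth_npa_nats B p a q.
by rewrite /in_prio2 in_kE in_n2E in_field2 e /tprio tr.
Qed.

Lemma max_prio2E : max_prio2 M len = nmax (n2 * k * n2) (fun i => nth 0 (npa_nats B) (3 + 2 * i)).
Proof.
by rewrite /max_prio2 in_n2E in_kE; congr nmax; apply: functional_extensionality => i; rewrite in_field2.
Qed.

Lemma max_prio2_bounds : prio_bounded B (max_prio2 M len) /\ max_prio2 M len <= d2.
Proof.
rewrite max_prio2E; split=> [p a q tr|]; last by apply: nmax_lub => i; exact: nth_npa_nats_le.
have [_ e] := nth_npa_nats B p a q; rewrite /tprio tr in e.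
by rewrite -e; exact: (nmax_ub (fun i => nth 0 (npa_nats B) (3 + 2 * i))) (triple_index p a q).
Qed.

Let dB := max_prio2 M len.
Let D := dB.*2.+1.

Lemma dead_valueE : dead_value M len = D. Proof. by rewrite /dead_value /D mul2n. Qed.
Lemma num_positionsE : num_positions M len = n1 * n2 * D.+1. Proof. by rewrite /num_positions in_n1E in_n2E dead_valueE. Qed.

Lemma seen_codeE (v : pos n1 n2 dB) (a : 'I_k) (q : 'I_n2) :
  seen_code M len v.2 v.1.2 a q = seen B v a q.
Proof.
rewrite /seen_code /seen /yprio in_trans2E dead_valueE; congr maxn; case: ifP => // tr.
exact: in_prio2E.
Qed.

Definition pos_index (e : nat) (v : pos n1 n2 dB) (u : nat) : nat :=
  pos_code M len U e v.1.1 v.1.2 v.2 u.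

Lemma U_gt0 : 0 < U. Proof. by rewrite /U expn_gt0. Qed.

Lemma pos_index_decode e v u : u < U ->
  [/\ pos_index e v u %% U = u, pos_index e v u %/ U %% (dead_value M len).+1 = v.2,
      pos_index e v u %/ U %/ (dead_value M len).+1 %% in_n2 M len = v.1.2,
      pos_index e v u %/ U %/ (dead_value M len).+1 %/ in_n2 M len %% in_n1 M len = v.1.1 &
      pos_index e v u %/ U %/ (dead_value M len).+1 %/ in_n2 M len %/ in_n1 M len = e].
Proof.
move=> uU; rewrite /pos_index /pos_code in_n1E in_n2E dead_valueE.
have h1 : v.1.1 < n1 := ltn_ord v.1.1; have h2 : v.1.2 < n2 := ltn_ord v.1.2.
have h3 : v.2 < D.+1 := ltn_ord v.2; have U0 := U_gt0.
have n10 : 0 < n1 by apply: leq_ltn_trans h1.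
have n20 : 0 < n2 by apply: leq_ltn_trans h2.
rewrite modnMDl modn_small // divnMDl // (divn_small uU) addn0.
rewrite modnMDl modn_small // divnMDl // (divn_small h3) addn0.
rewrite modnMDl modn_small // divnMDl // (divn_small h2) addn0.
by rewrite modnMDl modn_small // divnMDl // (divn_small h1) addn0.
Qed.

Lemma pos_index_lt e v u : e < len -> u < U -> pos_index e v u < npos M len U.
Proof.
move=> el uU; rewrite /pos_index /pos_code /npos num_positionsE in_n1E in_n2E dead_valueE.
have h1 : v.1.1 < n1 := ltn_ord v.1.1; have h2 : v.1.2 < n2 := ltn_ord v.1.2.
have h3 : v.2 < D.+1 := ltn_ord v.2.
have step a b c m : a < b -> c < m -> a * m + c < b * m.
  by move=> ab cm; apply: (@leq_trans (a.+1 * m)); [rewrite mulSn; lia|rewrite leq_mul2r ab orbT].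
by rewrite !mulnA; do 4!apply: (step _ _ _ _) => //.
Qed.

Lemma progress_field (M' : memo) p u u' : M' true = M true ->
  progress_leaf M' len U p u u' = progress (height M len) p (digl M len u) (digl M len u').
Proof.
move=> eM; have e := in_field_ext len eM; have [e1 e2 e3 e4 _] := same_params len U eM.
have e7 : in_offset2 M' len = in_offset2 M len by rewrite /in_offset2 e1 e2.
have e8 : height M' len = height M len by rewrite /height /max_prio2 e1 e3 e7 e.
have e9 : digit_base M' len = digit_base M len by rewrite /digit_base e8.
have e10 : num_positions M' len = num_positions M len by rewrite /num_positions e2 e3 e4.
have -> : U = digit_base M' len ^ bitlen (num_positions M' len) by rewrite e9 e10.
by rewrite progress_leafE e8 /digl /digit e9 e10.
Qed.

Lemma losingP (M' : memo) e (v : pos n1 n2 dB) u : M' true = M true -> u < U ->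
  ~~ losing M' len U (pos_index e v u) <->
  forall a qA, npa_trans A v.1.1 a qA -> exists qB u',
    [/\ u' < U, ~~ M' false (pos_index e (gnext A B e v a qA qB) u') &
       progress (height M len) (gout A B e v a qA qB) (digl M len u) (digl M len u')].
Proof.
move=> eM uU; have [dB_ok _] := max_prio2_bounds.
have e' := in_field_ext len eM; have [e1 e2 e3 e4 _] := same_params len U eM.
have e7 : in_offset2 M' len = in_offset2 M len by rewrite /in_offset2 e1 e2.
have [i1 i2 i3 i4 i5] := pos_index_decode e v uU.
rewrite /losing negbK e2 e3 e4 i1 i2 i3 i4 i5 /safe e1 e2 in_kE in_n1E.
have tA p a q : in_trans1 M' len p a q = in_trans1 M len p a q by rewrite /in_trans1 e' e1 e2.
have pA p a q : in_prio1 M' len p a q = in_prio1 M len p a q by rewrite /in_prio1 e' e1 e2.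
have sB m p a q : seen_code M' len m p a q = seen_code M len m p a q.
  by rewrite /seen_code /in_trans2 /in_prio2 e' e1 e3 e4 e7.
have gE (a : 'I_k) (qA : 'I_n1) (qB : 'I_n2) : npa_trans A v.1.1 a qA ->
    outp e D (in_prio1 M len v.1.1 a qA) (seen_code M len v.2 v.1.2 a qB) = gout A B e v a qA qB.
  by move=> tr; rewrite in_prio1E // seen_codeE.
have nE (a : 'I_k) (qA : 'I_n1) (qB : 'I_n2) u' : npa_trans A v.1.1 a qA ->
    pos_code M' len U e qA qB (nextm e D (in_prio1 M len v.1.1 a qA) (seen_code M len v.2 v.1.2 a qB)) u' =
    pos_index e (gnext A B e v a qA qB) u'.
  by move=> tr; rewrite /pos_index gnextE // in_prio1E // seen_codeE /pos_code e2 e3 e4.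
split=> [/nallP h a qA tr|h].
  have /nallP := h _ (ltn_ord a) => /(_ _ (ltn_ord qA)).
  rewrite tA in_trans1E tr /= /answerable e3 in_n2E => /nexP[qB qB2 /nexP[u' u'U /andP[]]].
  have -> : qB = Ordinal qB2 by [].
  rewrite progress_field // e4 dead_valueE pA sB gE // nE // => pr nm.
  by exists (Ordinal qB2), u'.
apply/nallP => a ak; apply/nallP => qA qn; have -> : a = Ordinal ak by [].
have -> : qA = Ordinal qn by [].
rewrite tA in_trans1E; case: (boolP (npa_trans _ _ _ _)) => [tr|//]; rewrite orFb.
have [qB [u' [u'U nm pr]]] := h _ _ tr.
rewrite /answerable e3 in_n2E; apply/nexP; exists qB => //; apply/nexP; exists u' => //.
by rewrite progress_field // e4 dead_valueE pA sB gE // nE // nm andbT.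
Qed.

Let W := sweep len U M (rounds M len U).

Lemma len_gt m i : i < size pair_nats -> nth 0 pair_nats i = m -> m < len.
Proof. by move=> lt <-; rewrite /len enc_pairE; exact: nth_lt_size_enc. Qed.

Lemma W_input : W true = M true. Proof. exact: sweep_input. Qed.

Lemma pos_index_init e u :
  pos_code W len U e (in_init1 W len) (in_init2 W len) 0 u = pos_index e (ginit A B dB) u.
Proof.
have [e1 e2 e3 e4 _] := same_params len U W_input; have e' := in_field_ext len W_input.
have e7 : in_offset2 W len = in_offset2 M len by rewrite /in_offset2 e1 e2.
by rewrite /pos_index /pos_code e2 e3 e4 {1}/in_init1 {1}/in_init2 e' e7 -/(in_init1 M len) -/(in_init2 M len) in_init1E in_init2E.
Qed.

Lemma verdict_sound : verdict W len U -> forall w, lang A w -> lang B w.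
Proof.
have [dB_ok _] := max_prio2_bounds.
move=> /nallP ver w [r [runA acc]].
have x_lt i : run_prio A w r i < d1.+1 by rewrite ltnS; apply: Ad; case: runA.
have [e lim e_even] := (parity_acceptingE x_lt).1 acc.
(* The priority [e] belongs to a transition of the run, so it is one of the unary numbers of the
   input. *)
have e_lt : e < len.
  have [/(_ 0)[i [_ <-]] _] := lim; have tr := runA.2 i.
  have [_ E] := nth_npa_nats A (r i) (w i) (r i.+1); rewrite /tprio tr in E.
  apply: (@len_gt _ (4 + 2 * ((r i * k + w i) * n1 + r i.+1))).
    rewrite -[size _]/((size (npa_nats A ++ npa_nats B)).+1) size_cat size_npa_nats.
    by have := triple_index (r i) (w i) (r i.+1); clear; lia.
  rewrite -/(run_prio A w r i) in E; rewrite -E.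
  rewrite -[LHS]/(nth 0 (npa_nats A ++ npa_nats B) (3 + 2 * ((r i * k + w i) * n1 + r i.+1))).
  rewrite nth_cat size_npa_nats ifT //.
  by have := triple_index (r i) (w i) (r i.+1); clear; lia.
have := ver e e_lt; rewrite (negbTE e_even) /= => /nexP[u0 u0U]; rewrite pos_index_init => ninit.
(* The unmarked pairs are a labelling: stability of the final array gives the closure under
   moves. *)
pose good (v : pos n1 n2 dB) s := exists2 u, u < U & s = digl M len u /\ ~~ W false (pos_index e v u).
apply: (@game_sound _ _ _ A B dB e dB_ok good (height M len) (bitlen (num_positions M len)) (digl M len u0)
   w r _ _ _ runA lim).
- by move=> v _ [u uU [-> _]]; exact: digl_ok.
- move=> v _ a qA [u uU [-> nW]] tr.
  have lo : ~~ losing W len U (pos_index e v u).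
    apply: contra nW; apply: sweep_stable; exact: pos_index_lt.
  have [qB [u' [u'U nW' pr]]] := (losingP e v W_input uU).1 lo a qA tr.
  by exists qB, (digl M len u'); split=> //; exists u'.
- by exists u0.
Qed.

Lemma verdict_complete : (forall w, lang A w -> lang B w) -> verdict W len U.
Proof.
have [dB_ok _] := max_prio2_bounds.
move=> incl; apply/nallP => e e_lt; case: (boolP (odd e)) => //= e_even.
have Vl : #|pos n1 n2 dB| < 2 ^ bitlen (num_positions M len).
  rewrite !card_prod !card_ord; apply: leq_ltn_trans (bitlen_gt _).
  by rewrite num_positionsE.
have [good [goodP step [s0 g0]]] :=
  @game_complete _ _ _ A B dB e dB_ok d1 Ad e_even _ (height M len) erefl HD incl Vl.
(* The pairs of Eve's labelling justify each other, because by [digl_surj] the new label is again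
   one of the enumerated leaves. *)
pose G p := exists (v : pos n1 n2 dB) u, [/\ u < U, good v (digl M len u) & p = pos_index e v u].
have avoid p : G p -> ~~ W false p.
  apply: (sweep_avoids (G := G)) => // M' _ eM nG [v [u [uU gv ->]]].
  apply/(losingP e v eM uU) => a qA tr.
  have [qB [s' [g' pr]]] := step _ _ _ _ gv tr; have [sz dg] := goodP _ _ g'.
  have [u' u'U us'] := digl_surj sz dg; rewrite -us' in g' pr.
  by exists qB, u'; split=> //; apply: nG; exists (gnext A B e v a qA qB), u'.
have [sz dg] := goodP _ _ g0; have [u0 u0U us0] := digl_surj sz dg.
apply/nexP; exists u0 => //; rewrite pos_index_init; apply: avoid.
by exists (ginit A B dB), u0; rewrite us0.
Qed.

End Correctness.

(** * Time bound *)

Section Bounds.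
Variables (k n1 n2 d1 d2 : nat) (A : npa k n1) (B : npa k n2).
Hypotheses (Ad : prio_bounded A d1) (Bd : prio_bounded B d2) (k0 : 0 < k).

Let b := (n1 * d1.+1 * n2 * d2.+1 * k).+1.
Let len := size (enc_pair A B).
Let M := M0 (enc_pair A B).

Lemma base_bounds : [/\ 1 < b, n1 <= b, n2 <= b, k <= b & d1.+1 <= b /\ d2.+1 <= b].
Proof.
have n10 : 0 < n1 by apply: leq_ltn_trans (ltn_ord (npa_init A)).
have n20 : 0 < n2 by apply: leq_ltn_trans (ltn_ord (npa_init B)).
have pos : 0 < n1 * d1.+1 * n2 * d2.+1 * k by rewrite !muln_gt0 n10 n20 k0.
have div m : m %| n1 * d1.+1 * n2 * d2.+1 * k -> m <= b.
  by move=> dv; rewrite leqW // dvdn_leq.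
split; first by rewrite ltnS.
- by apply: div; rewrite -!mulnA dvdn_mulr.
- by apply: div; apply: dvdn_mulr; apply: dvdn_mulr; apply: dvdn_mull.
- by apply: div; apply: dvdn_mull.
split; apply: div; last by apply: dvdn_mulr; apply: dvdn_mull.
by apply: dvdn_mulr; apply: dvdn_mulr; apply: dvdn_mulr; apply: dvdn_mull.
Qed.

(** Each automaton takes at most [4 * b ^ 4] bits, and constants are absorbed since 16 is at most
    [b ^ 4]. *)
Lemma len_bound : len < b ^ 8.
Proof.
have [b1 n1b n2b kb [d1b d2b]] := base_bounds.
rewrite /len enc_pairE size_enc_nats -[size _]/((size (npa_nats A ++ npa_nats B)).+1).
rewrite -[sumn _]/(k + sumn (npa_nats A ++ npa_nats B)) sumn_cat size_cat.
have hA := size_enc_npa_le Ad; have hB := size_enc_npa_le Bd.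
rewrite !size_enc_nats in hA hB.
have cube n d : n <= b -> d.+1 <= b -> 2 * n + 2 + n * k * n * (d + 3) <= 4 * (b * b * b * b).
  move=> nb db; have h1 : n * k * n <= b * b * b by rewrite !leq_mul.
  have h2 : d + 3 <= 2 * b by lia.
  have := leq_mul h1 h2; have h3 : 2 * 2 <= b * b by exact: leq_mul.
  have := leq_mul h3 (leqnn (b * b)).
  have := leq_mul b1 (leqnn b).
  have : b * b * b * (2 * b) = 2 * (b * b * b * b) by lia.
  have : b * b * (b * b) = b * b * b * b by lia.
  by move: (b * b * b * b) (b * b) (n * k * n * (d + 3)) nb => X Y Z; clear -b1; lia.
have cA := cube _ _ n1b d1b; have cB := cube _ _ n2b d2b.
have e4 : b ^ 4 = b * b * b * b by rewrite !expnS expn0; lia.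
have h16 : 16 <= b ^ 4 by apply: (@leq_trans (2 ^ 4)) => //; rewrite leq_exp2r.
have bb : b <= b ^ 4 by rewrite -{1}(expn1 b) leq_exp2l.
rewrite (expnD b 4 4) e4 in h16 bb *.
have := leq_mul h16 (leqnn (b * b * b * b)).
move: (b * b * b * b) cA cB h16 bb hA hB => X; clear -kb.
by move: (sumn _) (sumn _) (size _) (size _) (_ + _) (_ + _) => *; lia.
Qed.

(** The two exponents are exchanged: with [L] the bit length of the number of positions,
    [(2 ^ lg.+3) ^ L] equals [(2 ^ L) ^ lg.+3], where [2 ^ L] is at most [b ^ 5]. Finally
    [5 * lg.+3] is at most [15 * lg.+1]. *)
Lemma measure_bound : digit_base M len ^ bitlen (num_positions M len) <= b ^ (15 * (trunc_log 2 d2).+1).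
Proof.
have [b1 n1b n2b kb [d1b d2b]] := base_bounds; have b0 := ltnW b1.
have [_ dB] := max_prio2_bounds A Bd; rewrite -/M -/len in dB.
set lg := trunc_log 2 d2.
have d2lg : d2 < 2 ^ lg.+1.
  case: (posnP d2) => [->|d20]; first by rewrite expn_gt0.
  by have /andP[] := trunc_log_bounds (isT : 1 < 2) d20.
have base_le : digit_base M len <= 2 ^ lg.+3.
  have e : 2 ^ lg.+3 = 4 * 2 ^ lg.+1 by rewrite !expnS !mulnA.
  rewrite /digit_base /height e; move: (2 ^ lg.+1) d2lg (max_prio2 M len) dB => X h y yd.
  by clear -h yd; lia.
have V0 : 0 < num_positions M len.
  rewrite (num_positionsE A B) !muln_gt0 /=.
  by rewrite (leq_ltn_trans _ (ltn_ord (npa_init A))) // (leq_ltn_trans _ (ltn_ord (npa_init B))).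
have Vb : 2 ^ bitlen (num_positions M len) <= b ^ 5.
  apply: leq_trans (exp_bitlen_le V0) _; rewrite (num_positionsE A B) -/M -/len.
  have h : (max_prio2 M len).*2.+2 <= 2 * b by lia.
  have := leq_mul (leq_mul n1b n2b) h.
  have h2 : 2 * 2 <= b * b by exact: leq_mul.
  have := leq_mul h2 (leqnn (b * b * b)); rewrite !expnS expn0 muln1.
  move: (n1 * n2 * _) => X; have -> : b * b * (2 * b) = 2 * (b * b * b) by lia.
  have -> : b * (b * (b * (b * b))) = b * b * (b * b * b) by lia.
  by move: (b * b * b) (b * b * (b * b * b)) => Y Z; clear; lia.
apply: (@leq_trans ((2 ^ lg.+3) ^ bitlen (num_positions M len))).
  by rewrite leq_exp2r // bitlenE.
rewrite -expnM mulnC expnM; apply: (@leq_trans ((b ^ 5) ^ lg.+3)); first by rewrite leq_exp2r.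
by rewrite -expnM leq_exp2l //; lia.
Qed.

End Bounds.

Theorem theorem4 :
  exists (M : TM) (c : nat),
    forall (k n1 n2 d1 d2 : nat) (A : npa k n1) (B : npa k n2),
      prio_bounded A d1 -> prio_bounded B d2 -> history_deterministic B ->
      exists b : bool,
        halts_within M (enc_pair A B)
          ((n1 * d1.+1 * n2 * d2.+1 * k).+1 ^ (c * (trunc_log 2 d2).+1)) b /\
        (b = true <-> forall w : word k, lang A w -> lang B w).
Proof.
have [K [P [c [K7 run]]]] := main_run.
(* The verdict is in register 7, whose square in cell 0 is square 7. *)
pose Q := Seq P (mvs DLeft 7).
exists (machine (full_code Q)), ((K + 8 + 15 + 4) * (c + 5)) => k n1 n2 d1 d2 A B Ad Bd HD.
(* Without letters there are no infinite words and the inclusion holds vacuously. *)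
case: (posnP k) => [k0|k0].
  exists true; split; last by split=> // _ w; have := ltn_ord (w 0); rewrite [X in _ < X]k0.
  have -> : enc_pair A B = false :: behead (enc_pair A B).
    have e : enc_nat k = [:: false] by rewrite k0.
    by rewrite /enc_pair e.
  have -> : n1 * d1.+1 * n2 * d2.+1 * k = 0 by rewrite k0 muln0.
  by rewrite exp1n; exact: machine_false.
set b := (n1 * _ * _ * _ * _).+1.
have [b1 _ _ _ _] := base_bounds d1 d2 A B k0; rewrite -/b in b1.
have xE : enc_pair A B = true :: behead (enc_pair A B).
  have e : enc_nat k = true :: behead (enc_nat k) by case: k k0 {A B Ad Bd HD b b1}.
  by rewrite /enc_pair e.
set x := enc_pair A B in xE *; set len := size x; set M := M0 x.
set U := digit_base M len ^ bitlen (num_positions M len).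
(* The summands make [S] dominate the number of tracks, as [K < b ^ K], the input length by
   [len_bound] and the number of leaves by [measure_bound]. *)
pose a := (K + 8 + 15 + 2) * (trunc_log 2 d2).+1.
pose S := b ^ a.
have expb i : i <= a -> b ^ i <= S by move=> ia; rewrite leq_exp2l.
have lenS : len < S.
  by apply: leq_trans (len_bound Ad Bd k0) _; apply: expb; rewrite /a; lia.
have US : U <= S.
  by apply: leq_trans (measure_bound d1 A Bd k0) _; apply: expb; rewrite /a leq_mul2r; lia.
have KS : K <= S.
  by apply: leq_trans (ltnW (ltn_expl K b1)) _; apply: expb; rewrite /a; lia.
have [T [[_ _ r2 _ _] [n le e]]] := run x S KS lenS US.
have [m lem em] := runs_left 7 0 T.
have eT : exec Q (-1, input_tape x)%Z (n + m) (0 + Z.of_nat 7, T)%Z by exact: ExSeq e em.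
rewrite xE in eT; have := machine_run eT; rewrite -xE => -[s [s_le halt]].
exists (T (0 + Z.of_nat 7)%Z == Some true); split.
  exists s; split=> //; apply: leq_trans s_le _.
  have S4 : 3 < S by lia.
  apply: (@leq_trans (S ^ (c + 5))); last first.
    by rewrite /S -expnM leq_exp2l // /a; lia.
  have h1 : 0 < S ^ c by rewrite expn_gt0; lia.
  have h4 : 12 <= S ^ 5.
    apply: (@leq_trans (S ^ 2)); last by rewrite leq_exp2l //; lia.
    by have := leq_mul S4 S4; rewrite -mulnn; lia.
  rewrite expnD; have := leq_mul (leqnn (S ^ c)) h4.
  by move: (S ^ c) (S ^ c * S ^ 5) h1 le => X Y; clear -lem; lia.
have K7r : 2 < 7 < K by rewrite K7.
have -> : (T (0 + Z.of_nat 7)%Z == Some true) = verdict (sweep len U M (rounds M len U)) len U.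
  have := r2 7 0 K7r; rewrite /cell muln0 add0n /marked => ->.
  by rewrite /=; case: (verdict _ _ _).
split; first exact: (verdict_sound Ad Bd).
exact: (verdict_complete Ad Bd HD).
Qed.
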